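(* Let $\mathbb{F}$ be a field of characteristic $0$. Every multilinear polynomial identity of arity $\le 6$ relating the Jordan product $a\circ b = a\curlywedge b+b\curlywedge a$ and the pre-Jordan product $a\bullet b = a\prec b+b\succ a$ in every tridendriform algebra over $\mathbb{F}$ is a consequence of the defining identities for post-Jordan algebras.
   Context: A tridendriform algebra over $\mathbb{F}$ is an $\mathbb{F}$-vector space with bilinear operations $\prec,\curlywedge,\succ$ satisfying, for all $a,b,c$: (i) $(a\curlywedge b)\curlywedge c = a\curlywedge(b\curlywedge c)$; (ii) $(a\prec b)\prec c = a\prec(b\prec c)+a\prec(b\curlywedge c)+a\prec(b\succ c)$; (iii) $a\succ(b\succ c) = (a\succ b)\succ c+(a\curlywedge b)\succ c+(a\prec b)\succ c$; (iv) $(a\ast_1 b)\ast_2 c = a\ast_1(b\ast_2 c)$ for $(\ast_1,\ast_2)\in\{(\succ,\prec),(\succ,\curlywedge),(\curlywedge,\prec)\}$; (v) $(a\prec b)\curlywedge c = a\curlywedge(b\succ c)$. The defining identities for post-Jordan algebras (vector spaces with bilinear operations $\circ,\bullet$) are the commutativity $a\circ b\equiv b\circ a$ and the following seven multilinear identities: \begin{align*} (1)\quad & ((c\bullet a)\circ b)\circ d + ((d\bullet a)\circ b)\circ c - ((b\circ c)\bullet a)\circ d - ((b\circ d)\bullet a)\circ c\\ &\quad - ((c\circ d)\bullet a)\circ b + ((c\circ d)\circ b)\bullet a \equiv 0,\\ (2)\quad & ((b\circ c)\bullet a)\circ d + ((b\circ d)\bullet a)\circ c + ((c\circ d)\bullet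 a)\circ b - (b\circ c)\circ(d\bullet a)\\ &\quad - (b\circ d)\circ(c\bullet a) - (c\circ d)\circ(b\bullet a) \equiv 0,\\ (3)\quad & ((a\circ b)\circ d)\circ c + ((a\circ c)\circ d)\circ b + ((b\circ c)\circ d)\circ a - (a\circ b)\circ(c\circ d)\\ &\quad - (a\circ c)\circ(b\circ d) - (a\circ d)\circ(b\circ c) \equiv 0,\\ (4)\quad & ((c\bullet a)\bullet b)\circ d + ((d\bullet a)\bullet b)\circ c - (d\bullet(a\circ b))\circ c - (d\bullet(a\bullet b))\circ c\\ &\quad - (d\bullet(b\bullet a))\circ c - ((c\bullet a)\circ d)\bullet b - ((c\bullet b)\circ d)\bullet a + ((c\circ d)\bullet b)\bullet a \equiv 0,\\ (5)\quad & (d\bullet(a\circ b))\circ c + (d\bullet(a\bullet b))\circ c + (d\bullet(b\bullet a))\circ c - (c\bullet a)\circ(d\bullet b)\\ &\quad - (c\bullet b)\circ(d\bullet a) + ((c\bullet a)\circ d)\bullet b + ((c\bullet b)\circ d)\bullet a - (c\circ d)\bullet(a\circ b)\\ &\quad - (c\circ d)\bullet(a\bullet b) - (c\circ d)\bullet(b\bullet a) \equiv 0,\\ (6)\quad & (d\bullet(a\circ b))\bullet c + (d\bullet(a\circ c))\bullet b + (d\bullet(b\circ c))\bullet a + (d\bullet(a\bullet b))\bullet c\\ &\quad + (d\bullet(a\bullet c))\bullet b + (d\bullet(b\bullet a))\bullet c + (d\bullet(b\bullet c))\bullet a + (d\bullet(c\bullet a))\bullet b\\ &\quad + (d\bullet(c\bullet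 b))\bullet a - (d\bullet a)\bullet(b\circ c) - (d\bullet b)\bullet(a\circ c) - (d\bullet c)\bullet(a\circ b)\\ &\quad - (d\bullet a)\bullet(b\bullet c) - (d\bullet a)\bullet(c\bullet b) - (d\bullet b)\bullet(a\bullet c) - (d\bullet b)\bullet(c\bullet a)\\ &\quad - (d\bullet c)\bullet(a\bullet b) - (d\bullet c)\bullet(b\bullet a) \equiv 0,\\ (7)\quad & ((d\bullet a)\bullet c)\bullet b + ((d\bullet b)\bullet c)\bullet a - (d\bullet(a\circ b))\bullet c - (d\bullet(a\circ c))\bullet b\\ &\quad - (d\bullet(b\circ c))\bullet a - (d\bullet(a\bullet b))\bullet c - (d\bullet(a\bullet c))\bullet b - (d\bullet(b\bullet a))\bullet c\\ &\quad - (d\bullet(b\bullet c))\bullet a - (d\bullet(c\bullet a))\bullet b - (d\bullet(c\bullet b))\bullet a + d\bullet((a\circ b)\circ c)\\ &\quad + d\bullet((a\bullet b)\circ c) + d\bullet((b\bullet a)\circ c) + d\bullet((a\circ b)\bullet c) + d\bullet((a\bullet b)\bullet c)\\ &\quad + d\bullet((b\bullet a)\bullet c) + d\bullet(c\bullet(a\circ b)) + d\bullet(c\bullet(a\bullet b)) + d\bullet(c\bullet(b\bullet a)) \equiv 0. \end{align*} Let $\mathrm{BW}$ be the free symmetric operad over $\mathbb{F}$ generated by two binary operations, $\circ$ (commutative) and $\bullet$ (no symmetry). Thus $\mathrm{BW}(n)$ is the space of multilinear nonassociative polynomials in $x_1,\dots,x_n$ built from $\circ$ and $\bullet$, modulo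 commutativity of $\circ$. A multilinear polynomial identity of arity $n$ relating the two products in every tridendriform algebra is an element $f\in\mathrm{BW}(n)$ that vanishes for all values of its arguments in every tridendriform algebra when $\circ,\bullet$ are interpreted by $a\circ b = a\curlywedge b+b\curlywedge a$ and $a\bullet b = a\prec b+b\succ a$. The symbol $\equiv$ means equality for all values of the arguments. An identity is a consequence of a set of multilinear identities if it belongs to the operad ideal of $\mathrm{BW}$ they generate, i.e. the smallest family of $S_n$-submodules $I(n)\subseteq\mathrm{BW}(n)$ containing them and closed under composition (substitution, on either side) with arbitrary elements of $\mathrm{BW}$. *)

(* Defs.v *)
From HB Require Import structures.
From mathcomp Require Import all_boot all_algebra all_fingroup.
From mathcomp Require Import finmap.
From mathcomp Require Import generic_quotient sesquilinear.
From mathcomp.multinomials Require Import monalg.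

Set Implicit Arguments.
Unset Strict Implicit.
Unset Printing Implicit Defensive.

Import GRing.Theory.

Local Open Scope ring_scope.
Local Open Scope quotient_scope.

Record tridendriform (F : fieldType) := Tridendriform {
  tri_carrier :> lmodType F;
  tri_prec : {bilinear tri_carrier -> tri_carrier -> tri_carrier};
  tri_curly : {bilinear tri_carrier -> tri_carrier -> tri_carrier};
  tri_succ : {bilinear tri_carrier -> tri_carrier -> tri_carrier};
  tri_curlyA : forall a b c : tri_carrier,
    tri_curly (tri_curly a b) c = tri_curly a (tri_curly b c);
  tri_prec_prec : forall a b c : tri_carrier,
    tri_prec (tri_prec a b) c =
      tri_prec a (tri_prec b c) + tri_prec a (tri_curly b c)
      + tri_prec a (tri_succ b c);
  tri_succ_succ : forall a b c : tri_carrier,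
    tri_succ a (tri_succ b c) =
      tri_succ (tri_succ a b) c + tri_succ (tri_curly a b) c
      + tri_succ (tri_prec a b) c;
  tri_succ_prec : forall a b c : tri_carrier,
    tri_prec (tri_succ a b) c = tri_succ a (tri_prec b c);
  tri_succ_curly : forall a b c : tri_carrier,
    tri_curly (tri_succ a b) c = tri_succ a (tri_curly b c);
  tri_curly_prec : forall a b c : tri_carrier,
    tri_prec (tri_curly a b) c = tri_curly a (tri_prec b c);
  tri_prec_curly : forall a b c : tri_carrier,
    tri_curly (tri_prec a b) c = tri_curly a (tri_succ b c)
}.

Definition jordan_prod (F : fieldType) (T : tridendriform F) (a b : T) : T :=
  tri_curly T a b + tri_curly T b a.

Definition prejordan_prod (F : fieldType) (T : tridendriform F) (a b : T) : T :=
  tri_prec T a b + tri_succ T b a.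

(* Nonassociative words in two binary operations; the label i stands for the
   variable x_(i+1). *)
Inductive bwterm : Type :=
  | TVar of nat
  | TCirc of bwterm & bwterm
  | TBul of bwterm & bwterm.

Fixpoint bwterm_encode (t : bwterm) : GenTree.tree nat :=
  match t with
  | TVar i => GenTree.Leaf i
  | TCirc t1 t2 => GenTree.Node 0 [:: bwterm_encode t1; bwterm_encode t2]
  | TBul t1 t2 => GenTree.Node 1 [:: bwterm_encode t1; bwterm_encode t2]
  end.

Fixpoint bwterm_decode (t : GenTree.tree nat) : bwterm :=
  match t with
  | GenTree.Leaf i => TVar i
  | GenTree.Node 0 [:: t1; t2] => TCirc (bwterm_decode t1) (bwterm_decode t2)
  | GenTree.Node _ [:: t1; t2] => TBul (bwterm_decode t1) (bwterm_decode t2)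
  | _ => TVar 0
  end.

Lemma bwterm_encodeK : cancel bwterm_encode bwterm_decode.
Proof. by elim=> //= t1 -> t2 ->. Qed.

HB.instance Definition _ := Countable.copy bwterm (can_type bwterm_encodeK).

(* Equality of words modulo commutativity of TCirc. *)
Fixpoint bwterm_comm (t u : bwterm) : bool :=
  match t, u with
  | TVar i, TVar j => i == j
  | TCirc t1 t2, TCirc u1 u2 =>
      bwterm_comm t1 u1 && bwterm_comm t2 u2
      || bwterm_comm t1 u2 && bwterm_comm t2 u1
  | TBul t1 t2, TBul u1 u2 => bwterm_comm t1 u1 && bwterm_comm t2 u2
  | _, _ => false
  end.

Lemma bwterm_comm_refl : reflexive bwterm_comm.
Proof. by elim=> //= t1 -> t2 ->. Qed.

Lemma bwterm_comm_sym : symmetric bwterm_comm.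
Proof.
elim=> [i|t1 IH1 t2 IH2|t1 IH1 t2 IH2] [j|u1 u2|u1 u2] //=.
- by rewrite !IH1 !IH2 [bwterm_comm u2 t1 && _]andbC.
- by rewrite IH1 IH2.
Qed.

Lemma bwterm_comm_trans : transitive bwterm_comm.
Proof.
move=> u t w; elim: t u w => [i|t1 IH1 t2 IH2|t1 IH1 t2 IH2] [j|u1 u2|u1 u2]
  [k|w1 w2|w1 w2] //=.
- by move=> /eqP-> /eqP->.
- case/orP=> /andP[t1u t2u] /orP[] /andP[u1w u2w]; apply/orP.
  + by left; rewrite (IH1 _ _ t1u) ?(IH2 _ _ t2u).
  + by right; rewrite (IH1 _ _ t1u) ?(IH2 _ _ t2u).
  + by right; rewrite (IH1 _ _ t1u) ?(IH2 _ _ t2u).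
  + by left; rewrite (IH1 _ _ t1u) ?(IH2 _ _ t2u).
- by move=> /andP[t1u t2u] /andP[u1w u2w]; rewrite (IH1 _ _ t1u) ?(IH2 _ _ t2u).
Qed.

Canonical bwterm_comm_equiv :=
  EquivRel bwterm_comm bwterm_comm_refl bwterm_comm_sym bwterm_comm_trans.

Definition bwmon := {eq_quot bwterm_comm}.

Fixpoint bwterm_leaves (t : bwterm) : seq nat :=
  match t with
  | TVar i => [:: i]
  | TCirc t1 t2 | TBul t1 t2 => bwterm_leaves t1 ++ bwterm_leaves t2
  end.

Fixpoint bwterm_eval (V : Type) (circ bul : V -> V -> V) (v : nat -> V)
    (t : bwterm) : V :=
  match t with
  | TVar i => v i
  | TCirc t1 t2 => circ (bwterm_eval circ bul v t1) (bwterm_eval circ bul v t2)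
  | TBul t1 t2 => bul (bwterm_eval circ bul v t1) (bwterm_eval circ bul v t2)
  end.

Definition bwmon_multilinear (n : nat) (m : bwmon) : bool :=
  perm_eq (bwterm_leaves (repr m)) (iota 0 n).

(* Meaningful only if circ is commutative: see bwmon_eval_pi. *)
Definition bwmon_eval (V : Type) (circ bul : V -> V -> V) (v : nat -> V)
    (m : bwmon) : V :=
  bwterm_eval circ bul v (repr m).

Lemma bwterm_comm_leaves (t u : bwterm) :
  bwterm_comm t u -> perm_eq (bwterm_leaves t) (bwterm_leaves u).
Proof.
elim: t u => [i|t1 IH1 t2 IH2|t1 IH1 t2 IH2] [j|u1 u2|u1 u2] //=.
- by move=> /eqP->.
- case/orP=> /andP[/IH1 p1 /IH2 p2]; first exact: perm_cat.
  by rewrite perm_sym perm_catC perm_sym; exact: perm_cat.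
- by case/andP=> /IH1 p1 /IH2 p2; exact: perm_cat.
Qed.

Lemma bwmon_multilinear_pi (n : nat) (t : bwterm) :
  bwmon_multilinear n (\pi_bwmon t) = perm_eq (bwterm_leaves t) (iota 0 n).
Proof.
apply: permPl; apply: bwterm_comm_leaves.
by apply/eqmodP; rewrite reprK.
Qed.

Lemma bwmon_eval_pi (V : Type) (circ bul : V -> V -> V) (v : nat -> V)
    (t : bwterm) :
  commutative circ ->
  bwmon_eval circ bul v (\pi_bwmon t) = bwterm_eval circ bul v t.
Proof.
move=> circC.
have: bwterm_comm (repr (\pi_bwmon t)) t.
  by apply/eqmodP; rewrite reprK.
rewrite /bwmon_eval; move: (repr _) => u.
elim: u t => [i|t1 IH1 t2 IH2|t1 IH1 t2 IH2] [j|u1 u2|u1 u2] //=.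
- by move=> /eqP->.
- by case/orP=> /andP[/IH1-> /IH2->] //; exact: circC.
- by case/andP=> /IH1-> /IH2->.
Qed.

(* The free algebra on x_1, x_2, ... with operations circ (commutative) and
   bul; the component of arity n of the operad BW is the subspace BW n below. *)
Definition bwpoly (F : fieldType) := {malg F[bwmon]}.

Section BWPoly.
Variable F : fieldType.
Implicit Types f g : bwpoly F.

Definition BW (n : nat) : {pred bwpoly F} :=
  [pred f : bwpoly F | all (bwmon_multilinear n) (enum_fset (msupp f))].

Definition bwX (i : nat) : bwpoly F := << \pi_bwmon (TVar i) >>.

Definition bwmul (op : bwterm -> bwterm -> bwterm) f g : bwpoly F :=
  \sum_(m1 <- msupp f) \sum_(m2 <- msupp g)
    << f@_m1 * g@_m2 *g \pi_bwmon (op (repr m1) (repr m2)) >>.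

Definition bwcirc : bwpoly F -> bwpoly F -> bwpoly F := bwmul TCirc.
Definition bwbul : bwpoly F -> bwpoly F -> bwpoly F := bwmul TBul.

Definition bweval (V : lmodType F) (circ bul : V -> V -> V) (v : nat -> V) f
    : V :=
  \sum_(m <- msupp f) f@_m *: bwmon_eval circ bul v m.

Definition bwsubst (v : nat -> bwpoly F) f : bwpoly F :=
  bweval bwcirc bwbul v f.

Definition bwperm (n : nat) (s : 'S_n) f : bwpoly F :=
  bwsubst (fun i => bwX (oapp (fun j : 'I_n => nat_of_ord (s j)) i (insub i))) f.

(* Partial operadic composition, where k is the arity of g; if f has arity n,
   the result f(x_1, ..., x_i, g(x_(i+1), ..., x_(i+k)), x_(i+k+1), ...) has
   arity n + k - 1. *)
Definition bwcomp (i k : nat) f g : bwpoly F :=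
  bwsubst (fun j =>
    if (j < i)%N then bwX j
    else if j == i then bwsubst (fun l => bwX (i + l)) g
    else bwX (j + k).-1) f.

Record operad_ideal (I : nat -> bwpoly F -> Prop) : Prop := OperadIdeal {
  operad_ideal_sub : forall n f, I n f -> f \in BW n;
  operad_ideal0 : forall n, I n 0;
  operad_idealD : forall n f g, I n f -> I n g -> I n (f + g);
  operad_idealZ : forall n (c : F) f, I n f -> I n (c *: f);
  operad_ideal_perm : forall n (s : 'S_n) f, I n f -> I n (bwperm s f);
  operad_ideal_compl : forall n k i f g, (i < n)%N ->
    I n f -> g \in BW k -> I (n + k).-1 (bwcomp i k f g);
  operad_ideal_compr : forall n k i f g, (i < n)%N ->
    f \in BW n -> I k g -> I (n + k).-1 (bwcomp i k f g)
}.

Definition bw_consequence (S : nat -> bwpoly F -> Prop) (n : nat) f : Prop :=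
  forall I : nat -> bwpoly F -> Prop,
    operad_ideal I -> (forall k g, S k g -> I k g) -> I n f.

Definition tridendriform_identity (n : nat) f : Prop :=
  f \in BW n /\
  forall (T : tridendriform F) (v : nat -> T),
    bweval (@jordan_prod F T) (@prejordan_prod F T) v f = 0.

Local Notation a := (bwX 0).
Local Notation b := (bwX 1).
Local Notation c := (bwX 2).
Local Notation d := (bwX 3).
Local Notation "x ∘ y" := (bwcirc x y)
  (at level 40, left associativity, format "x  ∘  y").
Local Notation "x ∙ y" := (bwbul x y)
  (at level 40, left associativity, format "x  ∙  y").

Definition post_jordan1 : bwpoly F :=
  ((c ∙ a) ∘ b) ∘ d + ((d ∙ a) ∘ b) ∘ c - ((b ∘ c) ∙ a) ∘ d - ((b ∘ d) ∙ a) ∘ c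
  - ((c ∘ d) ∙ a) ∘ b + ((c ∘ d) ∘ b) ∙ a.

Definition post_jordan2 : bwpoly F :=
  ((b ∘ c) ∙ a) ∘ d + ((b ∘ d) ∙ a) ∘ c + ((c ∘ d) ∙ a) ∘ b - (b ∘ c) ∘ (d ∙ a)
  - (b ∘ d) ∘ (c ∙ a) - (c ∘ d) ∘ (b ∙ a).

Definition post_jordan3 : bwpoly F :=
  ((a ∘ b) ∘ d) ∘ c + ((a ∘ c) ∘ d) ∘ b + ((b ∘ c) ∘ d) ∘ a - (a ∘ b) ∘ (c ∘ d)
  - (a ∘ c) ∘ (b ∘ d) - (a ∘ d) ∘ (b ∘ c).

Definition post_jordan4 : bwpoly F :=
  ((c ∙ a) ∙ b) ∘ d + ((d ∙ a) ∙ b) ∘ c - (d ∙ (a ∘ b)) ∘ c - (d ∙ (a ∙ b)) ∘ c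
  - (d ∙ (b ∙ a)) ∘ c - ((c ∙ a) ∘ d) ∙ b - ((c ∙ b) ∘ d) ∙ a
  + ((c ∘ d) ∙ b) ∙ a.

Definition post_jordan5 : bwpoly F :=
  (d ∙ (a ∘ b)) ∘ c + (d ∙ (a ∙ b)) ∘ c + (d ∙ (b ∙ a)) ∘ c - (c ∙ a) ∘ (d ∙ b)
  - (c ∙ b) ∘ (d ∙ a) + ((c ∙ a) ∘ d) ∙ b + ((c ∙ b) ∘ d) ∙ a
  - (c ∘ d) ∙ (a ∘ b) - (c ∘ d) ∙ (a ∙ b) - (c ∘ d) ∙ (b ∙ a).

Definition post_jordan6 : bwpoly F :=
  (d ∙ (a ∘ b)) ∙ c + (d ∙ (a ∘ c)) ∙ b + (d ∙ (b ∘ c)) ∙ a + (d ∙ (a ∙ b)) ∙ c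
  + (d ∙ (a ∙ c)) ∙ b + (d ∙ (b ∙ a)) ∙ c + (d ∙ (b ∙ c)) ∙ a
  + (d ∙ (c ∙ a)) ∙ b + (d ∙ (c ∙ b)) ∙ a - (d ∙ a) ∙ (b ∘ c)
  - (d ∙ b) ∙ (a ∘ c) - (d ∙ c) ∙ (a ∘ b) - (d ∙ a) ∙ (b ∙ c)
  - (d ∙ a) ∙ (c ∙ b) - (d ∙ b) ∙ (a ∙ c) - (d ∙ b) ∙ (c ∙ a)
  - (d ∙ c) ∙ (a ∙ b) - (d ∙ c) ∙ (b ∙ a).

Definition post_jordan7 : bwpoly F :=
  ((d ∙ a) ∙ c) ∙ b + ((d ∙ b) ∙ c) ∙ a - (d ∙ (a ∘ b)) ∙ c - (d ∙ (a ∘ c)) ∙ b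
  - (d ∙ (b ∘ c)) ∙ a - (d ∙ (a ∙ b)) ∙ c - (d ∙ (a ∙ c)) ∙ b
  - (d ∙ (b ∙ a)) ∙ c - (d ∙ (b ∙ c)) ∙ a - (d ∙ (c ∙ a)) ∙ b
  - (d ∙ (c ∙ b)) ∙ a + d ∙ ((a ∘ b) ∘ c) + d ∙ ((a ∙ b) ∘ c)
  + d ∙ ((b ∙ a) ∘ c) + d ∙ ((a ∘ b) ∙ c) + d ∙ ((a ∙ b) ∙ c)
  + d ∙ ((b ∙ a) ∙ c) + d ∙ (c ∙ (a ∘ b)) + d ∙ (c ∙ (a ∙ b))
  + d ∙ (c ∙ (b ∙ a)).

(* The commutativity identity is the zero element of BW 2. *)
Inductive post_jordan_identity : nat -> bwpoly F -> Prop :=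
  | PostJordanC : post_jordan_identity 2 (a ∘ b - b ∘ a)
  | PostJordan1 : post_jordan_identity 4 post_jordan1
  | PostJordan2 : post_jordan_identity 4 post_jordan2
  | PostJordan3 : post_jordan_identity 4 post_jordan3
  | PostJordan4 : post_jordan_identity 4 post_jordan4
  | PostJordan5 : post_jordan_identity 4 post_jordan5
  | PostJordan6 : post_jordan_identity 4 post_jordan6
  | PostJordan7 : post_jordan_identity 4 post_jordan7.

End BWPoly.

(* Main.v *)
(* A weight one Rota-Baxter algebra is tridendriform for x < y = x R(y), x > y = R(x) y and the
   product xy, so an identity f holds in the free Rota-Baxter algebra U on x_1, x_2, ....  Let N be
   the T-ideal generated by the post-Jordan identities.  Pairs (q, r) of elements of the free
   algebra, thought of as q + R(r), form a Jordan algebra modulo N.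

   Let X_i and G_t be free noncommuting letters standing for x_i and for R(t) in U, with values
   (x_i, 0) and (0, t).  Every term t of degree at most 6 has a lift: a Jordan polynomial s in these
   letters that evaluates to t in U and has the value (t, 0) modulo N.  The letters G_t are not free
   in U, but a greedy subfamily of them is (their linear parts are independent), and lifts can be
   taken in these.  So if f vanishes in U, its lift vanishes as an associative polynomial; since the
   value of a Jordan polynomial of degree at most 6 is determined modulo the Jordan identities by
   its associative expansion, (f, 0) vanishes modulo N.

   The difficulty is to lift R(t) when G_t is redundant.  Subtracting letters, R(t - ...) = W with W
   of order at least 2 in free generators G_t and further generators C.  The homomorphism R(k) ->
   R(k) + k of U fixes no nonconstant R-word, and it maps W to W + s where s is Jordan.  This forces
   W to contain no C, then to be invariant under reversal, and finally, in degree at most 5, to be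
   a Jordan polynomial; comparing values in W + s gives W the value (0, t - ...). *)
Require Import Defs.
From HB Require Import structures.
From Stdlib Require Import ZArith.
From mathcomp Require Import all_boot all_algebra all_fingroup.
From mathcomp Require Import finmap generic_quotient sesquilinear ssrAC ssrZ zify.
From mathcomp.multinomials Require Import monalg.
From mathcomp.classical Require Import boolp.
Set Implicit Arguments.
Unset Strict Implicit.
Unset Printing Implicit Defensive.
Import GRing.Theory.
Delimit Scope Z_scope with Z.

(** * Jordan polynomials of degree at most six *)

(** The shift R(k) -> R(k) + k comes from the double product k * k' = k R(k') + R(k) k' + k k', for
    which both R and R + 1 are multiplicative. It is valid for k in the span of the words that
    contain some x_i; on all other words R is -1. On pairs it acts as (q, r) -> (r, r).

    The letters C cannot be avoided at the start: U is generated by the x_i and all R(w x_i) with w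
    an arbitrary associative word, whereas the Jordan side only knows R(t) for terms t.

    A reversible polynomial in words of length at most three is Jordan; the first obstruction is the
    tetrad xyzt + tzyx. This is where the degree matters. In a term of degree at most 6 the operator
    R is applied to terms of degree at most 5, and a word of length at least four and degree at most
    5 has at most one letter of degree 2, the others having degree 1. The shift acts on such words,
    up to longer ones, as a power of two, so the equation for W can be solved.

    That the associative expansion determines Jordan values is the absence of special identities in
    low degree; classically the first ones have degree 8. Here it is obtained from explicit integer
    certificates. *)

Fixpoint bwcmp (t u : bwterm) : comparison :=
  match t, u with
  | TVar i, TVar j => Nat.compare i j
  | TVar _, _ => Lt
  | _, TVar _ => Gt
  | TCirc t1 t2, TCirc u1 u2 =>
      match bwcmp t1 u1 with Eq => bwcmp t2 u2 | c => c end
  | TCirc _ _, _ => Lt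
  | _, TCirc _ _ => Gt
  | TBul t1 t2, TBul u1 u2 =>
      match bwcmp t1 u1 with Eq => bwcmp t2 u2 | c => c end
  end.

Definition bwle t u := if bwcmp t u is Gt then false else true.

Fixpoint circ_sort (t : bwterm) : bwterm :=
  match t with
  | TVar i => TVar i
  | TCirc a b => let a' := circ_sort a in let b' := circ_sort b in
      if bwle a' b' then TCirc a' b' else TCirc b' a'
  | TBul a b => TBul (circ_sort a) (circ_sort b)
  end.

Definition formal := seq (Z * bwterm).

(** One pass over a sorted list: [c] is the coefficient gathered so far for the current term [t],
    and it must be zero whenever the term changes. [vanishes] starts with coefficient 0 on a dummy
    term. *)
Fixpoint collect (c : Z) (t : bwterm) (L : formal) : bool :=
  match L with
  | [::] => Z.eqb c 0
  | (c', t') :: L' =>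
      if bwcmp t t' is Eq then collect (c + c')%Z t L'
      else Z.eqb c 0 && collect c' t' L'
  end.

Definition vanishes (L : formal) : bool :=
  collect 0 (TVar 0) (sort (fun p q => bwle p.2 q.2) [seq (p.1, circ_sort p.2) | p <- L]).

Definition fscale (c : Z) (L : formal) : formal := [seq ((c * p.1)%Z, p.2) | p <- L].

(** The Jordan identity ((x x) d) x = (x x) (d x), with x polarized into [a], [b], [c]. *)
Definition jordan_formal (a b c d : bwterm) : formal := [::
  (1%Z, TCirc (TCirc (TCirc a b) d) c);
  (1%Z, TCirc (TCirc (TCirc a c) d) b);
  (1%Z, TCirc (TCirc (TCirc b c) d) a);
  ((-1)%Z, TCirc (TCirc a b) (TCirc c d));
  ((-1)%Z, TCirc (TCirc a c) (TCirc b d));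
  ((-1)%Z, TCirc (TCirc a d) (TCirc b c))].

Fixpoint splits (S : seq nat) : seq (seq nat * seq nat) :=
  match S with
  | [::] => [:: ([::], [::])]
  | x :: S' => let r := splits S' in
      [seq (x :: p.1, p.2) | p <- r] ++ [seq (p.1, x :: p.2) | p <- r]
  end.

(** Keeping the first label in the left factor selects one tree from each class modulo
    commutativity; [n] is fuel. *)
Fixpoint jtrees (n : nat) (S : seq nat) : seq bwterm :=
  match n, S with
  | n'.+1, x :: S' =>
      if nilp S' then [:: TVar x] else
      flatten [seq if nilp p.2 then [::]
                   else [seq TCirc a b | a <- jtrees n' (x :: p.1), b <- jtrees n' p.2]
              | p <- splits S']
  | _, _ => [::]
  end.

(** Instances of the Jordan identity at trees, then products of relations on fewer labels with
    trees. The identity is symmetric in its first three arguments, hence the condition on the first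
    labels of A, B, C. *)
Fixpoint jrels (n : nat) (S : seq nat) : seq formal :=
  match n with
  | 0 => [::]
  | n'.+1 =>
      flatten [seq
        flatten [seq
          flatten [seq
            let A := p.1 in let B := q.1 in let C := r.1 in let D := r.2 in
            if [&& ~~ nilp A, ~~ nilp B, ~~ nilp C, ~~ nilp D,
                   head 0 A < head 0 B & head 0 B < head 0 C]
            then flatten [seq flatten [seq [seq jordan_formal a b c d
                   | c <- jtrees n C, d <- jtrees n D]
                   | b <- jtrees n B] | a <- jtrees n A]
            else [::]
          | r <- splits q.2]
        | q <- splits p.2]
      | p <- splits S]
      ++ flatten [seq if nilp p.2 || (size p.1 < 4) then [::]
                      else [seq [seq (x.1, TCirc x.2 t) | x <- L]
                           | L <- jrels n' p.1, t <- jtrees n p.2]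
                 | p <- splits S]
  end.

Fixpoint shift_vars (k : nat) (t : bwterm) : bwterm :=
  match t with
  | TVar i => TVar (k + i)
  | TCirc a b => TCirc (shift_vars k a) (shift_vars k b)
  | TBul a b => TBul (shift_vars k a) (shift_vars k b)
  end.

(** Shapes of commutative trees: the smaller factor stands on the left and the leaves are numbered
    from left to right. *)
Fixpoint jreps (fuel n : nat) : seq bwterm :=
  match fuel with
  | 0 => [::]
  | fuel'.+1 =>
    if n == 1 then [:: TVar 0] else
    flatten [seq [seq TCirc a (shift_vars i b) | a <- jreps fuel' i, b <- jreps fuel' (n - i)]
            | i <- iota 1 n./2]
  end.

Fixpoint bwwords (t : bwterm) : seq (seq nat) :=
  match t with
  | TVar i => [:: [:: i]]
  | TCirc a b | TBul a b => let A := bwwords a in let B := bwwords b in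
     [seq u ++ v | u <- A, v <- B] ++ [seq v ++ u | u <- A, v <- B]
  end.

Fixpoint relabel (w : seq nat) (t : bwterm) : bwterm :=
  match t with
  | TVar i => TVar (nth 0 w i)
  | TCirc a b => TCirc (relabel w a) (relabel w b)
  | TBul a b => TBul (relabel w a) (relabel w b)
  end.

(** Since [zip] truncates, missing coefficients count as zero; the lists stored below omit trailing
    zeros. *)
Definition combine (cs : seq Z) (Ls : seq formal) : formal :=
  flatten [seq if Z.eqb p.1 0 then [::] else fscale p.1 p.2 | p <- zip cs Ls].

Definition proj_formal (n : nat) (cs : seq Z) : formal :=
  [seq p <- zip cs (jtrees n (iota 0 n)) | ~~ Z.eqb p.1 0].

Definition proj_sum (P : formal) (m : bwterm) : formal :=
  flatten [seq [seq (p.1, relabel w p.2) | p <- P] | w <- bwwords m].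

Definition proj_check (n : nat) (M : Z) (cs : seq Z) (rs : seq (seq Z)) : bool :=
  let P := proj_formal n cs in let R := jrels n (iota 0 n) in
  all (fun mr => vanishes (((- M)%Z, mr.1) :: proj_sum P mr.1 ++ combine (map Z.opp mr.2) R))
      (zip (jreps n n) rs).

(* Found by linear algebra over the rationals.  [projcoefn] lists the coefficients, on the basis
   [jtrees n], of a formal polynomial p such that for every shape m in [jreps n n] the sum of p(w)
   over the associative words w of m is an integer multiple of m modulo the Jordan relations
   [jrels]; the corresponding entry of [relcoefn] is the combination of relations. *)
Definition projcoef1 : seq Z :=
  [::1]%Z.
Definition relcoef1 : seq (seq Z) :=
  [::[::]]%Z.
Definition projcoef2 : seq Z :=
  [::1]%Z.
Definition relcoef2 : seq (seq Z) :=
  [::[::]]%Z.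
Definition projcoef3 : seq Z :=
  [::2;-1]%Z.
Definition relcoef3 : seq (seq Z) :=
  [::[::]]%Z.
Definition projcoef4 : seq Z :=
  [::7;-1;4;-4;3;0;0;0;0;0;-2;-4]%Z.
Definition relcoef4 : seq (seq Z) :=
  [::[::9;9;-2];[::6;6;6;6]]%Z.
Definition projcoef5 : seq Z :=
  [::5;-11;17;-2;-10;10;0;-1;7;3;-4;-8;0;0;0;2;4;-1;-14;-4;13;0;-7;7;6;-4;-8;0;0;0;0;0;0;-11;-1;7;
  14;0;0;0;0;0;0;-2;-4]%Z.
Definition relcoef5 : seq (seq Z) :=
  [::[::0;0;0;0;0;0;0;0;0;0;0;0;0;0;0;0;0;0;0;0;0;0;0;0;0;0;0;0;0;0;0;0;0;0;0;0;0;0;0;0;-11;-1;2;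
  42;-11;-1;2;42;12;12;-24;32;9;9;2;12;0;0;-4;36];[::0;0;0;0;0;0;0;0;0;0;0;0;0;0;0;0;0;0;0;0;0;0;
  0;0;0;0;0;0;0;0;0;0;0;0;0;0;0;0;0;0;-18;9;9;32;-18;9;9;32;9;9;-18;32;9;9;-18;32;12;12;12;12];
  [::0;0;0;0;0;48;0;0;0;0;0;0;0;0;0;0;0;0;0;0;48;0;0;0;0;0;0;0;0;-48;48;0;0;0;0;0;0;0;-48;0;-50;
  14;18;18;-50;14;18;18;12;12;12;12;9;9;46;-32;9;9;46;-32]]%Z.
Definition projcoef6 : seq Z :=
  [::-6;-25;17;0;-28;25;0;-10;8;2;6;11;0;0;0;14;17;-19;-11;6;-19;0;0;14;-2;6;-11;0;0;0;12;-14;5;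
  14;-7;1;-8;-2;-6;0;-14;24;-13;19;-11;0;0;0;2;10;-20;0;-7;23;0;0;0;10;7;-1;-16;11;-3;0;-9;-1;13;
  9;-17;0;0;0;-2;-15;0;0;9;0;0;0;0;0;0;0;0;0;0;0;0;0;0;0;0;0;0;0;0;0;0;0;0;0;0;0;0;8;-7;-9;-4;2;
  -15;0;8;-14;2;16;15;0;0;0;-8;19;-25;5;2;-11;0;-6;16;-20;16;3;0;0;0;8;-14;7;2;-11;3;2;0;-14;0;-4;
  14;-15;11;7;0;0;0;14;8;-14;0;-1;11;0;0;0;8;7;-5;-12;-5;21;0;-11;1;13;-5;-9;0;0;0;-10;1;0;0;-5;0;
  0;0;0;0;0;0;0;0;0;0;0;0;0;0;0;0;0;0;0;0;0;0;0;0;0;0;0;8;-8;8;0;-4;2;0;0;4;-2;0;0;0;0;0;-9;8;-6;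
  11;5;-3;0;0;-8;-2;3;3;0;0;0;3;-4;0;-1;5;-9;0;8;-8;0;1;5;0;0;0;-5;0;0;0;0;0;0;0;0;0;0;0;0;1;-1;0;
  0;0;0;0;0;0;0;0;0;0;0;0;0;0;0;0;0;0;0;0;0;2;-2;0;0;0;0;0;0;0;0;0;0;0;0;0;0;0;0;0;0;0;0;0;0;0;0;
  0;0;0;0;0;0;0;0;0;0;0;0;0;0;4;0;4;-2;0;0;-4;2;0;0;0;0;0;0;0;0;0;-4;2;0;0;4;-2]%Z.
Definition relcoef6 : seq (seq Z) :=
  [::[::0;0;0;0;0;0;0;0;0;0;0;0;0;0;0;0;0;0;0;0;0;0;0;0;0;0;0;0;0;0;0;0;0;0;0;0;0;0;0;0;0;0;0;0;0;
  0;0;0;0;0;0;0;0;0;0;0;0;0;0;0;0;0;0;0;0;0;3;0;0;0;-13;0;0;0;0;3;0;0;0;-13;0;0;0;0;0;0;0;0;0;0;0;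
  0;0;0;0;0;5;5;15;0;0;0;23;6;0;13;-8;0;0;0;0;23;6;0;13;-8;0;0;0;0;0;0;0;0;0;0;0;-31;-31;-4;-4;0;
  -9;-9;45;3;3;3;31;31;11;39;39;-10;0;0;0;4;0;0;0;0;-38;8;-67;-10;8;16;-16;-39;10;-28;0;0;0;4;0;0;
  0;0;-38;8;-67;-10;8;16;-16;-39;10;-28;0;0;0;0;0;0;0;0;0;3;0;0;0;0;0;3;0;0;0;0;0;0;0;0;0;0;0;31;
  6;0;0;0;0;31;6;0;0;0;0;0;-35;-35;3;3;-5;23;23;-89;0;0;-14;8;-35;-22;0;0;-14;8;-35;-22;0;0;0;0;0;
  0;0;0;0;0;-14;-14;58;58;-64;0;0;0;-40;-40;34;34;62;-46;-4;64;-2;-4;64;-2;39;-8;-13;39;-8;-13;10;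
  -35;-35;13;13;-89;26;-39;-26;26;-39;-26;0;0;-5;-37;-37;13;13;98;-41;12;34;6;12;34;6;-70;-70;43;
  49;3;-2;49;3;-2;-58;12;-14;0;0;0;0;1;-10;-68;1;-10;2;70;-40;31;31;-45;9;-82;-10;-59;-82;-10;2;
  70;52;17;17;-15;-51;17;-10;6;-8;44;45;32;-2;74;-8;44;45;32;-2;17;-82;1;-51;-82;1;26;41;41;-59;9;
  11;18;43;48;18;43;48;-68;0;3;33;33;-87;-87;78;-89;-54;-16;84;-54;-16;84;0;0;-5;-25;-43;76;-25;
  -43;76;-26;-56;74;0;0;0;0;0;0;-26;-20;58;-26;-20;58;-34;-20;48;-40;-20;28;0;0;0;0;0;-8;0;4;4;25;
  -31;-19;0;0;0;0;-2;48;0;-6;-1;12;17;8;-8;70;-21;16;12;11;-16;0;-31;1;-17;8;-21;8;-1;-49;11;15;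
  -26;-53;18;16;20;-104;-20;28;-13;-29;-37;21;5;14;-18;20;14;-10;0;0;0;0;0;-8;0;4;4;25;-31;-19;0;
  0;0;0;-2;48;0;-6;-1;12;17;8;-8;70;-21;16;12;11;-16;0;-31;1;-17;8;-21;8;-1;-49;11;15;-26;-53;18;
  16;20;-104;-20;28;-13;-29;-37;21;5;14;50;20;14;-10;-18;-40;-40;52;0;0;0;0;0;-31;0;-29;-9;0;-29;
  -9;0;0;0;-22;0;-22;0;0;-9;10;49;49;-8;-8;-23;52;52;117;-59;-5;-5;-2;-2;84;-54;-54;-4;-40;53;13;
  -20;-51;53;13;-20;-51;-4;-4;-5;-20;-12;-12;5;8;66;-2;0;-8;-18;-40;-30;48;-18;-40;-30;48;0;0;0;0;
  0;-49;0;-21;3;0;-21;3;0;0;0;2;0;2;0;0;-15;34;25;25;23;23;-101;63;63;75;-77;-5;-5;15;15;28;-27;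
  -27;-52;-20;67;23;-39;-62;67;23;-39;-62;28;28;-83;16;-20;-20;-17;-16;46;-22;68;-16;-18;-34;-22;
  60;-18;-34;-22;60;-18;-18;-32;68;0;0;0;0;0;-30;0;-19;13;0;-19;13;0;0;0;8;0;8;0;0;-58;-7;-1;-1;
  20;20;-59;103;103;118;-121;-8;-8;52;52;25;-65;-65;-65;-41;102;31;-58;-75;102;31;-58;-75;26;26;
  -81;-2;-47;-47;-91;68;33;-35;54;-26;-22;-18;-58;82;-22;-18;-58;82;-14;-14;-68;86;-12;-12;-26;94;
  0;0;0;0;0;-62;0;-27;1;0;-27;1;0;0;0;34;0;34;0;0;-144;65;-109;-109;44;44;-49;5;5;54;-97;-2;-2;64;
  64;73;37;37;21;11;124;43;-48;-117;124;43;-48;-117;44;44;-85;-24;-35;-35;-83;64;-83;-83;-20;62;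
  44;-42;6;-6;-24;-42;6;-6;-8;60;-8;-2;-6;62;-58;6;-10;58;-34;-4];[::0;0;0;0;0;0;0;0;0;0;0;0;0;0;
  0;0;0;0;0;0;0;0;0;0;0;0;0;0;0;0;0;0;0;0;0;0;0;0;0;0;0;0;0;0;0;0;0;0;0;0;0;0;0;0;0;0;0;0;0;0;0;0;
  0;0;0;0;-16;0;0;0;-5;0;0;0;0;-16;0;0;0;-5;0;0;0;0;0;0;0;0;0;0;0;0;0;0;0;0;7;7;-22;0;0;0;-16;0;0;
  0;-5;0;0;0;0;-16;0;0;0;-5;0;0;0;0;0;0;0;0;0;0;0;0;0;0;0;0;7;7;-22;16;16;-30;16;16;-30;5;5;-88;0;
  0;0;0;0;0;0;0;15;0;15;-1;-8;8;8;40;23;23;0;0;0;0;0;0;0;0;15;0;15;-1;-8;8;8;40;23;23;0;0;0;0;0;0;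
  0;0;0;16;0;0;0;0;0;16;0;0;0;0;0;0;0;0;0;0;0;16;0;0;0;0;0;16;0;0;0;0;0;0;0;0;-16;-16;24;-16;-16;
  24;0;0;-15;0;-15;7;0;0;-15;0;-15;7;0;0;0;0;0;0;0;0;0;0;-68;-68;7;7;41;0;0;0;-68;-68;7;7;41;-88;
  -9;51;51;-9;51;51;5;-5;-5;5;-5;-5;0;-14;-14;0;0;24;48;-84;-24;48;-84;-24;0;0;24;-84;-84;40;40;
  -9;-112;-7;40;63;-7;40;63;-24;-24;-112;-7;40;63;-7;40;63;39;39;-49;0;0;0;0;-1;-88;-24;-1;-88;0;
  24;82;-7;-7;22;0;-1;-88;-24;-1;-88;0;24;82;-7;-7;22;-23;1;-88;-16;98;98;-40;-23;-23;8;98;98;-40;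
  -23;-23;1;-1;-1;-23;-1;-1;0;14;14;-24;0;-30;0;-28;0;0;-28;0;-24;0;-30;-28;-28;-52;-52;203;24;1;
  -46;79;1;-46;79;0;0;24;1;-46;79;1;-46;79;-51;-51;55;0;0;0;0;0;0;-15;-25;27;-15;-25;27;-59;-25;
  27;-59;-25;27;0;0;0;0;0;-26;0;0;-26;-32;-32;50;0;0;0;0;-18;-18;0;78;-1;78;-1;-15;-26;1;1;70;29;
  29;-18;-18;-26;42;-27;-27;-22;1;1;-5;28;28;-92;-16;12;22;25;-55;12;22;25;-55;-41;28;28;-44;7;2;
  2;-8;0;0;0;0;0;-26;0;0;-26;-32;-32;50;0;0;0;0;-18;-18;0;78;-1;78;-1;-15;-26;1;1;70;29;29;-18;
  -18;-26;42;-27;-27;-22;1;1;-5;28;28;-92;-16;12;22;25;-55;12;22;25;-55;-41;28;28;-44;31;2;2;-8;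
  -43;-43;-49;47;0;0;0;0;0;50;0;32;-42;0;32;-42;0;0;0;18;0;18;0;0;19;10;-17;-17;19;19;4;12;12;3;
  -26;-2;-2;5;5;18;18;18;-55;-39;22;12;-7;-73;22;12;-7;-73;28;28;-92;-16;-9;-9;-36;34;7;-17;8;70;
  -15;-59;-25;31;-15;-59;-25;31;0;0;0;0;0;50;0;32;-42;0;32;-42;0;0;0;18;0;18;0;0;19;10;-17;-17;19;
  19;4;12;12;3;-26;-2;-2;5;5;18;18;18;-55;-39;22;12;-7;-73;22;12;-7;-73;28;28;-92;-16;-9;-9;-36;
  34;7;-17;8;70;-15;-59;-25;31;-15;-59;-25;31;1;1;-49;47;0;0;0;0;0;0;0;-16;-16;0;-16;-16;0;0;0;
  -46;0;-46;0;0;-57;76;51;51;-46;-46;76;51;51;35;-74;24;24;24;24;-74;-37;-37;9;9;52;-23;-23;10;52;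
  -23;-23;10;-23;-23;52;-36;-23;-23;52;-36;35;11;-34;-34;-11;-53;-53;79;-11;-53;-53;79;-17;-17;
  -47;79;-17;-17;-47;79;0;0;0;0;0;0;0;16;16;0;16;16;0;0;0;0;0;0;0;0;-69;-24;-11;-11;0;0;-24;-11;
  -11;-69;18;30;30;30;30;18;-13;-13;-13;-13;36;-21;-21;-42;36;-21;-21;-42;-21;-21;36;-42;-21;-21;
  36;-42;-13;-13;-8;-8;5;41;41;-25;-19;41;41;-25;-13;11;35;-25;-13;11;35;-25;-15;9;47;47];[::0;0;
  0;0;0;0;0;0;0;0;0;0;0;0;0;0;0;0;0;0;0;0;0;0;0;0;0;0;0;0;0;0;0;0;0;0;0;0;0;0;0;0;0;0;0;0;0;0;0;0;
  0;0;0;0;0;0;0;0;0;0;0;0;0;0;0;0;0;0;0;0;0;0;0;0;0;0;0;0;0;0;0;0;0;0;0;0;0;0;0;0;0;0;0;0;0;0;0;0;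
  0;0;0;0;14;14;0;14;14;0;0;0;0;14;14;0;14;14;0;0;0;0;0;0;0;0;0;0;0;-29;-29;0;0;0;-29;-29;19;19;
  19;-15;24;24;1;24;24;1;0;0;0;8;0;0;0;0;-38;0;-26;-22;8;0;0;-26;-22;-12;0;0;0;8;0;0;0;0;-38;0;
  -26;-22;8;0;0;-26;-22;-12;0;0;0;0;0;0;0;0;0;19;0;0;0;0;0;19;0;0;0;0;0;0;0;0;0;0;0;24;14;0;0;0;0;
  24;14;0;0;0;0;0;-32;-32;0;0;8;14;14;-50;0;0;-15;0;-44;-31;0;0;-15;0;-44;-31;0;0;0;0;0;0;0;0;0;0;
  -7;-7;37;37;-68;0;0;0;-22;-22;25;25;49;-29;15;43;-1;15;43;-1;24;14;0;24;14;0;-8;-24;-24;14;14;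
  -50;-8;-36;-23;-8;-36;-23;0;0;8;-22;-22;25;25;41;-37;15;43;-1;15;43;-1;-41;-41;21;10;-3;-3;10;
  -3;-3;-51;-4;-4;0;0;0;0;1;1;-48;1;1;-7;41;-36;31;31;-19;2;-92;1;-46;-92;1;9;57;38;38;38;0;-46;2;
  1;9;-12;38;40;43;0;57;-12;38;40;43;0;2;-92;1;-46;-92;1;38;38;38;-46;2;1;38;40;43;38;40;43;-48;0;
  -15;38;38;-75;-75;67;-50;-44;-51;58;-44;-51;58;0;0;8;-16;-38;62;-16;-38;62;-23;-38;62;0;0;0;0;0;
  0;-16;-38;70;-16;-38;70;-23;-38;70;-38;-38;38;0;0;0;0;0;0;0;-4;-4;-1;-16;-16;0;0;0;2;2;50;0;2;8;
  9;26;0;2;50;9;26;0;-9;-18;23;-36;23;-36;-27;-30;-7;-20;-20;8;-33;-33;-26;9;24;24;-116;-39;29;22;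
  -19;-39;29;22;-19;-4;20;-12;-12;0;0;0;0;0;0;0;-4;-4;-1;-16;-16;0;0;0;2;2;50;0;2;8;9;26;0;2;50;9;
  26;0;-9;-18;23;-36;23;-36;-27;-30;-7;-20;-20;8;-33;-33;-26;9;24;24;-116;-39;29;22;-19;-39;29;22;
  -19;44;20;-12;-12;-15;-42;-42;70;0;0;0;0;0;0;0;-16;-16;0;-16;-16;0;0;0;-16;0;-16;0;0;4;33;39;39;
  -16;-16;33;39;39;36;-39;11;11;11;11;-21;-45;-45;-11;-11;27;-25;-25;-2;27;-25;-25;-2;-10;-10;61;
  -46;-10;-10;61;-46;56;8;-30;-30;-12;-40;-40;70;-12;-40;-40;70;0;0;0;0;0;-51;0;-22;12;0;-22;12;0;
  0;0;4;0;4;0;0;-52;-9;-1;-1;3;3;-69;107;107;138;-94;-37;-37;53;53;42;-63;-63;-56;-16;85;42;-35;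
  -67;85;42;-35;-67;29;29;-46;-12;-53;-53;-110;40;31;-17;52;22;-16;-23;-38;70;-16;-23;-38;70;-16;
  -16;-38;70;0;0;0;0;0;-51;0;-22;12;0;-22;12;0;0;0;4;0;4;0;0;-52;-9;-1;-1;3;3;-69;107;107;138;-94;
  -37;-37;53;53;50;-63;-63;-56;-16;85;42;-35;-67;85;42;-35;-67;29;29;-46;-12;-53;-53;-110;40;31;
  -17;52;22;-16;-23;-38;62;-16;-23;-38;62;-16;-16;-38;62;-4;-4;-39;78;0;0;0;0;0;-27;0;-3;39;0;-3;
  39;0;0;0;-3;0;-3;0;0;-98;77;-2;-2;10;10;-3;-23;-23;14;-27;39;39;10;10;5;-31;-31;6;-22;60;-22;
  -31;-31;60;-22;-31;-31;-45;-45;-15;-15;-20;-20;7;-25;-20;-20;7;-25;29;-35;2;2;-19;-35;2;2;-3;45;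
  -4;-4;-7;41;-35;0;-7;41;-35];[::0;0;0;0;0;0;0;0;0;0;0;0;0;0;0;0;0;0;0;0;0;0;0;0;0;0;0;0;0;0;0;0;
  0;0;0;0;0;0;0;0;0;0;0;0;0;0;0;0;0;0;0;0;0;0;0;0;0;0;0;0;0;0;0;0;0;0;-22;0;0;0;14;0;0;0;0;-22;0;
  0;0;14;0;0;0;0;0;0;0;0;0;0;0;0;0;0;0;0;-4;-4;-18;0;0;0;6;-44;0;16;-10;0;0;0;0;6;-44;0;16;-10;0;
  0;0;0;0;0;0;0;0;0;0;12;12;-8;-8;0;-8;-8;50;-22;-22;36;6;6;0;18;18;0;0;0;0;0;0;0;0;0;0;0;-16;38;
  -16;-24;0;-26;26;-6;0;0;0;0;0;0;0;0;0;0;-16;38;-16;-24;0;-26;26;-6;0;0;0;0;0;0;0;0;0;-22;0;0;0;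
  0;0;-22;0;0;0;0;0;0;0;0;0;0;0;6;-44;0;0;0;0;6;-44;0;0;0;0;0;12;12;-22;-22;16;6;6;-20;0;0;20;0;4;
  38;0;0;20;0;4;38;0;0;0;0;0;0;0;0;0;0;0;0;16;16;-60;0;0;0;0;0;-20;-20;44;0;-32;-4;0;-32;-4;0;18;
  -10;14;18;-10;14;16;-40;-40;16;16;-20;16;-6;-24;16;-6;-24;0;0;16;-22;-22;18;18;-14;-16;-2;54;
  -18;-2;54;-18;-36;-36;20;42;18;-18;42;18;-18;0;32;-18;0;0;0;0;14;0;-40;14;0;-4;36;16;-16;-16;
  -50;16;-10;0;-24;-10;0;-12;28;16;-20;-20;18;-22;18;0;-20;-8;16;-18;14;-18;20;-8;16;-18;14;-18;
  18;-10;14;-22;-10;14;-16;-4;-4;-24;16;0;-16;30;12;-16;30;12;-40;0;36;14;14;-18;-18;-18;-20;-38;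
  38;18;-38;38;18;0;0;16;6;2;18;6;2;18;-16;16;18;0;0;0;0;0;0;-12;-4;0;-12;-4;0;-8;-6;-2;0;-10;-6;
  0;0;0;0;0;18;0;8;2;1;-5;0;0;0;0;8;1;-5;0;-12;22;-12;2;-44;11;3;-5;39;16;-16;18;2;0;11;3;-5;35;
  12;-20;-58;-10;2;-47;-47;12;12;-40;-40;-12;56;-40;-40;-35;11;-15;46;-35;11;-15;46;0;0;0;0;0;18;
  0;8;2;1;-5;0;0;0;0;8;1;-5;0;-12;22;-12;2;-44;11;3;-5;39;16;-16;18;2;0;11;3;-5;35;12;-20;-58;-10;
  2;-47;-47;12;12;-40;-40;-12;56;-40;-40;-35;11;-15;46;5;11;-15;46;-8;32;-14;-10;0;0;0;0;0;42;0;3;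
  -22;0;3;-22;0;0;0;3;0;3;0;0;14;-32;-6;-6;-2;-2;21;28;28;-9;42;-22;-22;-2;-2;41;4;4;-33;-60;-14;
  18;-35;-35;-14;18;-35;-35;20;20;-43;-43;-16;-16;-33;48;24;-16;-33;48;-12;16;-4;0;-12;16;-4;0;0;
  0;0;0;0;-6;0;7;30;0;7;30;0;0;0;7;0;7;0;0;-6;12;-6;-6;16;16;-33;12;12;-23;-6;30;30;16;16;-13;-12;
  -12;-47;-44;34;-22;-31;-31;34;-22;-31;-31;0;0;-25;-25;-20;-20;-27;32;20;-20;-27;32;-12;8;0;4;
  -12;8;0;4;4;4;-6;-2;0;0;0;0;0;-76;0;-38;-38;0;-38;-38;0;0;0;10;0;10;0;0;-46;6;-10;-10;26;26;30;
  10;10;10;-90;22;22;24;24;-98;70;70;54;6;98;42;-14;-88;98;42;-14;-88;38;38;30;-78;10;10;22;-18;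
  -40;-80;-46;10;-16;-16;16;18;-16;-16;16;18;-16;-16;16;18;-16;-16;-16;18;0;0;0;0;0;-76;0;-38;-38;
  0;-38;-38;0;0;0;10;0;10;0;0;-82;26;-46;-46;26;26;50;-26;-26;-26;-90;22;22;24;24;-98;106;106;90;
  42;98;42;-14;-88;98;42;-14;-88;38;38;30;-78;10;10;22;-18;-80;-80;-46;10;20;0;32;-18;-20;0;32;
  -18;-20;20;32;-18;-20;20;0;-18;-24;16;-40;48];[::0;0;0;0;0;0;0;0;0;0;0;0;0;0;0;0;0;0;0;0;0;0;0;
  0;0;0;0;0;0;0;0;0;0;0;0;0;0;0;0;0;0;0;0;0;0;0;0;0;0;0;0;0;0;0;0;0;0;0;0;0;0;0;0;0;0;0;0;0;0;0;
  -4;0;0;0;0;0;0;0;0;-4;0;0;0;0;0;0;0;0;0;0;0;0;0;0;0;0;-20;-20;56;0;0;0;0;0;0;0;-4;0;0;0;0;0;0;0;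
  0;-4;0;0;0;0;0;0;0;0;0;0;0;0;0;0;0;0;-20;-20;56;0;0;72;0;0;72;4;4;96;0;0;0;0;0;0;0;0;-76;0;-76;
  4;-24;24;24;-96;-20;-20;0;0;0;0;0;0;0;0;-76;0;-76;4;-24;24;24;-96;-20;-20;0;0;0;0;0;0;0;0;0;0;0;
  0;0;0;0;0;0;0;0;0;0;0;0;0;0;0;0;0;0;0;0;0;0;0;0;0;0;0;0;0;0;0;0;0;-80;0;0;-80;0;0;76;0;76;4;0;0;
  76;0;76;4;0;0;0;0;0;0;0;0;0;0;0;0;20;20;-48;0;0;0;0;0;20;20;-48;96;-8;-28;-28;-8;-28;-28;4;-4;
  -4;4;-4;-4;56;-24;-24;0;0;-80;56;0;-48;56;0;-48;0;0;-80;0;0;20;20;40;176;24;-52;-24;24;-52;-24;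
  -48;-48;176;24;-52;-24;24;-52;-24;-56;-56;-24;0;0;0;0;-4;0;16;-4;0;64;48;-104;20;20;-56;0;-4;0;
  16;-4;0;64;48;-104;20;20;-56;20;4;96;40;-80;-80;96;20;20;24;-80;-80;96;20;20;4;-4;-4;20;-4;-4;
  -56;24;24;16;0;72;-56;48;0;-56;48;0;16;0;72;48;48;-28;-28;-216;-80;-24;52;24;-24;52;24;0;0;-80;
  -24;52;24;-24;52;24;48;48;24;0;0;0;0;0;0;-24;28;-36;-24;28;-36;24;28;-36;24;28;-36;0;0;0;0;0;-4;
  0;0;-4;-22;-22;12;0;0;0;0;-22;-22;0;44;-16;44;-16;-84;48;-28;-28;-4;-28;-28;-4;-4;12;48;-28;-28;
  60;36;36;-4;-4;-4;-40;-40;-36;64;-24;-24;-36;64;-24;-24;-64;30;30;8;-64;30;30;8;0;0;0;0;0;-4;0;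
  0;-4;-22;-22;12;0;0;0;0;-22;-22;0;44;-16;44;-16;-84;48;-28;-28;-4;-28;-28;-4;-4;12;48;-28;-28;
  60;36;36;-4;-4;-4;-40;-40;-36;64;-24;-24;-36;64;-24;-24;-64;30;30;8;-80;30;30;8;56;56;24;-40;0;
  0;0;0;0;12;0;22;-4;0;22;-4;0;0;0;22;0;22;0;0;8;-140;32;32;-6;-6;-24;48;48;28;12;-4;-4;-6;-6;128;
  -40;-40;-60;-96;64;-36;-46;-46;64;-36;-46;-46;-4;-4;-40;-40;4;4;-60;52;-12;4;-60;52;-24;24;32;
  -32;-24;24;32;-32;0;0;0;0;0;12;0;22;-4;0;22;-4;0;0;0;22;0;22;0;0;8;-140;32;32;-6;-6;-24;48;48;
  28;12;-4;-4;-6;-6;128;-40;-40;-60;-96;64;-36;-46;-46;64;-36;-46;-46;-4;-4;-40;-40;4;4;-60;52;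
  -12;4;-60;52;-24;24;32;-32;-24;24;32;-32;8;8;24;-40;0;0;0;0;0;0;0;0;0;0;0;0;0;0;0;-48;0;-48;0;0;
  -72;-24;72;72;-48;-48;-24;72;72;24;-80;54;54;54;54;-80;-76;-76;-28;-28;112;-44;-44;-24;112;-44;
  -44;-24;-44;-44;112;-72;-44;-44;112;-72;-16;0;-44;-44;-24;48;48;24;-24;48;48;24;-24;-24;48;24;
  -24;-24;48;24;0;0;0;0;0;0;0;0;0;0;0;0;0;0;0;-48;0;-48;0;0;-120;128;24;24;-48;-48;128;24;24;-24;
  -80;54;54;54;54;-80;-28;-28;20;20;112;-44;-44;-24;112;-44;-44;-24;-44;-44;112;-72;-44;-44;112;
  -72;0;0;-44;-44;24;-56;-56;-24;40;-56;-56;-24;40;24;-56;-24;40;24;-56;-24;40;24;-32;-32];[::0;0;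
  0;0;0;0;0;0;0;0;0;0;0;0;0;0;0;0;0;0;0;0;0;0;0;0;0;0;0;0;0;0;0;0;0;0;0;0;0;0;0;0;0;0;0;0;0;0;0;0;
  0;0;0;0;0;0;0;0;0;0;0;0;0;0;0;0;0;0;0;0;0;0;0;0;0;0;0;0;0;0;0;0;0;0;0;0;0;0;0;0;0;0;0;0;0;0;0;0;
  0;0;0;0;0;12;0;0;12;0;0;0;0;0;12;0;0;12;0;0;0;0;0;0;0;0;0;0;0;-13;-13;0;0;0;-13;-13;25;-3;-3;3;
  0;0;3;0;0;3;0;0;0;0;0;0;0;0;0;0;10;-12;0;0;0;10;-12;10;0;0;0;0;0;0;0;0;0;0;10;-12;0;0;0;10;-12;
  10;0;0;0;0;0;0;0;0;0;-3;0;0;0;0;0;-3;0;0;0;0;0;0;0;0;0;0;0;0;12;0;0;0;0;0;12;0;0;0;0;0;-26;-26;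
  0;0;26;0;0;-12;0;0;-23;0;-36;-25;0;0;-23;0;-36;-25;0;0;0;0;0;0;0;0;0;0;3;3;-8;-8;7;0;0;0;-10;
  -10;12;12;22;-7;12;24;10;12;24;10;0;12;0;0;12;0;-26;0;0;0;0;-12;-26;-10;1;-26;-10;1;0;0;26;-10;
  -10;12;12;-4;-33;12;24;10;12;24;10;-13;-13;5;3;10;10;3;10;10;-12;13;13;0;0;0;0;3;3;-4;3;3;9;13;
  -2;-13;-13;-25;-12;-48;3;-16;-48;3;9;13;36;12;12;0;-16;-12;3;9;-2;36;2;13;0;13;-2;36;2;13;0;-12;
  -48;3;-16;-48;3;36;12;12;-16;-12;3;36;2;13;36;2;13;-4;0;-93;0;0;-10;-10;14;-12;-13;-34;23;-13;
  -34;23;0;0;26;-13;-23;23;-13;-23;23;-10;-23;23;0;0;0;0;0;0;-13;-23;49;-13;-23;49;-10;-23;49;-31;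
  -31;1;0;0;0;0;0;0;0;21;21;7;-19;-19;0;0;0;16;-5;46;0;-5;13;-18;36;-29;16;46;-18;36;-29;-50;0;25;
  -53;25;-53;33;7;-30;-7;-7;0;-54;-54;-40;5;20;20;-108;-44;30;6;14;-44;30;6;14;-8;36;-28;-28;0;0;
  0;0;0;0;0;21;21;7;-19;-19;0;0;0;16;-5;46;0;-5;13;-18;36;-29;16;46;-18;36;-29;-50;0;25;-53;25;
  -53;33;7;-30;-7;-7;0;-54;-54;-40;5;20;20;-108;-44;30;6;14;-44;30;6;14;-4;36;-28;-28;-10;-31;-31;
  65;0;0;0;0;0;0;0;6;6;0;6;6;0;0;0;10;0;10;0;0;13;-12;6;6;10;10;-12;6;6;-17;3;-4;-4;-4;-4;33;-12;
  -12;-11;-11;-5;-14;-14;-12;-5;-14;-14;-12;-6;-6;5;9;-6;-6;5;9;16;12;-17;-17;-13;-23;-23;49;-13;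
  -23;-23;49;0;0;0;0;0;-33;0;4;18;0;4;18;0;0;0;-34;0;-34;0;0;-43;-3;48;48;7;7;-1;26;26;45;-26;13;
  13;-21;-21;-30;-38;-38;9;-13;39;-4;-23;23;39;-4;-23;23;-43;-43;-4;34;-33;-33;-36;0;17;13;-14;2;
  -13;-10;-23;49;-13;-10;-23;49;-13;-13;-23;49;0;0;0;0;0;-33;0;4;18;0;4;18;0;0;0;-34;0;-34;0;0;
  -43;-3;48;48;7;7;-1;26;26;45;-26;13;13;-21;-21;-4;-38;-38;9;-13;39;-4;-23;23;39;-4;-23;23;-43;
  -43;-4;34;-33;-33;-36;0;17;13;-14;2;-13;-10;-23;23;-13;-10;-23;23;-13;-13;-23;23;-21;-21;6;23;0;
  0;0;0;0;-21;0;-10;9;0;-10;9;0;0;0;-10;0;-10;0;0;-29;15;23;23;-6;-6;-24;8;8;36;-21;9;9;-6;-6;2;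
  -18;-18;10;3;26;0;0;0;26;0;0;0;-23;-23;10;10;-8;-8;-14;-5;-8;-8;-14;-5;0;-12;13;13;-4;-12;13;13;
  -4;0;13;13;-4;0;-12;13;-4;0;-12;13]]%Z.
Lemma proj_check1 : proj_check 1 1 projcoef1 relcoef1.
Proof. by vm_cast_no_check (erefl true). Qed.

Lemma proj_check2 : proj_check 2 2 projcoef2 relcoef2.
Proof. by vm_cast_no_check (erefl true). Qed.

Lemma proj_check3 : proj_check 3 4 projcoef3 relcoef3.
Proof. by vm_cast_no_check (erefl true). Qed.

Lemma proj_check4 : proj_check 4 24 projcoef4 relcoef4.
Proof. by vm_cast_no_check (erefl true). Qed.

Lemma proj_check5 : proj_check 5 48 projcoef5 relcoef5.
Proof. by vm_cast_no_check (erefl true). Qed.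

Lemma proj_check6 : proj_check 6 96 projcoef6 relcoef6.
Proof. by vm_cast_no_check (erefl true). Qed.

Local Open Scope ring_scope.

(** * Free algebras *)

HB.lock Definition mono (F : fieldType) (K : choiceType) (k : K) : {malg F[K]} := mkmalgU k 1.
Arguments mono {F K} k.

Lemma monoE (F : fieldType) (K : choiceType) (k : K) : mkmalgU k 1 = mono k :> {malg F[K]}.
Proof. by rewrite mono.unlock. Qed.

Section LinearExtension.
Variables (F : fieldType) (K : choiceType).
Implicit Types (g : {malg F[K]}) (k : K).

Definition linext (V : lmodType F) (h : K -> V) (g : {malg F[K]}) : V :=
  \sum_(k <- msupp g) g@_k *: h k.

Lemma linextEw (V : lmodType F) (h : K -> V) (d : {fset K}) g :
  (msupp g `<=` d)%fset -> linext h g = \sum_(k <- d) g@_k *: h k.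
Proof.
move=> le; rewrite /linext [LHS](big_fset_incl _ le) //= => x xd /mcoeff_outdom ->.
by rewrite scale0r.
Qed.

Lemma linextP (V : lmodType F) (h : K -> V) : linear (linext h).
Proof.
move=> a f g.
pose d := (msupp f `|` msupp g)%fset.
have df : (msupp f `<=` d)%fset by apply: fsubsetUl.
have dg : (msupp g `<=` d)%fset by apply: fsubsetUr.
have dfg : (msupp (a *: f + g) `<=` d)%fset.
  apply: fsubset_trans (msuppD_le _ _) _; apply: fsetSU; exact: msuppZ_le.
rewrite (linextEw _ df) (linextEw _ dg) (linextEw _ dfg) scaler_sumr -big_split.
by apply: eq_bigr => k _; rewrite mcoeffD mcoeffZ scalerDl scalerA.
Qed.

HB.instance Definition _ (V : lmodType F) (h : K -> V) :=
  GRing.isLinear.Build F {malg F[K]} V _ (linext h) (linextP h).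

Lemma linextZU (V : lmodType F) (h : K -> V) c k : linext h << c *g k >> = c *: h k.
Proof. by rewrite (linextEw _ msuppU_le) big_seq_fset1 mcoeffUU. Qed.

Lemma linextU (V : lmodType F) (h : K -> V) k : linext h (mono k) = h k.
Proof. by rewrite -monoE linextZU scale1r. Qed.

Lemma malgZU c k : << c *g k >> = c *: (mono k) :> {malg F[K]}.
Proof. by rewrite -monoE; apply/malgP => k'; rewrite mcoeffZ !mcoeffU mulrnAr mulr1. Qed.

Lemma mcoeff_mono k k' : (mono k : {malg F[K]})@_k' = (k == k')%:R.
Proof. by rewrite -monoE mcoeffU. Qed.

Lemma malg_sumU g : g = \sum_(k <- msupp g) g@_k *: (mono k).
Proof. by rewrite {1}[g]monalgE; apply: eq_bigr => k _; rewrite malgZU. Qed.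

Lemma linext_id g : linext (fun k => (mono k)) g = g.
Proof. by rewrite [RHS]malg_sumU. Qed.

Lemma linear_linext (V : lmodType F) (f : {linear {malg F[K]} -> V}) g :
  f g = linext (fun k => f (mono k)) g.
Proof. by rewrite {1}[g]malg_sumU linear_sum; apply: eq_bigr => k _; rewrite linearZ. Qed.

Lemma linext_ext (V : lmodType F) (f1 f2 : {linear {malg F[K]} -> V}) g :
  (forall k, k \in msupp g -> f1 (mono k) = f2 (mono k)) -> f1 g = f2 g.
Proof.
move=> e; rewrite linear_linext [RHS]linear_linext /linext big_seq [RHS]big_seq.
by apply: eq_bigr => k /e ->.
Qed.

Lemma eq_linext_in (V : lmodType F) (h1 h2 : K -> V) g :
  (forall k, k \in msupp g -> h1 k = h2 k) -> linext h1 g = linext h2 g.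
Proof.
move=> e; rewrite /linext big_seq [RHS]big_seq.
by apply: eq_bigr => k /e ->.
Qed.

Lemma eq_linext (V : lmodType F) (h1 h2 : K -> V) : h1 =1 h2 -> linext h1 =1 linext h2.
Proof. by move=> e g; apply: eq_bigr => k _; rewrite e. Qed.

Lemma linext_comp (V W : lmodType F) (f : {linear V -> W}) (h : K -> V) g :
  f (linext h g) = linext (f \o h) g.
Proof. by rewrite linear_sum; apply: eq_bigr => k _; rewrite linearZ. Qed.

Record subspace (V : lmodType F) (P : V -> Prop) : Prop := Subspace {
  subspace0 : P 0;
  subspaceD : forall x y, P x -> P y -> P (x + y);
  subspaceZ : forall c x, P x -> P (c *: x)
}.

Section Subspace.
Variables (V : lmodType F) (P : V -> Prop).
Hypothesis sP : subspace P.

Lemma subspaceN x : P x -> P (- x).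
Proof. by move=> Px; rewrite -scaleN1r; apply: subspaceZ. Qed.

Lemma subspaceB x y : P x -> P y -> P (x - y).
Proof. by move=> Px Py; apply: subspaceD => //; apply: subspaceN. Qed.

Lemma subspace_sum (I : eqType) (r : seq I) (E : I -> V) :
  (forall i, i \in r -> P (E i)) -> P (\sum_(i <- r) E i).
Proof.
move=> h; rewrite big_seq; apply: big_ind => //; first exact: subspace0.
exact: subspaceD.
Qed.

Lemma subspace_linext (h : K -> V) g :
  (forall k, k \in msupp g -> P (h k)) -> P (linext h g).
Proof. by move=> H; apply: subspace_sum => k /H ?; apply: subspaceZ. Qed.

End Subspace.

Lemma malg_ind (P : {malg F[K]} -> Prop) : subspace P -> (forall k, P (mono k)) ->
  forall g, P g.
Proof. by move=> sP h g; rewrite -[g]linext_id; apply: (subspace_linext sP). Qed.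

Definition suppin (P : K -> Prop) g := forall k, k \in msupp g -> P k.

Lemma suppinP (P : K -> Prop) g : suppin P g <-> (forall k, g@_k != 0 -> P k).
Proof. by split=> h k; [rewrite mcoeff_neq0 | rewrite -mcoeff_neq0]; apply: h. Qed.

Lemma suppin_subspace (P : K -> Prop) : subspace (suppin P).
Proof.
split; first by move=> k; rewrite msupp0.
  move=> x y hx hy k /(fsubsetP (msuppD_le _ _)); rewrite in_fsetU => /orP[]; [exact: hx|exact: hy].
by move=> c x hx k /(fsubsetP (msuppZ_le _ _)); apply: hx.
Qed.

Lemma suppinU (P : K -> Prop) k : P k -> suppin P (mono k).
Proof. by move=> Pk k'; rewrite -monoE => /(fsubsetP msuppU_le); rewrite in_fset1 => /eqP->. Qed.

Lemma suppinW (P Q : K -> Prop) g : (forall k, P k -> Q k) -> suppin P g -> suppin Q g.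
Proof. by move=> PQ h k /h /PQ. Qed.

Lemma suppinT (P : K -> Prop) g : (forall k, P k) -> suppin P g.
Proof. by move=> h k _. Qed.

Lemma suppin_ind (S : K -> Prop) (P : {malg F[K]} -> Prop) : subspace P ->
  (forall k, S k -> P (mono k)) -> forall g, suppin S g -> P g.
Proof.
by move=> sP h g hg; rewrite -[g]linext_id; apply: (subspace_linext sP) => k /hg /h.
Qed.

Lemma mcoeff_suppin (S : K -> Prop) g k : suppin S g -> ~ S k -> g@_k = 0.
Proof. by move=> hg hk; apply: mcoeff_outdom; apply/negP => /hg. Qed.

End LinearExtension.
Arguments suppin_subspace {F K} P.

HB.lock Definition part (F : fieldType) (K : choiceType) (p : pred K) : {malg F[K]} -> {malg F[K]} :=
  linext (fun k => if p k then mono k else 0).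
Arguments part {F K} p g.

Section Part.
Variables (F : fieldType) (K : choiceType).
Implicit Types (g : {malg F[K]}) (p : pred K).

Lemma lin_part p : linear (part p : {malg F[K]} -> {malg F[K]}).
Proof. by rewrite part.unlock; exact: linextP. Qed.

HB.instance Definition _ p :=
  GRing.isLinear.Build F {malg F[K]} {malg F[K]} _ (part p) (lin_part p).

Lemma part_mono p k : part p (mono k) = if p k then mono k else 0 :> {malg F[K]}.
Proof. by rewrite part.unlock; exact: linextU. Qed.

Lemma mcoeff_part p g k : (part p g)@_k = if p k then g@_k else 0.
Proof.
move: g; apply: malg_ind => [|k'].
  split; first by rewrite linear0 mcoeff0 if_same.
    by move=> x y ex ey; rewrite linearD !mcoeffD ex ey; case: ifP => _; rewrite ?addr0.
  by move=> c x ex; rewrite linearZ !mcoeffZ ex; case: ifP => _; rewrite ?mulr0.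
rewrite part_mono mcoeff_mono; case: (eqVneq k' k) => [->|ne].
  by case: ifP => _; rewrite ?mcoeff_mono ?eqxx ?mcoeff0.
by rewrite if_same; case: ifP => _; rewrite ?mcoeff_mono ?(negPf ne) ?mcoeff0.
Qed.

Lemma suppin_part p g : suppin p (part p g).
Proof. by apply/suppinP => k; rewrite mcoeff_part; case: ifP => //; rewrite eqxx. Qed.

Lemma suppin_partW p (S : K -> Prop) g : suppin S g -> suppin S (part p g).
Proof.
move=> /suppinP h; apply/suppinP => k; rewrite mcoeff_part.
by case: ifP => _; [exact: h|rewrite eqxx].
Qed.

Lemma part_id p g : suppin p g -> part p g = g.
Proof.
move=> h; apply/malgP => k; rewrite mcoeff_part; case: ifPn => // /negP hk.
exact/esym/(mcoeff_suppin h).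
Qed.

Lemma part_0 p g : suppin (fun k => ~~ p k) g -> part p g = 0.
Proof.
move=> h; apply/malgP => k; rewrite mcoeff_part mcoeff0; case: ifPn => // hk.
by apply: (mcoeff_suppin h); rewrite hk.
Qed.

Lemma part_split p g : g = part p g + part (predC p) g.
Proof.
apply/malgP => k; rewrite mcoeffD !mcoeff_part /=.
by case: (p k); rewrite ?addr0 ?add0r.
Qed.

Lemma subspace_image (V : lmodType F) (f : {malg F[K]} -> V) (S : K -> Prop) :
  linear f -> subspace (fun x => exists2 z, suppin S z & f z = x).
Proof.
have sS := @suppin_subspace F K S.
move=> lf; split.
- exists 0; first exact: (subspace0 sS).
  by have := lf (-1) 0 0; rewrite scaler0 addr0 scaleN1r addNr.
- move=> _ _ [x hx <-] [y hy <-]; exists (x + y); first exact: (subspaceD sS).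
  by have := lf 1 x y; rewrite !scale1r.
- move=> c _ [x hx <-]; exists (c *: x); first exact: (subspaceZ sS).
  have f0 : f 0 = 0 by have := lf (-1) 0 0; rewrite scaler0 addr0 scaleN1r addNr.
  by have := lf c x 0; rewrite f0 !addr0.
Qed.

End Part.

Section FreeAlgebra.

Lemma seq_unitm (K : choiceType) (x y : seq K) : x ++ y = [::] -> x = [::] /\ y = [::].
Proof. by case: x. Qed.

(** With concatenation as product of monomials, [{malg F[seq K]}] is the free associative algebra on
    [K]. *)
HB.instance Definition _ (K : choiceType) := Choice_isMonomialDef.Build (seq K)
  (@catA K) (@cat0s K) (@cats0 K) (@seq_unitm K).

Variables (F : fieldType).
Local Notation "{ 'fa' K }" := {malg F[seq K]} (at level 0, K at level 2).

Section OneType.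
Variable K : choiceType.
Implicit Types (x y z : {fa K}) (u v w : seq K).

Lemma faUU u v : (mono u) * (mono v) = (mono (u ++ v)) :> {fa K}.
Proof. by rewrite -!monoE malgM_def fgmulUU mulr1. Qed.

Lemma fa1E : 1 = (mono [::]) :> {fa K}.
Proof. by rewrite -monoE. Qed.

Lemma fa_scalerAl c x y : (c *: x) * y = c *: (x * y).
Proof. by rewrite scalerAl. Qed.

Lemma fa_scalerAr c x y : x * (c *: y) = c *: (x * y).
Proof.
have cC z : z * malgC c = malgC c * z.
  rewrite !malgM_def fgmulgU fgmulUg; apply: eq_bigr => k _.
  by rewrite mulm1 mul1m mulrC.
by rewrite -mul_malgC mulrA cC -mulrA mul_malgC.
Qed.

Definition famull (y : {fa K}) x := x * y.
Definition famulr (x : {fa K}) y := x * y.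

Lemma famull_linear y : linear (famull y).
Proof. by move=> c u v; rewrite /famull mulrDl fa_scalerAl. Qed.
Lemma famulr_linear x : linear (famulr x).
Proof. by move=> c u v; rewrite /famulr mulrDr fa_scalerAr. Qed.
HB.instance Definition _ y :=
  GRing.isLinear.Build F {fa K} {fa K} _ (famull y) (famull_linear y).
HB.instance Definition _ x :=
  GRing.isLinear.Build F {fa K} {fa K} _ (famulr x) (famulr_linear x).

Lemma suppinM (P Q R : seq K -> Prop) x y :
  (forall u v, P u -> Q v -> R (u ++ v)) ->
  suppin P x -> suppin Q y -> suppin R (x * y).
Proof.
by move=> h hx hy k /msuppM_le [u [v [/hx ? /hy ? ->]]]; apply: h.
Qed.

Lemma fa_ind (V : lmodType F) (f g : {linear {fa K} -> V}) :
  (forall w, f (mono w) = g (mono w)) -> forall x, f x = g x.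
Proof. by move=> h x; apply: linext_ext => k _; apply: h. Qed.

End OneType.

Section Hom.
Variables (K L : choiceType) (h : K -> {fa L}).

Definition wordprod (w : seq K) : {fa L} := \prod_(k <- w) h k.
Definition fahom : {fa K} -> {fa L} := linext wordprod.

HB.instance Definition _ := GRing.Linear.on fahom.

Lemma fahomU w : fahom (mono w) = \prod_(k <- w) h k.
Proof. by rewrite /fahom linextU. Qed.

Lemma fahom1 : fahom 1 = 1.
Proof. by rewrite fa1E fahomU big_nil. Qed.

Lemma fahom_letter k : fahom (mono [:: k]) = h k.
Proof. by rewrite fahomU big_seq1. Qed.

Lemma fahom_cons k w : fahom (mono (k :: w)) = h k * fahom (mono w).
Proof. by rewrite !fahomU big_cons. Qed.

Lemma fahom_cat u v : fahom (mono (u ++ v)) = fahom (mono u) * fahom (mono v).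
Proof. by rewrite !fahomU big_cat. Qed.

Lemma lin_fahom : linear fahom. Proof. exact: linearP. Qed.
Lemma fahom0 : fahom 0 = 0. Proof. exact: linear0. Qed.
Lemma fahomD x y : fahom (x + y) = fahom x + fahom y. Proof. exact: linearD. Qed.
Lemma fahomB x y : fahom (x - y) = fahom x - fahom y. Proof. exact: linearB. Qed.
Lemma fahomZ c x : fahom (c *: x) = c *: fahom x. Proof. exact: linearZ. Qed.

Lemma fahomM x y : fahom (x * y) = fahom x * fahom y.
Proof.
apply: (fa_ind (f := fahom \o famull y) (g := famull (fahom y) \o fahom)) => u /=.
rewrite /famull; apply: (fa_ind (f := fahom \o famulr (mono u))
  (g := famulr (fahom (mono u)) \o fahom)) => v /=.
by rewrite /famulr faUU fahom_cat.
Qed.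

Lemma suppin_fahom (P : seq K -> Prop) (Q : seq L -> Prop) x :
  (forall w, P w -> suppin Q (fahom (mono w))) -> suppin P x -> suppin Q (fahom x).
Proof.
move=> H Px; rewrite /fahom; apply: (subspace_linext (suppin_subspace Q)) => w wx.
by have := H w (Px w wx); rewrite fahomU.
Qed.

End Hom.

Lemma fahom_comp (K L M : choiceType) (h : K -> {fa L}) (g : L -> {fa M}) x :
  fahom g (fahom h x) = fahom (fun k => fahom g (h k)) x.
Proof.
apply: (fa_ind (f := fahom g \o fahom h) (g := fahom _)) => w /=.
elim: w => [|k w IH]; first by rewrite !fahomU !big_nil fahom1.
by rewrite !fahom_cons fahomM IH.
Qed.

Lemma eq_fahom_in (K L : choiceType) (h g : K -> {fa L}) (P : K -> Prop) x :
  (forall k, P k -> h k = g k) -> suppin (fun w : seq K => forall k, k \in w -> P k) x ->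
  fahom h x = fahom g x.
Proof.
move=> e Px; apply: linext_ext => w /Px Pw.
change (fahom h (mono w) = fahom g (mono w)); rewrite !fahomU !big_seq.
by apply: eq_bigr => k /Pw /e.
Qed.

Lemma eq_fahom (K L : choiceType) (h g : K -> {fa L}) x : h =1 g -> fahom h x = fahom g x.
Proof. by move=> e; apply: (eq_fahom_in (P := fun=> True)) => // w _ k. Qed.

Lemma fahom_id (K : choiceType) (x : {fa K}) : fahom (fun k => (mono [:: k])) x = x.
Proof.
apply: (fa_ind (f := fahom _) (g := idfun)) => w /=.
elim: w => [|k w IH]; first by rewrite fahomU big_nil fa1E.
by rewrite fahom_cons IH faUU.
Qed.

End FreeAlgebra.
Notation "{ 'fa' F [ K ] }" := {malg F[seq K]} (at level 0, F, K at level 2).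

(** * Evaluation of formal combinations *)

Lemma bwcmpP t u : bwcmp t u = Eq -> t = u.
Proof.
elim: t u => [i|t1 IH1 t2 IH2|t1 IH1 t2 IH2] [j|u1 u2|u1 u2] //=.
- by move=> /PeanoNat.Nat.compare_eq ->.
- by case e: (bwcmp t1 u1) => // /IH2 ->; rewrite (IH1 _ e).
- by case e: (bwcmp t1 u1) => // /IH2 ->; rewrite (IH1 _ e).
Qed.

Section FormalValue.
Variables (F : fieldType) (V : lmodType F) (circ bul : V -> V -> V).
Hypothesis circC : commutative circ.

Definition ZtoF (z : Z) : F := (int_of_Z z)%:~R.

Lemma ZtoFD x y : ZtoF (x + y)%Z = ZtoF x + ZtoF y.
Proof. by rewrite /ZtoF -[(x + y)%Z]/(x + y)%R rmorphD /= rmorphD. Qed.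

Lemma ZtoFM x y : ZtoF (x * y)%Z = ZtoF x * ZtoF y.
Proof. by rewrite /ZtoF -[(x * y)%Z]/(x * y)%R rmorphM /= rmorphM. Qed.

Lemma ZtoFN x : ZtoF (- x)%Z = - ZtoF x.
Proof. by rewrite /ZtoF -[(- x)%Z]/(- x)%R rmorphN /= rmorphN. Qed.

Definition fval (v : nat -> V) (L : formal) : V :=
  \sum_(p <- L) ZtoF p.1 *: bwterm_eval circ bul v p.2.

Lemma fval_cat v L1 L2 : fval v (L1 ++ L2) = fval v L1 + fval v L2.
Proof. by rewrite /fval big_cat. Qed.

Lemma fval_flatten v (Ls : seq formal) : fval v (flatten Ls) = \sum_(L <- Ls) fval v L.
Proof.
elim: Ls => [|L Ls IH] /=; first by rewrite /fval !big_nil.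
by rewrite fval_cat big_cons IH.
Qed.

Lemma fval_scale v c L : fval v (fscale c L) = ZtoF c *: fval v L.
Proof.
rewrite /fval big_map scaler_sumr; apply: eq_bigr => p _ /=.
by rewrite ZtoFM scalerA.
Qed.

Lemma circ_sort_eval v t :
  bwterm_eval circ bul v (circ_sort t) = bwterm_eval circ bul v t.
Proof.
elim: t => [i|a IHa b IHb|a IHa b IHb] //=; last by rewrite IHa IHb.
by case: bwle => /=; rewrite IHa IHb.
Qed.

Lemma collect_sound v c t L :
  collect c t L -> ZtoF c *: bwterm_eval circ bul v t + fval v L = 0.
Proof.
elim: L c t => [|[c' t'] L IH] c t /=.
  by move=> /Z.eqb_eq ->; rewrite /fval big_nil scale0r addr0.
rewrite /fval big_cons /= -/(fval v L); case e: (bwcmp t t').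
- by move/IH; rewrite (bwcmpP e) ZtoFD scalerDl addrA.
- by case/andP=> /Z.eqb_eq -> /IH ->; rewrite scale0r addr0.
- by case/andP=> /Z.eqb_eq -> /IH ->; rewrite scale0r addr0.
Qed.

(** Sorting permutes the summands and [circ_sort] swaps factors of a commutative operation, so
    neither changes the value. *)
Lemma vanishes_sound v L : vanishes L -> fval v L = 0.
Proof.
move/(collect_sound v); rewrite scale0r add0r => <-.
rewrite /fval (perm_big _ (permEl (perm_sort _ _))) big_map.
by apply: eq_bigr => p _ /=; rewrite circ_sort_eval.
Qed.

End FormalValue.

Definition bilinear_op (F : fieldType) (V : lmodType F) (c : V -> V -> V) : Prop :=
  (forall z, linear (c^~ z)) /\ (forall z, linear (c z)).

Section LinearFun.
Variables (F : fieldType) (V W : lmodType F) (f : V -> W).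
Hypothesis lf : linear f.
Lemma linear_fun0 : f 0 = 0.
Proof. by have := lf (-1) 0 0; rewrite scaler0 addr0 scaleN1r addNr. Qed.
Lemma linear_funD x y : f (x + y) = f x + f y.
Proof. by have := lf 1 x y; rewrite !scale1r. Qed.
Lemma linear_funZ c x : f (c *: x) = c *: f x.
Proof. by have := lf c x 0; rewrite linear_fun0 !addr0. Qed.
Lemma linear_funB x y : f (x - y) = f x - f y.
Proof. by rewrite -scaleN1r linear_funD linear_funZ scaleN1r. Qed.
End LinearFun.

Section LinearCombinators.
Variables (F : fieldType) (U V W : lmodType F).

Lemma lin_id : linear (fun x : V => x). Proof. by []. Qed.
Lemma lin_add (f g : V -> W) : linear f -> linear g -> linear (fun x => f x + g x).
Proof. by move=> lf lg c x y; rewrite lf lg scalerDr addrACA. Qed.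
Lemma lin_opp (f : V -> W) : linear f -> linear (fun x => - f x).
Proof. by move=> lf c x y; rewrite lf opprD scalerN. Qed.
Lemma lin_comp (f : V -> W) (g : U -> V) : linear f -> linear g -> linear (fun x => f (g x)).
Proof. by move=> lf lg c x y; rewrite lg lf. Qed.
Lemma lin_lin (f : {linear V -> W}) : linear f.
Proof. exact: linearP. Qed.

Lemma subspace_preim (f : V -> W) (P : W -> Prop) :
  linear f -> subspace P -> subspace (fun x => P (f x)).
Proof.
move=> lf sP; split; first by rewrite (linear_fun0 lf); exact: subspace0 sP.
  by move=> x y hx hy; rewrite (linear_funD lf); exact: (subspaceD sP).
by move=> c x hx; rewrite (linear_funZ lf); exact: (subspaceZ sP).
Qed.

Lemma eq_subspace (f g : V -> W) : linear f -> linear g ->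
  subspace (fun x => f x = g x).
Proof.
move=> lf lg.
split; first by rewrite !linear_fun0.
  by move=> x y e1 e2; rewrite !linear_funD // e1 e2.
by move=> c x e; rewrite !linear_funZ // e.
Qed.

End LinearCombinators.

Section BilinearOp.
Variables (F : fieldType) (V : lmodType F) (c : V -> V -> V).
Hypothesis bc : bilinear_op c.

Lemma bilopDl x y z : c (x + y) z = c x z + c y z.
Proof. by have := bc.1 z 1 x y; rewrite !scale1r. Qed.
Lemma bilopDr x y z : c z (x + y) = c z x + c z y.
Proof. by have := bc.2 z 1 x y; rewrite !scale1r. Qed.
Lemma bilop0l z : c 0 z = 0.
Proof. by apply: (@addrI _ (c 0 z)); rewrite -bilopDl !addr0. Qed.
Lemma bilop0r z : c z 0 = 0.
Proof. by apply: (@addrI _ (c z 0)); rewrite -bilopDr !addr0. Qed.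
Lemma bilopZl a x z : c (a *: x) z = a *: c x z.
Proof. by have := bc.1 z a x 0; rewrite bilop0l !addr0. Qed.
Lemma bilopZr a x z : c z (a *: x) = a *: c z x.
Proof. by have := bc.2 z a x 0; rewrite bilop0r !addr0. Qed.
Lemma bilopNl x z : c (- x) z = - c x z.
Proof. by rewrite -scaleN1r bilopZl scaleN1r. Qed.
Lemma bilopNr x z : c z (- x) = - c z x.
Proof. by rewrite -scaleN1r bilopZr scaleN1r. Qed.
Lemma bilop_suml I (r : seq I) (E : I -> V) z :
  c (\sum_(i <- r) E i) z = \sum_(i <- r) c (E i) z.
Proof. by apply: (big_morph (c^~ z)) => [x y|]; rewrite ?bilopDl ?bilop0l. Qed.
Lemma bilop_sumr I (r : seq I) (E : I -> V) z :
  c z (\sum_(i <- r) E i) = \sum_(i <- r) c z (E i).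
Proof. by apply: (big_morph (c z)) => [x y|]; rewrite ?bilopDr ?bilop0r. Qed.
End BilinearOp.

(** * Jordan algebras modulo a subspace, and soundness of the certificates *)

Definition jordan_expr (F : fieldType) (V : lmodType F) (c : V -> V -> V) (x y z t : V) : V :=
  c (c (c x y) t) z + c (c (c x z) t) y + c (c (c y z) t) x
  - c (c x y) (c z t) - c (c x z) (c y t) - c (c x t) (c y z).

(** Expresses that V / Z is a Jordan algebra without forming the quotient; it will be used with [Z]
    the pairs of elements of the T-ideal N. *)
Record jordan_mod (F : fieldType) (V : lmodType F) (c : V -> V -> V) (Z : V -> Prop) : Prop :=
  JordanMod {
  jordan_bil : bilinear_op c;
  jordan_comm : commutative c;
  jordan_sub : subspace Z;
  jordan_ideal : forall x y, Z x -> Z (c x y);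
  jordan_id : forall x y z t, Z (jordan_expr c x y z t)
}.

Inductive jtree (Y : Type) : Type :=
  | JLeaf of Y
  | JMul of jtree Y & jtree Y.

Fixpoint jsize (Y : Type) (t : jtree Y) : nat :=
  match t with JLeaf _ => 1 | JMul a b => jsize a + jsize b end.

Fixpoint jwords (Y : Type) (t : jtree Y) : seq (seq Y) :=
  match t with
  | JLeaf y => [:: [:: y]]
  | JMul a b => [seq u ++ v | u <- jwords a, v <- jwords b]
                ++ [seq v ++ u | u <- jwords a, v <- jwords b]
  end.

Fixpoint jval (Y V : Type) (c : V -> V -> V) (val : Y -> V) (t : jtree Y) : V :=
  match t with
  | JLeaf y => val y
  | JMul a b => c (jval c val a) (jval c val b)
  end.

Fixpoint jinst (Y : Type) (s : nat -> Y) (t : bwterm) : jtree Y :=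
  match t with
  | TVar i => JLeaf (s i)
  | TCirc a b | TBul a b => JMul (jinst s a) (jinst s b)
  end.

Lemma jinst_shift (Y : Type) (s : nat -> Y) k t :
  jinst s (shift_vars k t) = jinst (fun i => s (k + i)%N) t.
Proof. by elim: t => //= a -> b ->. Qed.

Lemma jsize_gt0 (Y : Type) (t : jtree Y) : (0 < jsize t)%N.
Proof. by elim: t => //= a IHa b IHb; rewrite addn_gt0 IHa. Qed.

Inductive jsim (Y : Type) : jtree Y -> jtree Y -> Prop :=
  | JSimRefl t : jsim t t
  | JSimTrans t u w : jsim t u -> jsim u w -> jsim t w
  | JSimSwap a b : jsim (JMul a b) (JMul b a)
  | JSimMul a b a' b' : jsim a a' -> jsim b b' -> jsim (JMul a b) (JMul a' b').

Section JordanWords.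
Variables (F : fieldType) (V : lmodType F) (c : V -> V -> V).
Hypotheses (cC : commutative c).

Lemma jsim_val (Y : Type) (val : Y -> V) t u : jsim t u -> jval c val t = jval c val u.
Proof.
elim=> // [t1 t2 t3 _ -> _ ->|a b|a b a' b' _ IHa _ IHb] //=.
by rewrite IHa IHb.
Qed.

Lemma jwords_mul (Y : Type) (f : seq Y -> V) a b :
  \sum_(w <- jwords (JMul a b)) f w =
  \sum_(u <- jwords a) \sum_(v <- jwords b) (f (u ++ v) + f (v ++ u)).
Proof.
rewrite /= big_cat !big_allpairs_dep /=.
rewrite [RHS](eq_bigr (fun u => \sum_(v <- jwords b) f (u ++ v) + \sum_(v <- jwords b) f (v ++ u))).
  by rewrite big_split.
by move=> u _; rewrite big_split.
Qed.

Lemma jsim_words (Y : Type) (f : seq Y -> V) t u : jsim t u ->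
  \sum_(w <- jwords t) f w = \sum_(w <- jwords u) f w.
Proof.
move=> h; elim: h f => // [t1 t2 t3 _ h1 _ h2 f|a b f|a b a' b' _ IHa _ IHb f].
- by rewrite h1 h2.
- rewrite !jwords_mul exchange_big; apply: eq_bigr => u' _; apply: eq_bigr => v _.
  by rewrite addrC.
- rewrite !jwords_mul IHa; apply: eq_bigr => u' _.
  by rewrite (IHb (fun v => f (u' ++ v) + f (v ++ u'))).
Qed.

Lemma jval_inst (Y : Type) (val : Y -> V) s m :
  jval c val (jinst s m) = bwterm_eval c c (fun i => val (s i)) m.
Proof. by elim: m => //= a -> b ->. Qed.

End JordanWords.

Lemma jwords_inst (Y : Type) (s : nat -> Y) m :
  jwords (jinst s m) = [seq [seq s i | i <- w] | w <- bwwords m].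
Proof.
have H (A B : seq (seq nat)) (A' B' : seq (seq Y)) :
    A' = [seq [seq s i | i <- w] | w <- A] -> B' = [seq [seq s i | i <- w] | w <- B] ->
    [seq u ++ v | u <- A', v <- B'] ++ [seq v ++ u | u <- A', v <- B'] =
    [seq [seq s i | i <- w] | w <- [seq u ++ v | u <- A, v <- B] ++ [seq v ++ u | u <- A, v <- B]].
  move=> -> ->; rewrite map_cat; congr (_ ++ _); rewrite map_allpairs allpairs_mapl allpairs_mapr;
  by apply: eq_allpairs => u v; rewrite map_cat.
by elim: m => //= a IHa b IHb; exact: H.
Qed.

Lemma size_bwwords m w : w \in bwwords m -> size w = size (bwterm_leaves m).
Proof.
elim: m w => [i|a IHa b IHb|a IHa b IHb] w /=; first by rewrite inE => /eqP->.
all: by rewrite mem_cat => /orP[] /allpairsP [[u v] /= [hu hv ->]];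
  rewrite !size_cat (IHa _ hu) (IHb _ hv) // addnC.
Qed.

Lemma eq_jinst (Y : Type) (s s' : nat -> Y) m :
  {in bwterm_leaves m, s =1 s'} -> jinst s m = jinst s' m.
Proof.
elim: m => [i|a IHa b IHb|a IHa b IHb] /= e; first by rewrite e ?inE.
all: by rewrite IHa ?IHb // => i hi; apply: e; rewrite mem_cat hi ?orbT.
Qed.

Lemma jreps_leaves fuel n m : m \in jreps fuel n ->
  size (bwterm_leaves m) = n /\ {in bwterm_leaves m, forall i, (i < n)%N}.
Proof.
elim: fuel n m => [//|fuel IH] n m /=.
case: eqP => [->|_]; first by rewrite inE => /eqP -> /=; split=> // i; rewrite inE => /eqP ->.
move=> /flattenP [L /mapP [i hi ->]] /allpairsP [[a b] /= [ha hb ->]].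
have {hi} le_in : (i <= n)%N.
  move: hi; rewrite mem_iota add1n ltnS => /andP [_ hi].
  apply: (leq_trans hi); rewrite -{2}(odd_double_half n) -addnn addnCA; exact: leq_addr.
have [sa la] := IH _ _ ha; have [sb lb] := IH _ _ hb.
have sh : bwterm_leaves (shift_vars i b) = [seq (i + j)%N | j <- bwterm_leaves b].
  by elim: (b) => //= x -> y ->; rewrite map_cat.
rewrite /= sh; split; first by rewrite size_cat size_map sa sb subnKC.
move=> j; rewrite mem_cat => /orP[/la hj|/mapP [k /lb hk ->]]; first exact: leq_trans hj le_in.
by rewrite -(subnKC le_in) ltn_add2l.
Qed.

(** A swap moves the smaller factor to the left at each node; the labelling of a product glues those
    of its factors at position [jsize a]. *)
Lemma jreps_exists (Y : Type) (t : jtree Y) fuel : (jsize t <= fuel)%N ->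
  exists m s, m \in jreps fuel (jsize t) /\ jsim t (jinst s m).
Proof.
elim: fuel t => [|fuel IH] t; first by rewrite leqNgt jsize_gt0.
have key (a b : jtree Y) : (jsize a <= jsize b)%N -> (jsize (JMul a b) <= fuel.+1)%N ->
  exists m s, m \in jreps fuel.+1 (jsize (JMul a b)) /\ jsim (JMul a b) (jinst s m).
  move=> le_ab; rewrite /= => le.
  have a0 := jsize_gt0 a; have b0 := jsize_gt0 b.
  have la : (jsize a <= fuel)%N.
    by rewrite -ltnS (leq_trans _ le) // -addn1 leq_add2l.
  have lb : (jsize b <= fuel)%N.
    by rewrite -ltnS (leq_trans _ le) // -add1n leq_add2r.
  have [ma [sa [ha simA]]] := IH _ la; have [mb [sb [hb simB]]] := IH _ lb.
  have [_ lla] := jreps_leaves ha; have [_ llb] := jreps_leaves hb.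
  exists (TCirc ma (shift_vars (jsize a) mb)).
  exists (fun i => if (i < jsize a)%N then sa i else sb (i - jsize a)%N); split.
    rewrite ifF; last by apply/eqP=> e; move: (leq_add a0 b0); rewrite e.
    apply/flattenP; exists [seq TCirc x (shift_vars (jsize a) y) |
      x <- jreps fuel (jsize a), y <- jreps fuel (jsize a + jsize b - jsize a)].
      apply/mapP; exists (jsize a) => //; rewrite mem_iota a0 add1n ltnS /=.
      by rewrite geq_half_double -addnn leq_add2l.
    by apply: allpairs_f => //; rewrite addKn.
  rewrite /= jinst_shift; apply: JSimMul.
    rewrite (_ : jinst _ ma = jinst sa ma) //.
    by apply: eq_jinst => i /lla ->.
  rewrite (_ : jinst _ mb = jinst sb mb) //.
  by apply: eq_jinst => i _; rewrite ltnNge leq_addr /= addKn.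
case: t => [y|a b] le; first by exists (TVar 0), (fun=> y); split; [rewrite inE|apply: JSimRefl].
have [ab|/ltnW ba] := leqP (jsize a) (jsize b); first exact: key.
have [m [s [hm sim]]] : exists m s, m \in jreps fuel.+1 (jsize (JMul b a)) /\
   jsim (JMul b a) (jinst s m) by apply: key => //; rewrite /= addnC.
exists m, s; split; first by rewrite [jsize _]/= addnC.
exact: JSimTrans (JSimSwap _ _) sim.
Qed.

Lemma mem_zip_nth (S T : eqType) (x0 : S) (y0 : T) (s : seq S) (t : seq T) j :
  (j < size s)%N -> (j < size t)%N -> (nth x0 s j, nth y0 t j) \in zip s t.
Proof.
elim: s t j => [|x s IH] [|y t] [|j] //= hs ht; rewrite inE ?eqxx //.
by apply/orP; right; apply: IH.
Qed.

Lemma mem_zip_snd (S T : eqType) (s : seq S) (t : seq T) p : p \in zip s t -> p.2 \in t.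
Proof.
elim: s t => [|x s IH] [|y t] //=; rewrite !inE => /orP[/eqP-> /=|/IH ->]; by rewrite ?eqxx ?orbT.
Qed.

Definition projdata : seq (Z * seq Z * seq (seq Z)) := [::
  (1%Z, [::], [::]); (1%Z, projcoef1, relcoef1); (2%Z, projcoef2, relcoef2);
  (4%Z, projcoef3, relcoef3); (24%Z, projcoef4, relcoef4);
  (48%Z, projcoef5, relcoef5); (96%Z, projcoef6, relcoef6)].

Definition proj_scale n := (nth (1%Z, [::], [::]) projdata n).1.1.
Definition proj_coef n := (nth (1%Z, [::], [::]) projdata n).1.2.
Definition proj_rel n := (nth (1%Z, [::], [::]) projdata n).2.

Lemma proj_data_check n : (0 < n <= 6)%N ->
  proj_check n (proj_scale n) (proj_coef n) (proj_rel n).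
Proof.
case: n => [|[|[|[|[|[|[|n]]]]]]] h; [by []| | | | | | |by case/andP: h].
- exact: proj_check1.
- exact: proj_check2.
- exact: proj_check3.
- exact: proj_check4.
- exact: proj_check5.
- exact: proj_check6.
Qed.

Lemma proj_rel_size n : (0 < n <= 6)%N -> (size (jreps n n) <= size (proj_rel n))%N.
Proof. by case: n => [|[|[|[|[|[|[|n]]]]]]]. Qed.

Section JordanLowDegree.
Variables (F : fieldType) (V : lmodType F) (c : V -> V -> V) (Z : V -> Prop).
Hypotheses (charF0 : [pchar F] =i pred0) (jm : jordan_mod c Z).

Let bc := jordan_bil jm.
Let cC := jordan_comm jm.
Let Zs := jordan_sub jm.
Notation fv := (fval c c).
Notation ev := (bwterm_eval c c).

Lemma jordan_formal_sound v x y z t : Z (fv v (jordan_formal x y z t)).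
Proof.
have -> : fv v (jordan_formal x y z t) = jordan_expr c (ev v x) (ev v y) (ev v z) (ev v t).
  rewrite /fval /jordan_formal !big_cons big_nil /= /ZtoF /= addr0.
  by rewrite !scale1r !scaleN1r !addrA.
exact: jordan_id.
Qed.

Lemma jrels_sound v n S L : L \in jrels n S -> Z (fv v L).
Proof.
elim: n S L => [//|n IH] S L; rewrite [jrels _ _]/= mem_cat => /orP[].
  move=> /flattenP [L1 /mapP [p _ ->]] /flattenP [L2 /mapP [q _ ->]].
  move=> /flattenP [L3 /mapP [r _ ->]] /=.
  case: ifP => // _ /flattenP [L4 /mapP [x _ ->]] /flattenP [L5 /mapP [y _ ->]].
  by move=> /allpairsP [[z t] /= [_ _ ->]]; apply: jordan_formal_sound.
move=> /flattenP [L1 /mapP [p _ ->]]; case: ifP => // _.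
move=> /allpairsP [[L' t] /= [hL _ ->]].
have -> : fv v [seq (x.1, TCirc x.2 t) | x <- L'] = c (fv v L') (ev v t).
  rewrite /fval big_map (bilop_suml bc); apply: eq_bigr => x _ /=.
  by rewrite (bilopZl bc).
exact/(jordan_ideal jm)/(IH _ _ hL).
Qed.

Lemma relabel_eval v w t : ev v (relabel w t) = ev (fun i => v (nth 0%N w i)) t.
Proof. by elim: t => //= a -> b ->. Qed.

(** The certificate is an identity of formal combinations, so it survives every evaluation, and its
    relation part evaluates into [Z] by [jrels_sound]. *)
Lemma proj_check_sound v n M cs rs m : proj_check n M cs rs -> m \in jreps n n ->
  (size (jreps n n) <= size rs)%N ->
  Z (\sum_(w <- bwwords m) fv (fun i => v (nth 0%N w i)) (proj_formal n cs)
     - ZtoF F M *: ev v m).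
Proof.
move=> /allP chk hm hs.
pose j := index m (jreps n n); have hj : (j < size (jreps n n))%N by rewrite index_mem.
have /chk {chk} : (m, nth [::] rs j) \in zip (jreps n n) rs.
  by rewrite -{1}(nth_index (TVar 0) hm); apply: mem_zip_nth => //; apply: leq_trans hs.
move=> /(vanishes_sound c cC v).
rewrite /fval big_cons /= -!/(fval _ _ _ _) fval_cat ZtoFN scaleNr => e.
have -> : \sum_(w <- bwwords m) fv (fun i => v (nth 0%N w i)) (proj_formal n cs) =
    fv v (proj_sum (proj_formal n cs) m).
  rewrite fval_flatten big_map; apply: eq_bigr => w _.
  by rewrite /fval big_map; apply: eq_bigr => p _; rewrite relabel_eval.
set A := fv v (proj_sum _ _); set B := fv v (combine _ _) in e *; set C := _ *: _.
have -> : A - C = - B.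
  by apply/eqP; rewrite -subr_eq0 opprK addrAC addrC e.
apply: (subspaceN Zs); rewrite /B /combine fval_flatten big_map.
apply: (subspace_sum Zs) => -[z L] /= /mem_zip_snd hL.
case: ifP => _; first by rewrite /fval big_nil; exact: (subspace0 Zs).
rewrite fval_scale; apply: (subspaceZ Zs); exact: jrels_sound hL.
Qed.

Lemma proj_scale_neq0 n : ZtoF F (proj_scale n) != 0.
Proof.
(* Every scale is a positive integer, the default entry included, so characteristic 0 makes it
   invertible. *)
have nat0 k : k.+1%:R != 0 :> F by rewrite (proj1 (pcharf0P F) charF0).
case: n => [|[|[|[|[|[|[|n]]]]]]]; rewrite /proj_scale /ZtoF /= ?nth_nil; exact: nat0.
Qed.

(* Modulo the Jordan identities this inverts the associative expansion of Jordan polynomials of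
   degree at most 6 ([jproj_tree]); hence in these degrees there are no special identities. *)
Definition jproj (Y : Type) (val : Y -> V) (w : seq Y) : V :=
  (ZtoF F (proj_scale (size w)))^-1 *:
    fv (fun i => nth 0 (map val w) i) (proj_formal (size w) (proj_coef (size w))).

Lemma eq_ev v v' t : {in bwterm_leaves t, v =1 v'} -> ev v t = ev v' t.
Proof.
elim: t => [i|a IHa b IHb|a IHa b IHb] /= e; first by rewrite e ?inE.
all: by rewrite IHa ?IHb // => i hi; apply: e; rewrite mem_cat hi ?orbT.
Qed.

Lemma jtrees_leaves n S t : t \in jtrees n S -> {subset bwterm_leaves t <= S}.
Proof.
have spl T p : p \in splits T -> {subset p.1 <= T} /\ {subset p.2 <= T}.
  elim: T p => [|x T IH] p /=; first by rewrite inE => /eqP ->.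
  by rewrite mem_cat => /orP[] /mapP [q /IH [h1 h2] ->] /=; split=> y;
    rewrite ?inE; [case/orP=> [->//|/h1 ->]|move/h2 ->|move/h1 ->|case/orP=> [->//|/h2 ->]];
    rewrite orbT.
elim: n S t => [//|n IH] [|x S] t //=; case: ifP => [_|_].
  by rewrite inE => /eqP -> /= y; rewrite !inE => ->.
move=> /flattenP [L /mapP [p /spl [h1 h2] ->]]; case: ifP => // _.
move=> /allpairsP [[a b] /= [/IH ha /IH hb ->]] y /=; rewrite mem_cat inE => /orP[/ha|/hb /h2 ->].
  by rewrite inE => /orP[->//|/h1 ->]; rewrite orbT.
by rewrite orbT.
Qed.

(** Commutativity reduces the tree to a shape of [jreps] with letters substituted for its leaves;
    there the claim is the certificate divided by its scale. *)
Lemma jproj_tree (Y : Type) (val : Y -> V) (t : jtree Y) : (jsize t <= 6)%N ->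
  Z (\sum_(w <- jwords t) jproj val w - jval c val t).
Proof.
move=> le6; have n0 := jsize_gt0 t.
have [m [s [hm sim]]] := jreps_exists (leqnn (jsize t)).
have [sz _] := jreps_leaves hm; set n := jsize t in le6 n0 hm sz *.
rewrite (jsim_val cC _ sim) (jsim_words _ sim) jval_inst jwords_inst big_map.
have h06 : (0 < n <= 6)%N by rewrite n0.
have nz := proj_scale_neq0 n.
pose v i := val (s i).
have := proj_check_sound v (proj_data_check h06) hm (proj_rel_size h06).
move=> /(subspaceZ Zs (ZtoF F (proj_scale n))^-1).
rewrite scalerBr scalerA mulVf // scale1r scaler_sumr.
congr (Z (_ - _)); rewrite big_seq [RHS]big_seq; apply: eq_bigr => w hw.
have szw : size w = n by rewrite (size_bwwords hw).
rewrite /jproj size_map szw; congr (_ *: _); rewrite /fval big_seq [RHS]big_seq.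
apply: eq_bigr => p hp; congr (_ *: _); apply: eq_ev => i hi.
have : i \in iota 0 n.
  move: hp; rewrite mem_filter => /andP[_ /mem_zip_snd hp]; exact: jtrees_leaves hp _ hi.
rewrite mem_iota add0n => /andP [_ hin].
by rewrite (nth_map (s 0%N)) ?size_map ?szw // (nth_map 0%N) ?szw.
Qed.

End JordanLowDegree.

Lemma sum2D (V : zmodType) (I J : Type) (r : seq I) (s : seq J) (f g : I -> J -> V) :
  \sum_(i <- r) \sum_(j <- s) (f i j + g i j) =
  \sum_(i <- r) \sum_(j <- s) f i j + \sum_(i <- r) \sum_(j <- s) g i j.
Proof. by rewrite -big_split; apply: eq_bigr => i _; rewrite big_split. Qed.

Section JordanComb.
Variables (F : fieldType) (Y : choiceType).
Local Notation U := {fa F[Y]}.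

(** Associative expansion for the product xy + yx, without the factor 1/2. *)
Definition jexp (t : jtree Y) : U := \sum_(w <- jwords t) (mono w).

Lemma jexp_leaf y : jexp (JLeaf y) = (mono [:: y]).
Proof. by rewrite /jexp big_seq1. Qed.

Lemma jexp_mul a b : jexp (JMul a b) = jexp a * jexp b + jexp b * jexp a.
Proof.
have E1 : jexp a * jexp b = \sum_(u <- jwords a) \sum_(v <- jwords b) (mono (u ++ v)).
  rewrite mulr_suml; apply: eq_bigr => u _; rewrite mulr_sumr.
  by apply: eq_bigr => v _; rewrite faUU.
have E2 : jexp b * jexp a = \sum_(u <- jwords a) \sum_(v <- jwords b) (mono (v ++ u)).
  rewrite exchange_big mulr_suml; apply: eq_bigr => u _; rewrite mulr_sumr.
  by apply: eq_bigr => v _; rewrite faUU.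
rewrite {}E1 {}E2 /jexp (jwords_mul (fun w => (mono w))).
exact: sum2D.
Qed.

Fixpoint jall (A : Y -> Prop) (t : jtree Y) : Prop :=
  match t with JLeaf y => A y | JMul a b => jall A a /\ jall A b end.

Fixpoint jdeg (dg : Y -> nat) (t : jtree Y) : nat :=
  match t with JLeaf y => dg y | JMul a b => jdeg dg a + jdeg dg b end.

End JordanComb.

Local Open Scope quotient_scope.

HB.lock Definition bwt (F : fieldType) (t : bwterm) : bwpoly F := mono (\pi_bwmon t).
Arguments bwt {F} t.

HB.lock Definition bws (F : fieldType) (v : nat -> bwpoly F) (f : bwpoly F) : bwpoly F :=
  bwsubst v f.
Arguments bws {F} v f.

(** * The free algebra with two operations and its ideals *)

Section BWAlgebra.
Variable F : fieldType.
Implicit Types (f g : bwpoly F) (m : bwmon) (t u : bwterm).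

Lemma bwt_repr m : bwt (repr m) = mono m :> bwpoly F.
Proof. by rewrite bwt.unlock reprK. Qed.

Lemma bw_pi_eq t u : bwterm_comm t u -> \pi_bwmon t = \pi_bwmon u.
Proof. by move=> h; apply/eqmodP. Qed.

Lemma bwt_comm t u : bwterm_comm t u -> bwt t = bwt u :> bwpoly F.
Proof. by move=> h; rewrite bwt.unlock (bw_pi_eq h). Qed.

Lemma repr_pi_comm t : bwterm_comm (repr (\pi_bwmon t)) t.
Proof. by apply/eqmodP; rewrite reprK. Qed.

Lemma leaves_pi t : perm_eq (bwterm_leaves (repr (\pi_bwmon t))) (bwterm_leaves t).
Proof. exact/bwterm_comm_leaves/repr_pi_comm. Qed.

Definition bwop (b : bool) : bwterm -> bwterm -> bwterm := if b then TCirc else TBul.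

Lemma bwX_bwt i : bwX F i = bwt (TVar i).
Proof. by rewrite bwt.unlock -monoE. Qed.

Lemma bwop_pi b t t' u u' : bwterm_comm t t' -> bwterm_comm u u' ->
  \pi_bwmon (bwop b t u) = \pi_bwmon (bwop b t' u').
Proof. by move=> ht hu; apply: bw_pi_eq; case: b; rewrite /= ht hu. Qed.

Lemma bwmul_linext op f g :
  bwmul op f g = linext (fun m1 => linext (fun m2 => bwt (op (repr m1) (repr m2))) g) f.
Proof.
apply: eq_bigr => m1 _; rewrite scaler_sumr; apply: eq_bigr => m2 _.
by rewrite malgZU bwt.unlock scalerA.
Qed.

Lemma bwmul_bil op : bilinear_op (@bwmul F op).
Proof.
split=> z a x y; rewrite !bwmul_linext ?linearP //.
rewrite /linext scaler_sumr -big_split; apply: eq_bigr => m _ /=.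
by rewrite -!/(linext _ _) linearP /= scalerDr !scalerA mulrC.
Qed.

Lemma bwcirc_bil : bilinear_op (@bwcirc F). Proof. exact: bwmul_bil. Qed.
Lemma bwbul_bil : bilinear_op (@bwbul F). Proof. exact: bwmul_bil. Qed.

Lemma bwmul_bwt b t u : bwmul (bwop b) (bwt t) (bwt u) = bwt (bwop b t u) :> bwpoly F.
Proof.
rewrite bwmul_linext !bwt.unlock !linextU; congr (mono _).
by apply: bwop_pi; apply: repr_pi_comm.
Qed.

Lemma bwcirc_bwt t u : bwcirc (bwt t) (bwt u) = bwt (TCirc t u) :> bwpoly F.
Proof. exact: (bwmul_bwt true). Qed.
Lemma bwbul_bwt t u : bwbul (bwt t) (bwt u) = bwt (TBul t u) :> bwpoly F.
Proof. exact: (bwmul_bwt false). Qed.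

Lemma bwpoly_sum f : f = \sum_(m <- msupp f) f@_m *: bwt (repr m).
Proof. by rewrite {1}[f]malg_sumU; apply: eq_bigr => m _; rewrite bwt_repr. Qed.

Lemma bwpoly_ind (P : bwpoly F -> Prop) : subspace P -> (forall t, P (bwt t)) ->
  forall f, P f.
Proof.
move=> sP h f; rewrite [f]bwpoly_sum; apply: (subspace_sum sP) => m _.
exact: (subspaceZ sP).
Qed.

Lemma bwcircC : commutative (@bwcirc F).
Proof.
move=> f g; move: f.
apply: bwpoly_ind => [|t]; first exact: eq_subspace (bwcirc_bil.1 g) (bwcirc_bil.2 g).
move: g; apply: bwpoly_ind => [|u].
  exact: eq_subspace (bwcirc_bil.2 _) (bwcirc_bil.1 _).
rewrite bwcirc_bwt bwcirc_bwt; apply: bwt_comm => /=.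
by rewrite !bwterm_comm_refl orbT.
Qed.

Section Eval.
Variables (V : lmodType F) (circ bul : V -> V -> V).
Hypotheses (circB : bilinear_op circ) (bulB : bilinear_op bul) (circC : commutative circ).
Implicit Type v : nat -> V.

Lemma bweval_linear v : linear (@bweval F V circ bul v).
Proof. exact: linextP. Qed.

Lemma bweval_bwt v t : bweval circ bul v (bwt t) = bwterm_eval circ bul v t.
Proof. by rewrite bwt.unlock -[LHS]/(linext _ _) linextU bwmon_eval_pi. Qed.

Lemma bweval_op b v f g :
  bweval circ bul v (bwmul (bwop b) f g) =
  (if b then circ else bul) (bweval circ bul v f) (bweval circ bul v g).
Proof.
have lv := bweval_linear v.
have bb : bilinear_op (if b then circ else bul) by case: (b).
move: f; apply: bwpoly_ind => [|t].
  apply: eq_subspace => a x y; first by rewrite (bwmul_bil _).1 lv.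
  by rewrite lv bb.1.
move: g; apply: bwpoly_ind => [|u].
  apply: eq_subspace => a x y; first by rewrite (bwmul_bil _).2 lv.
  by rewrite lv bb.2.
rewrite bwmul_bwt bweval_bwt (bweval_bwt v t) (bweval_bwt v u).
by case: (b).
Qed.

Lemma bweval_circ v f g :
  bweval circ bul v (bwcirc f g) = circ (bweval circ bul v f) (bweval circ bul v g).
Proof. exact: (bweval_op true). Qed.
Lemma bweval_bul v f g :
  bweval circ bul v (bwbul f g) = bul (bweval circ bul v f) (bweval circ bul v g).
Proof. exact: (bweval_op false). Qed.

Lemma bwterm_eval_in v v' t :
  {in bwterm_leaves t, v =1 v'} -> bwterm_eval circ bul v t = bwterm_eval circ bul v' t.
Proof.
elim: t => [i|a IHa b IHb|a IHa b IHb] /= e; first by rewrite e ?inE.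
all: by rewrite IHa ?IHb // => i hi; apply: e; rewrite mem_cat hi ?orbT.
Qed.

End Eval.

Lemma bws_linear (v : nat -> bwpoly F) : linear (@bws F v).
Proof. rewrite bws.unlock; exact: bweval_linear. Qed.

Lemma bws0 (v : nat -> bwpoly F) : bws v 0 = 0.
Proof. rewrite bws.unlock; exact: (linear0 (linext (bwmon_eval (@bwcirc F) (@bwbul F) v))). Qed.
Lemma bwsD v f g : bws v (f + g) = bws v f + bws v g.
Proof. rewrite bws.unlock; exact: (linearD (linext (bwmon_eval (@bwcirc F) (@bwbul F) v))). Qed.
Lemma bwsZ v a f : bws v (a *: f) = a *: bws v f.
Proof. rewrite bws.unlock; exact: (linearZ_LR (linext (bwmon_eval (@bwcirc F) (@bwbul F) v))). Qed.

Lemma bws_bwt v t : bws v (bwt t) = bwterm_eval (@bwcirc F) (@bwbul F) v t.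
Proof. rewrite bws.unlock; exact: (bweval_bwt _ bwcircC). Qed.

Lemma bws_circ v f g : bws v (bwcirc f g) = bwcirc (bws v f) (bws v g).
Proof. rewrite bws.unlock; exact: bweval_circ bwcirc_bil bwbul_bil bwcircC _ _ _. Qed.
Lemma bws_bul v f g : bws v (bwbul f g) = bwbul (bws v f) (bws v g).
Proof. rewrite bws.unlock; exact: bweval_bul bwcirc_bil bwbul_bil bwcircC _ _ _. Qed.

Lemma bws_X (v : nat -> bwpoly F) i : bws v (bwt (TVar i)) = v i.
Proof. by rewrite bws_bwt. Qed.

Lemma bwterm_evalX t : bwterm_eval (@bwcirc F) (@bwbul F) (@bwX F) t = bwt t.
Proof.
elim: t => [i|a IHa b IHb|a IHa b IHb]; first by rewrite bwt.unlock -monoE.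
  by rewrite -bwcirc_bwt -IHa -IHb.
by rewrite -bwbul_bwt -IHa -IHb.
Qed.

Fixpoint tsubst (s : nat -> bwterm) (t : bwterm) : bwterm :=
  match t with
  | TVar i => s i
  | TCirc a b => TCirc (tsubst s a) (tsubst s b)
  | TBul a b => TBul (tsubst s a) (tsubst s b)
  end.

Lemma bwterm_eval_bwt s t :
  bwterm_eval (@bwcirc F) (@bwbul F) (fun i => bwt (s i)) t = bwt (tsubst s t).
Proof.
elim: t => [i|a IHa b IHb|a IHa b IHb]; first by [].
  by rewrite /= IHa IHb bwcirc_bwt.
by rewrite /= IHa IHb bwbul_bwt.
Qed.

Lemma leaves_tsubst s t :
  bwterm_leaves (tsubst s t) = flatten [seq bwterm_leaves (s i) | i <- bwterm_leaves t].
Proof.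
by elim: t => [i|a IHa b IHb|a IHa b IHb] /=; rewrite ?cats0 // IHa IHb map_cat flatten_cat.
Qed.

Definition leaves_in (P : seq nat -> Prop) f := suppin (fun m => P (bwterm_leaves (repr m))) f.

Lemma leaves_in_subspace P : subspace (leaves_in P). Proof. exact: suppin_subspace. Qed.

Lemma leaves_in_bwt (P : seq nat -> Prop) t :
  (forall l, perm_eq l (bwterm_leaves t) -> P l) -> leaves_in P (bwt t).
Proof. by move=> h; rewrite bwt.unlock; apply: suppinU; apply: h; apply: leaves_pi. Qed.

Lemma leaves_in_op b (P Q R : seq nat -> Prop) f g :
  (forall l1 l2 l, P l1 -> Q l2 -> perm_eq l (l1 ++ l2) -> R l) ->
  leaves_in P f -> leaves_in Q g -> leaves_in R (bwmul (bwop b) f g).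
Proof.
move=> h hf hg; rewrite bwmul_linext.
apply: (subspace_linext (leaves_in_subspace R)) => m1 /hf h1.
apply: (subspace_linext (leaves_in_subspace R)) => m2 /hg h2.
apply: leaves_in_bwt => l hl; apply: (h _ _ _ h1 h2); rewrite (perm_trans hl) //.
by case: (b).
Qed.

Lemma bws_in v v' f (P : nat -> Prop) : (forall i, P i -> v i = v' i) ->
  leaves_in (fun l : seq nat => forall i, i \in l -> P i) f -> bws v f = bws v' f.
Proof.
move=> e hf; rewrite bws.unlock; apply: eq_linext_in => m /hf hm.
by apply: bwterm_eval_in => i /hm /e.
Qed.

Lemma bws_comp v w f : bws v (bws w f) = bws (fun i => bws v (w i)) f.
Proof.
move: f; apply: bwpoly_ind => [|t].
  apply: eq_subspace => a x y; last by rewrite bws_linear.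
  by rewrite !bws_linear.
rewrite !bws_bwt; elim: t => [i|a IHa b IHb|a IHa b IHb]; first by [].
  by rewrite [bwterm_eval _ _ _ _ in LHS]/= bws_circ IHa IHb.
by rewrite [bwterm_eval _ _ _ _ in LHS]/= bws_bul IHa IHb.
Qed.

Lemma bws_id f : bws (@bwX F) f = f.
Proof.
move: f; apply: bwpoly_ind => [|t]; last by rewrite bws_bwt bwterm_evalX.
by apply: eq_subspace => a x y //; rewrite bws_linear.
Qed.

Lemma BW_leaves n f : f \in BW n <-> leaves_in (fun l => perm_eq l (iota 0 n)) f.
Proof. by split=> [/allP h m /h|h]; [|apply/allP => m /h]. Qed.

Lemma leaves_in_subst s (P Q : seq nat -> Prop) f :
  (forall l, P l -> forall l', perm_eq l' (flatten [seq bwterm_leaves (s i) | i <- l]) -> Q l') ->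
  leaves_in P f -> leaves_in Q (bws (fun i => bwt (s i)) f).
Proof.
move=> h hf; rewrite bws.unlock.
apply: (subspace_linext (leaves_in_subspace Q)) => m /hf hm.
rewrite /bwmon_eval bwterm_eval_bwt; apply: leaves_in_bwt => l; rewrite leaves_tsubst.
exact: h.
Qed.

End BWAlgebra.
Arguments leaves_in_subspace {F} P.

(** * Operad ideals on arbitrary labels *)

Section Ideal.
Variables (F : fieldType) (I : nat -> bwpoly F -> Prop).
Hypothesis opI : operad_ideal I.
Implicit Types (f g : bwpoly F) (t u : bwterm) (L M : seq nat).

Lemma bwperm_bws n (s : 'S_n) f :
  bwperm s f = bws (fun i => bwt (TVar (oapp (fun j : 'I_n => nat_of_ord (s j)) i (insub i)))) f.
Proof. by rewrite /bwperm bws.unlock (funext (fun i => bwX_bwt F _)). Qed.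

Lemma bwcomp_bws i k f g :
  bwcomp i k f g = bws (fun j =>
    if (j < i)%N then bwt (TVar j)
    else if j == i then bws (fun l => bwt (TVar (i + l))) g
    else bwt (TVar (j + k).-1)) f.
Proof.
rewrite /bwcomp bws.unlock; congr (bwsubst _ f); apply: funext => j.
case: ifP => [_|_]; first exact: bwX_bwt.
case: ifP => [_|_]; last exact: bwX_bwt.
by congr (bwsubst _ g); apply: funext => l; exact: bwX_bwt.
Qed.

Definition relab L f : bwpoly F := bws (fun i => bwt (TVar (index i L))) f.

(* [f] is multilinear in the variables labelled by [L], and belongs to the ideal
   once these are renamed to 0, ..., size L - 1. *)
Definition inI L f : Prop :=
  leaves_in (fun l => perm_eq l L) f /\ I (size L) (relab L f).

Lemma inI_subspace L : subspace (inI L).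
Proof.
split.
- split; first exact: (subspace0 (leaves_in_subspace _)).
  rewrite /relab bws0; exact: (operad_ideal0 opI).
- move=> x y [lx Ix] [ly Iy]; split; first exact: (subspaceD (leaves_in_subspace _)).
  rewrite /relab bwsD.
  exact: (operad_idealD opI Ix Iy).
- move=> c x [lx Ix]; split; first exact: (subspaceZ (leaves_in_subspace _)).
  rewrite /relab bwsZ.
  exact: (operad_idealZ opI c Ix).
Qed.

(** Two orderings of the same labels differ by a permutation of positions, and the ideal is stable
    under the symmetric group. *)
Lemma inI_perm L L' f : uniq L -> perm_eq L L' -> inI L f -> inI L' f.
Proof.
move=> uL pL [lf If]; split.
  by apply: suppinW lf => m hm; rewrite (perm_trans hm).
rewrite -(perm_size pL).
case: L uL pL lf If => [|x0 L0] uL pL lf If.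
  move: If; rewrite /relab (bws_in (P := fun=> False) (v' := fun i => bwt (TVar (index i L')))) //.
  by apply: suppinW lf => m hm i; rewrite (perm_mem hm).
set L := x0 :: L0 in uL pL lf If *.
have sL' : size L' = size L by rewrite (perm_size pL).
have sP (j : 'I_(size L)) : (index (nth x0 L j) L' < size L)%N.
  by rewrite -[X in (_ < X)%N]sL' index_mem -(perm_mem pL) mem_nth.
pose sf (j : 'I_(size L)) := Ordinal (sP j).
have sI : injective sf.
  move=> j k /(congr1 val) /= e; apply: val_inj; apply/eqP.
  rewrite -(nth_uniq x0 (ltn_ord j) (ltn_ord k) uL); apply/eqP.
  have mL (l : 'I_(size L)) : nth x0 L l \in L' by rewrite -(perm_mem pL) mem_nth.
  by rewrite -(nth_index x0 (mL j)) e nth_index.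
suff -> : relab L' f = bwperm (perm sI) (relab L f) by exact: (operad_ideal_perm opI _ If).
rewrite bwperm_bws /relab bws_comp; apply: (bws_in (P := fun i => i \in L)).
  move=> i iL; rewrite bws_X; congr (bwt (TVar _)).
  have hi : (index i L < size L)%N by rewrite index_mem.
  by rewrite insubT /= permE /= nth_index.
by apply: suppinW lf => m hm i; rewrite (perm_mem hm).
Qed.

Lemma map_index_uniq L M : uniq L -> uniq M -> perm_eq M L ->
  perm_eq [seq index i L | i <- M] (iota 0 (size L)).
Proof.
move=> uL uM pt; apply: (perm_trans (perm_map _ pt)).
rewrite (_ : map _ L = iota 0 (size L)) //.
apply: (@eq_from_nth _ 0%N); first by rewrite size_map size_iota.
move=> i; rewrite size_map => hi; rewrite (nth_map 0%N) // nth_iota // add0n.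
exact: index_uniq.
Qed.

Lemma relab_BW L f : uniq L -> leaves_in (fun l => perm_eq l L) f -> relab L f \in BW (size L).
Proof.
move=> uL lf; apply/BW_leaves; rewrite /relab.
apply: leaves_in_subst lf => l hl l' hl'; apply: (perm_trans hl').
have -> : flatten [seq bwterm_leaves (TVar (index i L)) | i <- l] = [seq index i L | i <- l].
  by elim: (l) => //= x s ->.
by apply: map_index_uniq => //; rewrite (perm_uniq hl).
Qed.

(** This is partial composition in slot [size A]: once labels are turned into positions, those after
    the slot move by [size M] minus 1. *)
Lemma inI_subst A x B f t :
  uniq (A ++ x :: B) -> uniq (A ++ bwterm_leaves t ++ B) ->
  inI (A ++ x :: B) f ->
  inI (A ++ bwterm_leaves t ++ B) (bws (fun j => bwt (if j == x then t else TVar j)) f).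
Proof.
set M := bwterm_leaves t => uL uM [lf If]; split.
  apply: leaves_in_subst lf => l hl l' hl'; apply: (perm_trans hl').
  apply: (perm_trans (perm_flatten (perm_map _ hl))).
  have id N : x \notin N ->
      flatten [seq bwterm_leaves (if i == x then t else TVar i) | i <- N] = N.
    elim: N => [//|y N IH]; rewrite inE negb_or eq_sym => /andP [/negbTE e /IH] /= ->.
    by rewrite e.
  move: uL; rewrite cat_uniq /= negb_or => /and3P [_ /andP [xA _] /andP [xB _]].
  by rewrite map_cat flatten_cat /= eqxx !id.
have -> : size (A ++ M ++ B) = (size (A ++ x :: B) + size M).-1.
  by rewrite !size_cat /= addnS addSn /= -addnA [(size B + _)%N]addnC.
have -> : relab (A ++ M ++ B) (bws (fun j => bwt (if j == x then t else TVar j)) f) =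
    bwcomp (size A) (size M) (relab (A ++ x :: B) f) (relab M (bwt t)).
  rewrite bwcomp_bws /relab !bws_comp.
  apply: (bws_in (P := fun j => j \in A ++ x :: B)); last first.
    by apply: suppinW lf => m hm i; rewrite (perm_mem hm).
  move=> j; rewrite bws_X.
  move: uL; rewrite cat_uniq /= negb_or => /and3P [_ /andP [xA hAB] /andP [xB _]].
  move: uM; rewrite cat_uniq has_cat negb_or => /and3P [_ /andP [hAM _] uMB].
  have nA N y : ~~ has (mem A) N -> y \in N -> y \notin A.
    by move=> /hasPn h /h.
  have -> : bws (fun i => bwt (TVar (index i (A ++ M ++ B)))) (bwt (if j == x then t else TVar j)) =
      if j == x then bws (fun i => bwt (TVar (index i (A ++ M ++ B)))) (bwt t)
      else bwt (TVar (index j (A ++ M ++ B))) :> bwpoly F.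
    by case: (j == x); [|exact: bws_X].
  rewrite mem_cat inE => /orP[jA|/orP[/eqP ->|jB]].
  - have jx : j != x by apply: contraNneq xA => <-.
    by rewrite (negbTE jx) !index_cat jA index_mem jA.
  - rewrite eqxx index_cat (negbTE xA) /= eqxx addn0 ltnn eqxx.
    apply: (bws_in (P := fun i => i \in M)) => [i iM|].
      by rewrite bws_X index_cat (negbTE (nA _ _ hAM iM)) index_cat iM.
    by apply: leaves_in_bwt => l hl i; rewrite (perm_mem hl).
  - have jx : j != x by apply: contraNneq xB => <-.
    have jA := nA _ _ hAB jB.
    have jM : j \notin M.
      move: uMB; rewrite cat_uniq => /and3P [_ /hasPn h _]; exact: h.
    rewrite (negbTE jx) !index_cat (negbTE jA) (negbTE jM) /= eq_sym (negbTE jx).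
    rewrite ltnNge leq_addr [~~ true]/= ifF; last by rewrite -[X in _ == X]addn0 eqn_add2l.
    by congr (bwt (TVar _)); rewrite addnS addSn /= -addnA [(index j B + _)%N]addnC.
apply: (operad_ideal_compl opI _ If).
  by rewrite size_cat /= addnS ltnS leq_addr.
apply: relab_BW; last by apply: leaves_in_bwt.
by move: uM; rewrite !cat_uniq => /and3P [_ _ /and3P []].
Qed.

(** The product is [b] applied to two variables, composed with [f] in the first slot and then with
    [t] in the last one. Keeping [b] abstract covers both operations and the opposite of [bwbul]. *)
Lemma inI_op (b : bwpoly F -> bwpoly F -> bwpoly F) L f t :
  (forall v f g, bws v (b f g) = b (bws v f) (bws v g)) ->
  (forall P Q R f g, (forall l1 l2 l, P l1 -> Q l2 -> perm_eq l (l1 ++ l2) -> R l) ->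
    leaves_in P f -> leaves_in Q g -> leaves_in R (b f g)) ->
  uniq (L ++ bwterm_leaves t) -> inI L f -> inI (L ++ bwterm_leaves t) (b f (bwt t)).
Proof.
move=> bS bL uL [lf If]; set M := bwterm_leaves t in uL *.
have supp : leaves_in (fun l => perm_eq l (L ++ M)) (b f (bwt t)).
  apply: bL lf (leaves_in_bwt (P := fun l => perm_eq l M) _) => // l1 l2 l h1 h2 h.
  exact: perm_trans h (perm_cat h1 h2).
split=> //.
pose e : bwpoly F := b (bwt (TVar 0)) (bwt (TVar 1)).
have eBW : e \in BW 2.
  apply/BW_leaves; apply: (bL (fun l => perm_eq l [:: 0]) (fun l => perm_eq l [:: 1])).
  - by move=> l1 l2 l h1 h2 h; apply: (perm_trans h (perm_cat h1 h2)).
  - exact: leaves_in_bwt.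
  - exact: leaves_in_bwt.
have Ie := operad_ideal_compr opI (isT : 0 < 2)%N eBW If.
have tBW : relab M (bwt t) \in BW (size M).
  apply: relab_BW; last exact: leaves_in_bwt.
  by move: uL; rewrite cat_uniq => /and3P [].
have lt : (size L < (2 + size L).-1)%N by [].
have := operad_ideal_compl opI lt Ie tBW.
rewrite size_cat !bwcomp_bws /e !bS !bws_X /= ltnn eqxx bws_comp.
congr (I _ _); rewrite /relab bS; congr (b _ _).
  rewrite !bws_comp; apply: (bws_in (P := fun i => i \in L)) => [i iL|].
    by rewrite bws_X bws_X add0n index_mem iL index_cat iL.
  by apply: suppinW lf => m hm i; rewrite (perm_mem hm).
rewrite bws_comp; apply: (bws_in (P := fun i => i \in M)) => [i iM|].
  rewrite bws_X index_cat ifF //; apply/negbTE.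
  by move: uL; rewrite cat_uniq => /and3P [_ /hasPn h _]; exact: h.
by apply: leaves_in_bwt => l hl i; rewrite (perm_mem hl).
Qed.

End Ideal.

(** * The T-ideal of the post-Jordan identities *)

Section PostJordanFormal.
Local Notation a := (TVar 0).
Local Notation b := (TVar 1).
Local Notation c := (TVar 2).
Local Notation d := (TVar 3).
Local Notation "x ∘ y" := (TCirc x y) (at level 40, left associativity).
Local Notation "x ∙ y" := (TBul x y) (at level 40, left associativity).

(** Copies of [post_jordan1] to [post_jordan7] on which certificates can be computed. *)
Definition post_jordan_formals : seq formal := [::
  [:: (1%Z, ((c ∙ a) ∘ b) ∘ d);
      (1%Z, ((d ∙ a) ∘ b) ∘ c);
      ((-1)%Z, ((b ∘ c) ∙ a) ∘ d);
      ((-1)%Z, ((b ∘ d) ∙ a) ∘ c);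
      ((-1)%Z, ((c ∘ d) ∙ a) ∘ b);
      (1%Z, ((c ∘ d) ∘ b) ∙ a)];
  [:: (1%Z, ((b ∘ c) ∙ a) ∘ d);
      (1%Z, ((b ∘ d) ∙ a) ∘ c);
      (1%Z, ((c ∘ d) ∙ a) ∘ b);
      ((-1)%Z, (b ∘ c) ∘ (d ∙ a));
      ((-1)%Z, (b ∘ d) ∘ (c ∙ a));
      ((-1)%Z, (c ∘ d) ∘ (b ∙ a))];
  [:: (1%Z, ((a ∘ b) ∘ d) ∘ c);
      (1%Z, ((a ∘ c) ∘ d) ∘ b);
      (1%Z, ((b ∘ c) ∘ d) ∘ a);
      ((-1)%Z, (a ∘ b) ∘ (c ∘ d));
      ((-1)%Z, (a ∘ c) ∘ (b ∘ d));
      ((-1)%Z, (a ∘ d) ∘ (b ∘ c))];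
  [:: (1%Z, ((c ∙ a) ∙ b) ∘ d);
      (1%Z, ((d ∙ a) ∙ b) ∘ c);
      ((-1)%Z, (d ∙ (a ∘ b)) ∘ c);
      ((-1)%Z, (d ∙ (a ∙ b)) ∘ c);
      ((-1)%Z, (d ∙ (b ∙ a)) ∘ c);
      ((-1)%Z, ((c ∙ a) ∘ d) ∙ b);
      ((-1)%Z, ((c ∙ b) ∘ d) ∙ a);
      (1%Z, ((c ∘ d) ∙ b) ∙ a)];
  [:: (1%Z, (d ∙ (a ∘ b)) ∘ c);
      (1%Z, (d ∙ (a ∙ b)) ∘ c);
      (1%Z, (d ∙ (b ∙ a)) ∘ c);
      ((-1)%Z, (c ∙ a) ∘ (d ∙ b));
      ((-1)%Z, (c ∙ b) ∘ (d ∙ a));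
      (1%Z, ((c ∙ a) ∘ d) ∙ b);
      (1%Z, ((c ∙ b) ∘ d) ∙ a);
      ((-1)%Z, (c ∘ d) ∙ (a ∘ b));
      ((-1)%Z, (c ∘ d) ∙ (a ∙ b));
      ((-1)%Z, (c ∘ d) ∙ (b ∙ a))];
  [:: (1%Z, (d ∙ (a ∘ b)) ∙ c);
      (1%Z, (d ∙ (a ∘ c)) ∙ b);
      (1%Z, (d ∙ (b ∘ c)) ∙ a);
      (1%Z, (d ∙ (a ∙ b)) ∙ c);
      (1%Z, (d ∙ (a ∙ c)) ∙ b);
      (1%Z, (d ∙ (b ∙ a)) ∙ c);
      (1%Z, (d ∙ (b ∙ c)) ∙ a);
      (1%Z, (d ∙ (c ∙ a)) ∙ b);
      (1%Z, (d ∙ (c ∙ b)) ∙ a);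
      ((-1)%Z, (d ∙ a) ∙ (b ∘ c));
      ((-1)%Z, (d ∙ b) ∙ (a ∘ c));
      ((-1)%Z, (d ∙ c) ∙ (a ∘ b));
      ((-1)%Z, (d ∙ a) ∙ (b ∙ c));
      ((-1)%Z, (d ∙ a) ∙ (c ∙ b));
      ((-1)%Z, (d ∙ b) ∙ (a ∙ c));
      ((-1)%Z, (d ∙ b) ∙ (c ∙ a));
      ((-1)%Z, (d ∙ c) ∙ (a ∙ b));
      ((-1)%Z, (d ∙ c) ∙ (b ∙ a))];
  [:: (1%Z, ((d ∙ a) ∙ c) ∙ b);
      (1%Z, ((d ∙ b) ∙ c) ∙ a);
      ((-1)%Z, (d ∙ (a ∘ b)) ∙ c);
      ((-1)%Z, (d ∙ (a ∘ c)) ∙ b);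
      ((-1)%Z, (d ∙ (b ∘ c)) ∙ a);
      ((-1)%Z, (d ∙ (a ∙ b)) ∙ c);
      ((-1)%Z, (d ∙ (a ∙ c)) ∙ b);
      ((-1)%Z, (d ∙ (b ∙ a)) ∙ c);
      ((-1)%Z, (d ∙ (b ∙ c)) ∙ a);
      ((-1)%Z, (d ∙ (c ∙ a)) ∙ b);
      ((-1)%Z, (d ∙ (c ∙ b)) ∙ a);
      (1%Z, d ∙ ((a ∘ b) ∘ c));
      (1%Z, d ∙ ((a ∙ b) ∘ c));
      (1%Z, d ∙ ((b ∙ a) ∘ c));
      (1%Z, d ∙ ((a ∘ b) ∙ c));
      (1%Z, d ∙ ((a ∙ b) ∙ c));
      (1%Z, d ∙ ((b ∙ a) ∙ c));
      (1%Z, d ∙ (c ∙ (a ∘ b)));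
      (1%Z, d ∙ (c ∙ (a ∙ b)));
      (1%Z, d ∙ (c ∙ (b ∙ a)))]].

End PostJordanFormal.

Section PostJordanIdeal.
Variable F : fieldType.
Implicit Types (f g : bwpoly F) (t u : bwterm).
Local Notation fv := (fval (@bwcirc F) (@bwbul F)).

Lemma post_jordan_formalP (I : nat -> bwpoly F -> Prop) L :
  (forall k g, post_jordan_identity k g -> I k g) ->
  L \in post_jordan_formals -> I 4 (fv (@bwX F) L).
Proof.
move=> h.
have E (p q : bwpoly F) : q = p -> I 4 p -> I 4 q by move=> ->.
have e1 v t L' : fv v ((1%Z, t) :: L') = bwterm_eval (@bwcirc F) (@bwbul F) v t + fv v L'.
  by rewrite /fval big_cons scale1r.
have eN v t L' : fv v (((-1)%Z, t) :: L') = - bwterm_eval (@bwcirc F) (@bwbul F) v t + fv v L'.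
  by rewrite /fval big_cons scaleN1r.
have l1 v t : fv v [:: (1%Z, t)] = bwterm_eval (@bwcirc F) (@bwbul F) v t.
  by rewrite /fval big_seq1 scale1r.
have lN v t : fv v [:: ((-1)%Z, t)] = - bwterm_eval (@bwcirc F) (@bwbul F) v t.
  by rewrite /fval big_seq1 scaleN1r.
rewrite !inE => hL.
case/predU1P: hL => [->|hL].
  apply: (E _ _ _ (h _ _ (PostJordan1 F))); rewrite !(l1, lN, e1, eN).
  by rewrite !addrA.
case/predU1P: hL => [->|hL].
  apply: (E _ _ _ (h _ _ (PostJordan2 F))); rewrite !(l1, lN, e1, eN).
  by rewrite !addrA.
case/predU1P: hL => [->|hL].
  apply: (E _ _ _ (h _ _ (PostJordan3 F))); rewrite !(l1, lN, e1, eN).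
  by rewrite !addrA.
case/predU1P: hL => [->|hL].
  apply: (E _ _ _ (h _ _ (PostJordan4 F))); rewrite !(l1, lN, e1, eN).
  by rewrite !addrA.
case/predU1P: hL => [->|hL].
  apply: (E _ _ _ (h _ _ (PostJordan5 F))); rewrite !(l1, lN, e1, eN).
  by rewrite !addrA.
case/predU1P: hL => [->|/eqP ->].
  apply: (E _ _ _ (h _ _ (PostJordan6 F))); rewrite !(l1, lN, e1, eN).
  by rewrite !addrA.
apply: (E _ _ _ (h _ _ (PostJordan7 F))); rewrite !(l1, lN, e1, eN).
by rewrite !addrA.
Qed.

Lemma post_jordan_leaves L p : L \in post_jordan_formals -> p \in L ->
  perm_eq (bwterm_leaves p.2) (iota 0 4).
Proof.
have : all (all (fun p : Z * bwterm => perm_eq (bwterm_leaves p.2) (iota 0 4)))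
  post_jordan_formals by vm_compute.
by move=> /allP h /h /allP h' /h'.
Qed.

Lemma fval_in v v' L : L \in post_jordan_formals -> (forall i, (i < 4)%N -> v i = v' i) ->
  fv v L = fv v' L.
Proof.
move=> hL e; apply: eq_big_seq => p hp; congr (_ *: _).
apply: bwterm_eval_in => i; rewrite (perm_mem (post_jordan_leaves hL hp)) mem_iota => /andP[_ h].
exact: e.
Qed.

Lemma bws_eval v w t : bws v (bwterm_eval (@bwcirc F) (@bwbul F) w t) =
  bwterm_eval (@bwcirc F) (@bwbul F) (fun i => bws v (w i)) t.
Proof.
elim: t => [i|a IHa b IHb|a IHa b IHb]; cbn [bwterm_eval]; first exact: erefl.
  by rewrite bws_circ IHa IHb.
by rewrite bws_bul IHa IHb.
Qed.

Lemma bws_fval v w L : bws v (fv w L) = fv (fun i => bws v (w i)) L.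
Proof.
rewrite /fval (big_morph (bws v) (bwsD v) (bws0 v)).
by apply: eq_bigr => p _; rewrite bwsZ bws_eval.
Qed.

Lemma fval_bwt s L : fv (fun i => bwt (s i)) L = \sum_(p <- L) ZtoF F p.1 *: bwt (tsubst s p.2).
Proof. by apply: eq_bigr => p _; rewrite bwterm_eval_bwt. Qed.

Definition subst_leaves (s : nat -> bwterm) (r : seq nat) := flatten [seq bwterm_leaves (s i) | i <- r].

Lemma tsubst_leaves s L p : L \in post_jordan_formals -> p \in L ->
  perm_eq (bwterm_leaves (tsubst s p.2)) (subst_leaves s (iota 0 4)).
Proof.
move=> hL hp; rewrite leaves_tsubst; apply: perm_flatten; apply: perm_map.
exact: post_jordan_leaves hp.
Qed.

(** The T-ideal N. Its generators are instances at arbitrary terms, with repeated variables allowed,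
    and it lives in one algebra instead of a family of arities; [inI_ideal] leads back to operad
    ideals. *)
Inductive post_jordan_ideal : bwpoly F -> Prop :=
  | PJGen L s of L \in post_jordan_formals : post_jordan_ideal (fv (fun i => bwt (s i)) L)
  | PJ0 : post_jordan_ideal 0
  | PJD f g of post_jordan_ideal f & post_jordan_ideal g : post_jordan_ideal (f + g)
  | PJZ c f of post_jordan_ideal f : post_jordan_ideal (c *: f)
  | PJCirc f g of post_jordan_ideal f : post_jordan_ideal (bwcirc f g)
  | PJBull f g of post_jordan_ideal f : post_jordan_ideal (bwbul f g)
  | PJBulr f g of post_jordan_ideal f : post_jordan_ideal (bwbul g f).

Definition multipart (L : seq nat) f : bwpoly F :=
  @linext F bwmon {malg F[bwmon]}
    (fun m => if perm_eq (bwterm_leaves (repr m)) L then mono m else 0) f.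

Lemma multipart_bwt L t :
  multipart L (bwt t) = if perm_eq (bwterm_leaves t) L then bwt t else 0.
Proof.
rewrite /multipart [in LHS]bwt.unlock linextU bwt.unlock.
by rewrite (permPl (leaves_pi t)).
Qed.

Lemma multipart_lin L : linear (multipart L).
Proof. exact: linextP. Qed.

Lemma multipart_id L f : leaves_in (fun l => perm_eq l L) f -> multipart L f = f.
Proof.
move=> h; rewrite -[RHS]linext_id; apply: eq_linext_in => m /h.
by rewrite /= => ->.
Qed.

Section InIdeal.
Variable I : nat -> bwpoly F -> Prop.
Hypothesis opI : operad_ideal I.
Hypothesis subI : forall k g, post_jordan_identity k g -> I k g.

(** The four variables are replaced one at a time by [inI_subst]. Those still waiting carry labels
    [N + i], larger than every label in use, so the labels stay distinct throughout. *)
Lemma inI_gen s L : L \in post_jordan_formals -> uniq (subst_leaves s (iota 0 4)) ->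
  inI I (subst_leaves s (iota 0 4)) (fv (fun i => bwt (s i)) L).
Proof.
move=> hL uM; set M := subst_leaves s (iota 0 4) in uM *.
pose N := (\max_(x <- M) x).+1.
have ltN x : x \in M -> (x < N)%N.
  by move=> xM; rewrite ltnS (big_rem _ xM) /= leq_maxl.
have step k : (k <= 4)%N ->
    inI I (subst_leaves s (iota 0 k) ++ [seq (N + i)%N | i <- iota k (4 - k)])
      (fv (fun i => bwt (if (i < k)%N then s i else TVar (N + i))) L).
  elim: k => [_|k IH lt].
    split.
      rewrite (fval_in (v' := fun i => bwt (TVar (N + i))) hL) // fval_bwt.
      apply: (subspace_sum (leaves_in_subspace _)) => p hp.
      apply: (subspaceZ (leaves_in_subspace _)); apply: leaves_in_bwt => l hl.
      apply: (perm_trans hl); apply: (perm_trans (tsubst_leaves _ hL hp)).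
      by rewrite /subst_leaves /=.
    rewrite /relab bws_fval.
    rewrite (fval_in (v' := @bwX F) hL); first exact: post_jordan_formalP.
    move=> i hi; rewrite bws_X bwX_bwt; congr (bwt (TVar _)).
    have uN : uniq [seq (N + i)%N | i <- iota 0 4].
      by rewrite map_inj_uniq ?iota_uniq // => x y /addnI.
    have si : (i < size [seq (N + i)%N | i <- iota 0 4])%N by [].
    rewrite -[RHS](index_uniq 0%N si uN) (nth_map 0%N) ?size_iota // nth_iota //.
  have lt4 : (k < 4)%N by [].
  have kM i x : (i < 4)%N -> x \in bwterm_leaves (s i) -> x \in M.
    by move=> hi hx; apply/flattenP; exists (bwterm_leaves (s i)) => //;
       apply/mapP; exists i => //; rewrite mem_iota.
  have {}IH := IH (ltnW lt4).
  have e4 : (4 - k)%N = (4 - k.+1).+1 by rewrite subnS prednK // subn_gt0.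
  rewrite e4 /= in IH.
  have eI : iota 0 4 = iota 0 k ++ k :: iota k.+1 (4 - k.+1).
    by rewrite -[k :: _]/(iota k (4 - k.+1).+1) -e4 -{2}[k]add0n -iotaD subnKC // ltnW.
  have eM : M = subst_leaves s (iota 0 k) ++ bwterm_leaves (s k) ++ subst_leaves s (iota k.+1 (4 - k.+1)).
    by rewrite /M eI /subst_leaves map_cat flatten_cat.
  have uNk j r : uniq [seq (N + i)%N | i <- iota j r].
    by rewrite map_inj_uniq ?iota_uniq // => x y /addnI.
  have disj (X : seq nat) j r : {subset X <= M} -> ~~ has (mem X) [seq (N + i)%N | i <- iota j r].
    move=> sub; apply/hasPn => x /mapP [i _ ->]; apply/negP => /sub /ltN.
    by rewrite ltnNge leq_addr.
  have sub0 : {subset subst_leaves s (iota 0 k) <= M}.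
    by move=> x hx; rewrite eM mem_cat hx.
  have sub1 : {subset subst_leaves s (iota 0 k) ++ bwterm_leaves (s k) <= M}.
    by move=> x hx; rewrite eM catA mem_cat hx.
  have u1 : uniq (subst_leaves s (iota 0 k) ++ bwterm_leaves (s k)).
    by move: uM; rewrite eM catA cat_uniq => /and3P [].
  have u0 : uniq (subst_leaves s (iota 0 k)) by move: u1; rewrite cat_uniq => /and3P [].
  have := @inI_subst F I opI (subst_leaves s (iota 0 k)) (N + k)
    [seq (N + i)%N | i <- iota k.+1 (4 - k.+1)] _ (s k) _ _ IH.
  rewrite (_ : subst_leaves s (iota 0 k.+1) = subst_leaves s (iota 0 k) ++ bwterm_leaves (s k)); last first.
    by rewrite -addn1 iotaD /subst_leaves map_cat flatten_cat /= cats0.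
  rewrite -catA bws_fval => h.
  rewrite (fval_in (v' := fun i => bws (fun j => bwt (if j == N + k then s k else TVar j))
     (bwt (if (i < k)%N then s i else TVar (N + i)))) hL).
    apply: h; last by rewrite catA cat_uniq u1 uNk disj.
    rewrite -[(N + k)%N :: _]/[seq (N + i)%N | i <- iota k (4 - k.+1).+1].
    by rewrite cat_uniq u0 uNk disj.
  move=> i hi; rewrite ltnS leq_eqVlt; case: eqP => [->|/eqP ne] /=.
    by rewrite ltnn bws_X eqxx.
  case: ifP => [lik|_]; last by rewrite bws_X eqn_add2l (negbTE ne).
  rewrite bws_bwt -bwterm_evalX; apply: bwterm_eval_in => x hx.
  rewrite ifF; first exact: bwX_bwt.
  apply/eqP=> e; have := ltN _ (kM _ _ hi hx); by rewrite e ltnNge leq_addr.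
have := step 4 isT; rewrite /= cats0.
rewrite (fval_in (v' := fun i => bwt (s i)) hL) // => i hi.
by rewrite hi.
Qed.

Lemma multipart_sum L (r : formal) (h : Z * bwterm -> bwpoly F) :
  multipart L (\sum_(p <- r) h p) = \sum_(p <- r) multipart L (h p).
Proof. exact: (linear_sum (linext _)). Qed.

Lemma multipartZ L c f : multipart L (c *: f) = c *: multipart L f.
Proof. exact: (linearZ_LR (linext _)). Qed.

(** By linearity the second factor is a term with leaves M. The component of the product is then the
    product of [t] with the component of [f] on the labels of L outside M, or zero if L does not
    contain M. *)
Lemma inI_multipart_op (b : bwpoly F -> bwpoly F -> bwpoly F) (o : bwterm -> bwterm -> bwterm) f :
  bilinear_op b ->
  (forall v f g, bws v (b f g) = b (bws v f) (bws v g)) ->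
  (forall P Q R f g, (forall l1 l2 l, P l1 -> Q l2 -> perm_eq l (l1 ++ l2) -> R l) ->
    leaves_in P f -> leaves_in Q g -> leaves_in R (b f g)) ->
  (forall u t, b (bwt u) (bwt t) = bwt (o u t)) ->
  (forall u t, perm_eq (bwterm_leaves (o u t)) (bwterm_leaves u ++ bwterm_leaves t)) ->
  (forall L, uniq L -> inI I L (multipart L f)) ->
  forall g L, uniq L -> inI I L (multipart L (b f g)).
Proof.
move=> bb bS bL bT oT IH; apply: bwpoly_ind => [|t L uL].
  split=> [L uL|x y hx hy L uL|c x hx L uL].
  - rewrite (bilop0r bb) (_ : multipart L 0 = 0); first exact: subspace0 (inI_subspace opI L).
    exact: (linear0 (linext _)).
  - rewrite (bilopDr bb) (_ : multipart L (_ + _) = multipart L (b f x) + multipart L (b f y)).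
      exact: (subspaceD (inI_subspace opI L) (hx L uL) (hy L uL)).
    exact: (linearD (linext _)).
  - rewrite (bilopZr bb) multipartZ.
    exact: (subspaceZ (inI_subspace opI L) c (hx L uL)).
set M := bwterm_leaves t in oT *.
case: (pselect (exists A, perm_eq (A ++ M) L)) => [[A pA]|noA].
  have uAM : uniq (A ++ M) by rewrite (perm_uniq pA).
  have -> : multipart L (b f (bwt t)) = b (multipart A f) (bwt t).
    move: {IH} f; apply: bwpoly_ind.
      apply: eq_subspace => c x y; rewrite ?multipart_lin bb.1 ?multipart_lin; exact: erefl.
    move=> u; rewrite bT !multipart_bwt (permPl (oT u t)) -(permPr pA) perm_cat2r.
    by case: ifP => _; rewrite ?bT // (bilop0l bb).
  apply: (inI_perm opI uAM pA); apply: (inI_op opI bS bL uAM).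
  by apply: IH; move: uAM; rewrite cat_uniq => /and3P [].
have -> : multipart L (b f (bwt t)) = 0.
  move: {IH} f; apply: bwpoly_ind.
    apply: (@eq_subspace _ _ _ (fun f => multipart L (b f (bwt t))) (fun=> 0)) => c x y.
      by rewrite bb.1 multipart_lin.
    by rewrite scaler0 addr0.
  move=> u; rewrite bT multipart_bwt (permPl (oT u t)); case: ifP => // pu.
  by case: noA; exists (bwterm_leaves u).
exact: subspace0 (inI_subspace opI L).
Qed.

(** The identities are multilinear and are instantiated at terms, so every generator of N is
    multihomogeneous: its component on [L] is the generator itself or zero. *)
Lemma inI_ideal f : post_jordan_ideal f -> forall L, uniq L -> inI I L (multipart L f).
Proof.
elim=> {f} [L' s hL|L uL|f g _ IHf _ IHg L uL|c f _ IHf L uL|f g _ IHf|f g _ IHf|f g _ IHf].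
- move=> L uL; rewrite fval_bwt multipart_sum big_seq.
  have [pM|npM] := boolP (perm_eq (subst_leaves s (iota 0 4)) L).
    rewrite (eq_bigr (fun p => ZtoF F p.1 *: bwt (tsubst s p.2))); last first.
      move=> p hp; rewrite multipartZ multipart_bwt.
      by rewrite (permPl (tsubst_leaves s hL hp)) pM.
    have uM : uniq (subst_leaves s (iota 0 4)) by rewrite (perm_uniq pM).
    rewrite -big_seq -fval_bwt; exact: (inI_perm opI uM pM (inI_gen hL uM)).
  rewrite big1 => [|p hp]; first exact: subspace0 (inI_subspace opI L).
  rewrite multipartZ multipart_bwt (permPl (tsubst_leaves s hL hp)) (negbTE npM).
  exact: scaler0.
- rewrite (_ : multipart L 0 = 0); first exact: subspace0 (inI_subspace opI L).
  exact: (linear0 (linext _)).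
- rewrite (_ : multipart L (_ + _) = multipart L f + multipart L g).
    exact: (subspaceD (inI_subspace opI L) (IHf L uL) (IHg L uL)).
  exact: (linearD (linext _)).
- rewrite multipartZ; exact: (subspaceZ (inI_subspace opI L) c (IHf L uL)).
- move=> L uL; apply: (inI_multipart_op (o := TCirc) (bwcirc_bil F)) uL => //.
  + by move=> *; apply: bws_circ.
  + by move=> P Q R f' g' h hf hg; apply: (@leaves_in_op F true P Q).
  + by move=> *; apply: bwcirc_bwt.
- move=> L uL; apply: (inI_multipart_op (o := TBul) (bwbul_bil F)) uL => //.
  + by move=> *; apply: bws_bul.
  + by move=> P Q R f' g' h hf hg; apply: (@leaves_in_op F false P Q).
  + by move=> *; apply: bwbul_bwt.
- move=> L uL.
  apply: (inI_multipart_op (b := fun x y => bwbul y x) (o := fun x y => TBul y x)) uL => //.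
  + by split=> z; [exact: (bwbul_bil F).2 | exact: (bwbul_bil F).1].
  + by move=> *; apply: bws_bul.
  + move=> P Q R f' g' h hf hg; apply: (@leaves_in_op F false Q P) => // l1 l2 l h1 h2 hl.
    by apply: (h _ _ _ h2 h1); rewrite (perm_trans hl) // perm_catC.
  + by move=> *; apply: bwbul_bwt.
  + by move=> u t /=; rewrite perm_catC.
Qed.

Lemma ideal_BW n f : f \in BW n -> post_jordan_ideal f -> I n f.
Proof.
move=> /BW_leaves lf /inI_ideal /(_ (iota 0 n) (iota_uniq 0 n)).
rewrite multipart_id // => -[_]; rewrite size_iota /relab.
rewrite (bws_in (P := fun i => (i < n)%N) (v' := fun i => bwt (TVar i))); last first.
- by apply: suppinW lf => m hm i; rewrite (perm_mem hm) mem_iota.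
- move=> i hi; congr (bwt (TVar _)).
  by rewrite -[RHS](index_uniq 0%N _ (iota_uniq 0 n)) ?nth_iota ?size_iota.
have -> : (fun i => bwt (TVar i)) = @bwX F by apply: funext => i; rewrite bwX_bwt.
by rewrite bws_id.
Qed.

End InIdeal.

Lemma post_jordan_ideal_consequence n f : f \in BW n -> post_jordan_ideal f ->
  bw_consequence (@post_jordan_identity F) n f.
Proof. by move=> hf idf I opI subI; apply: ideal_BW. Qed.

End PostJordanIdeal.

(** * The Jordan algebra of pairs *)

Definition fmul (o : bwterm -> bwterm -> bwterm) (L M : formal) : formal :=
  [seq ((p.1 * q.1)%Z, o p.2 q.2) | p <- L, q <- M].

Definition fhat (x y : formal * formal) : formal * formal :=
  (fmul TCirc x.1 y.1 ++ fmul TBul x.1 y.2 ++ fmul TBul y.1 x.2,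
   fmul TCirc x.2 y.2 ++ fmul TBul x.2 y.2 ++ fmul TBul y.2 x.2).

Definition fhat_add (c : Z) (x y : formal * formal) : formal * formal :=
  (x.1 ++ fscale c y.1, x.2 ++ fscale c y.2).

Definition fhat_jordan (x y z t : formal * formal) : formal * formal :=
  let m := fhat in
  fhat_add (-1) (fhat_add (-1) (fhat_add (-1) (fhat_add 1 (fhat_add 1
    (m (m (m x y) t) z) (m (m (m x z) t) y)) (m (m (m y z) t) x))
    (m (m x y) (m z t))) (m (m x z) (m y t))) (m (m x t) (m y z)).

Definition fhat_var (i : nat) : formal * formal :=
  ([:: (1%Z, TVar i)], [:: (1%Z, TVar (4 + i))]).

(* Each entry (z, k, s) is z times the identity k + 1 at the variables s; variables below 4
   are marked, variable 4 + i is the unmarked copy of variable i. *)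
Definition jordan_hat_cert : seq (Z * nat * seq nat) := [::
  (1%Z, 5, [:: 4; 5; 6; 3]);
  (1%Z, 6, [:: 4; 5; 7; 2]);
  (1%Z, 5, [:: 4; 5; 7; 2]);
  (1%Z, 4, [:: 4; 5; 2; 3]);
  (1%Z, 6, [:: 4; 6; 7; 1]);
  (1%Z, 5, [:: 4; 6; 7; 1]);
  (1%Z, 4, [:: 4; 6; 1; 3]);
  (1%Z, 3, [:: 4; 7; 1; 2]);
  (1%Z, 4, [:: 4; 7; 1; 2]);
  (1%Z, 1, [:: 4; 1; 2; 3]);
  (1%Z, 0, [:: 4; 3; 1; 2]);
  (1%Z, 6, [:: 5; 6; 7; 0]);
  (1%Z, 5, [:: 5; 6; 7; 0]);
  (1%Z, 4, [:: 5; 6; 0; 3]);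
  (1%Z, 3, [:: 5; 7; 0; 2]);
  (1%Z, 4, [:: 5; 7; 0; 2]);
  (1%Z, 1, [:: 5; 0; 2; 3]);
  (1%Z, 0, [:: 5; 3; 0; 2]);
  (1%Z, 3, [:: 6; 7; 0; 1]);
  (1%Z, 4, [:: 6; 7; 0; 1]);
  (1%Z, 1, [:: 6; 0; 1; 3]);
  (1%Z, 0, [:: 6; 3; 0; 1]);
  (1%Z, 1, [:: 7; 0; 1; 2]);
  (1%Z, 2, [:: 0; 1; 2; 3])].

Definition cert_formal (rho : nat -> nat) (C : seq (Z * nat * seq nat)) : formal :=
  flatten [seq fscale (- p.1.1)
    [seq (q.1, tsubst (fun i => TVar (rho (nth 0 p.2 i))) q.2)
      | q <- nth [::] post_jordan_formals p.1.2] | p <- C].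

Lemma jordan_hat_check1 :
  vanishes ((fhat_jordan (fhat_var 0) (fhat_var 1) (fhat_var 2) (fhat_var 3)).1
            ++ cert_formal id jordan_hat_cert).
Proof. by vm_compute. Qed.

(** On the diagonal q = r the first component of the product is given by the formula of the second.
    Hence unmarking all variables turns the certificate for the first component into one for the
    second. *)
Lemma jordan_hat_check2 :
  vanishes ((fhat_jordan (fhat_var 0) (fhat_var 1) (fhat_var 2) (fhat_var 3)).2
            ++ cert_formal (fun i => 4 + i %% 4)%N jordan_hat_cert).
Proof. by vm_compute. Qed.

Section PostJordanHat.
Variable F : fieldType.
Implicit Types (f g : bwpoly F).
Local Notation fv := (fval (@bwcirc F) (@bwbul F)).
Local Notation N := (@post_jordan_ideal F).

Lemma ideal_subspace : subspace N.
Proof. split; [exact: PJ0|exact: PJD|exact: PJZ]. Qed.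

(** Each of the four variables occurs exactly once in every term of a defining identity. *)
Lemma fval_slot_linear L k (v : nat -> bwpoly F) : L \in post_jordan_formals -> (k < 4)%N ->
  linear (fun x : bwpoly F => fv (fun i => if i == k then x else v i) L).
Proof.
move=> hL hk.
have ev_out t : k \notin bwterm_leaves t -> forall x y : bwpoly F,
    bwterm_eval (@bwcirc F) (@bwbul F) (fun i => if i == k then x else v i) t =
    bwterm_eval (@bwcirc F) (@bwbul F) (fun i => if i == k then y else v i) t.
  move=> kt x y; apply: bwterm_eval_in => i it.
  by rewrite ifN ?ifN //; apply: contraNneq kt => <-.
have ev_lin t : count_mem k (bwterm_leaves t) = 1%N ->
    linear (fun x : bwpoly F => bwterm_eval (@bwcirc F) (@bwbul F) (fun i => if i == k then x else v i) t).
  have lin2 (op : bwpoly F -> bwpoly F -> bwpoly F) a b : bilinear_op op ->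
      (count_mem k (bwterm_leaves a) = 1%N -> linear (fun x : bwpoly F => bwterm_eval (@bwcirc F) (@bwbul F)
        (fun i => if i == k then x else v i) a)) ->
      (count_mem k (bwterm_leaves b) = 1%N -> linear (fun x : bwpoly F => bwterm_eval (@bwcirc F) (@bwbul F)
        (fun i => if i == k then x else v i) b)) ->
      count_mem k (bwterm_leaves a ++ bwterm_leaves b) = 1%N ->
      linear (fun x : bwpoly F => op
        (bwterm_eval (@bwcirc F) (@bwbul F) (fun i => if i == k then x else v i) a)
        (bwterm_eval (@bwcirc F) (@bwbul F) (fun i => if i == k then x else v i) b)).
    move=> bop IHa IHb; rewrite count_cat => e.
    case ca: (count_mem k (bwterm_leaves a)) e => [|[|n]] e.
    - have kb : count_mem k (bwterm_leaves b) = 1%N by [].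
      have ka : k \notin bwterm_leaves a by apply/count_memPn.
      move=> c x y; rewrite (IHb kb) bop.2.
      by rewrite (ev_out _ ka (c *: x + y) x) (ev_out _ ka y x).
    - have kb : k \notin bwterm_leaves b.
        by apply/count_memPn; move/eqP: e; rewrite add1n eqSS => /eqP.
      move=> c x y; rewrite (IHa ca) bop.1.
      by rewrite (ev_out _ kb (c *: x + y) x) (ev_out _ kb y x).
    - by case: e.
  elim: t => [i|a IHa b IHb|a IHa b IHb] /=.
  - by case: eqP => // _ _ c x y.
  - exact: lin2 (bwcirc_bil F) IHa IHb.
  - exact: lin2 (bwbul_bil F) IHa IHb.
move=> c x y; rewrite /fval scaler_sumr -big_split; apply: eq_big_seq => p hp.
rewrite ev_lin ?scalerDr ?scalerA 1?mulrC //.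
by rewrite (seq.permP (post_jordan_leaves hL hp)) count_uniq_mem ?iota_uniq // mem_iota hk.
Qed.

(** The generators of N have terms as arguments; multilinearity extends this to arbitrary arguments,
    one slot at a time. *)
Lemma ideal_fval L v : L \in post_jordan_formals -> N (fv v L).
Proof.
move=> hL.
have step k : (k <= 4)%N -> forall s, N (fv (fun i => if (i < k)%N then v i else bwt (s i)) L).
  elim: k => [_ s|k IH lt s]; first by apply: PJGen.
  have E : (fun i => if (i < k.+1)%N then v i else bwt (s i)) =
     (fun i => if i == k then v k else if (i < k)%N then v i else bwt (s i)).
    by apply: funext => i; rewrite ltnS leq_eqVlt; case: eqP => [->|_].
  rewrite E; move: (v k); apply: bwpoly_ind => [|t].
    have lin := fval_slot_linear (fun i => if (i < k)%N then v i else bwt (s i)) hL lt.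
    pose h := fun x : bwpoly F => fv (fun i => if i == k then x else if (i < k)%N then v i else bwt (s i)) L.
    have lh : linear h by [].
    split; first by change (N (h 0)); rewrite (linear_fun0 lh); exact: PJ0.
      move=> x y Nx Ny; change (N (h (x + y))); rewrite (linear_funD lh); exact: (PJD Nx Ny).
    move=> c x Nx; change (N (h (c *: x))); rewrite (linear_funZ lh); exact: (PJZ c Nx).
  have -> : (fun i => if i == k then bwt t else if (i < k)%N then v i else bwt (s i)) =
     (fun i => if (i < k)%N then v i else bwt (if i == k then t else s i)) :> (nat -> bwpoly F).
    by apply: funext => i; case: eqP => [->|_]; rewrite ?ltnn.
  exact: (IH (ltnW lt)).
have := step 4 isT (fun=> TVar 0).
by rewrite (fval_in (v' := v) hL) // => i ->.
Qed.

(* The pair (q, r) stands for q + R(r). *)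
Definition hatmul (x y : bwpoly F * bwpoly F) : bwpoly F * bwpoly F :=
  (bwcirc x.1 y.1 + bwbul x.1 y.2 + bwbul y.1 x.2,
   bwcirc x.2 y.2 + bwbul x.2 y.2 + bwbul y.2 x.2).

Definition hatideal (x : bwpoly F * bwpoly F) := N x.1 /\ N x.2.

Lemma fval_mul (v : nat -> bwpoly F) b L M :
  fv v (fmul (bwop b) L M) = bwmul (bwop b) (fv v L) (fv v M).
Proof.
rewrite /fval big_allpairs_dep /= (bilop_suml (bwmul_bil F (bwop b))); apply: eq_bigr => p _.
rewrite (bilop_sumr (bwmul_bil F (bwop b))); apply: eq_bigr => q _.
rewrite (bilopZl (bwmul_bil F (bwop b))) (bilopZr (bwmul_bil F (bwop b))) scalerA ZtoFM.
by case: b.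
Qed.

Definition hatval (v : nat -> bwpoly F) (x : formal * formal) := (fv v x.1, fv v x.2).

Lemma hatval_mul v x y : hatval v (fhat x y) = hatmul (hatval v x) (hatval v y).
Proof.
by rewrite /hatval /hatmul /fhat !fval_cat !addrA !(fval_mul v true) !(fval_mul v false).
Qed.

Lemma hatval_add v c x y : hatval v (fhat_add c x y) = hatval v x + ZtoF F c *: hatval v y.
Proof. by rewrite /hatval /fhat_add !fval_cat !fval_scale. Qed.

Lemma hatval_jordan v x y z t :
  hatval v (fhat_jordan x y z t) =
  jordan_expr hatmul (hatval v x) (hatval v y) (hatval v z) (hatval v t).
Proof.
rewrite /jordan_expr -!hatval_mul /fhat_jordan; do 5 rewrite hatval_add.
have -> : ZtoF F 1 = 1 by [].
have -> : ZtoF F (-1) = -1 by [].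
by rewrite !scale1r !scaleN1r.
Qed.

Lemma cert_ideal v rho C : N (fv v (cert_formal rho C)).
Proof.
rewrite /cert_formal fval_flatten big_map; apply: (subspace_sum ideal_subspace) => p _.
rewrite fval_scale; apply: (subspaceZ ideal_subspace).
set L := nth _ _ _.
have [hL|hL] : L \in post_jordan_formals \/ L = [::].
  rewrite /L; have [lt|ge] := ltnP p.1.2 (size post_jordan_formals).
    by left; apply: mem_nth.
  by right; apply: nth_default.
  have -> : fv v [seq (q.1, tsubst (fun i => TVar (rho (nth 0%N p.2 i))) q.2) | q <- L] =
     fv (fun i => v (rho (nth 0%N p.2 i))) L.
    rewrite /fval big_map; apply: eq_bigr => -[z q] _; cbn [fst snd]; congr (_ *: _).
    elim: q => [i|a IHa b IHb|a IHa b IHb]; cbn [tsubst bwterm_eval]; first exact: erefl.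
      by rewrite IHa IHb.
    by rewrite IHa IHb.
  exact: ideal_fval.
by rewrite hL /fval big_nil; exact: PJ0.
Qed.

(** All seven identities enter here: the components of the Jordan expression of four pairs are
    combinations of their instances. *)
Lemma hat_jordan : jordan_mod hatmul hatideal.
Proof.
have bC := bwcirc_bil F; have bB := bwbul_bil F; have cC := @bwcircC F.
have mC : commutative hatmul.
  have gen (A A' B C : bwpoly F) : A = A' -> A + B + C = A' + C + B by move=> ->; exact: addrAC.
  move=> x y; exact: (f_equal2 pair (gen _ _ _ _ (cC x.1 y.1)) (gen _ _ _ _ (cC x.2 y.2))).
have mL z : linear (hatmul^~ z).
  have lin (x1 x2 y1 y2 : bwpoly F) a z1 z2 :
      bwcirc (a *: x1 + y1) z1 + bwbul (a *: x1 + y1) z2 + bwbul z1 (a *: x2 + y2) =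
      a *: (bwcirc x1 z1 + bwbul x1 z2 + bwbul z1 x2) +
      (bwcirc y1 z1 + bwbul y1 z2 + bwbul z1 y2).
    have gen (A A' B B' C C' : bwpoly F) :
        (a *: A + A') + (a *: B + B') + (a *: C + C') = a *: (A + B + C) + (A' + B' + C').
      by rewrite !scalerDr (addrACA (a *: A)) (addrACA (a *: A + a *: B)).
    rewrite (bC.1 z1 a x1 y1) (bB.1 z2 a x1 y1) (bB.2 z1 a x2 y2); exact: gen.
  by move=> a x y; exact: (f_equal2 pair (lin _ _ _ _ _ _ _) (lin _ _ _ _ _ _ _)).
split.
- split; [exact: mL|].
  by move=> z a x y; rewrite (mC z) mL (mC x) (mC y).
- exact: mC.
- split; first by split; exact: PJ0.
    by move=> x y [x1 x2] [y1 y2]; split; apply: PJD.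
  by move=> c x [x1 x2]; split; apply: PJZ.
- move=> x y [x1 x2]; split; apply: PJD; try apply: PJD.
  + exact: PJCirc.
  + exact: PJBull.
  + exact: PJBulr.
  + exact: PJCirc.
  + exact: PJBull.
  + exact: PJBulr.
- move=> x y z t.
  (* The four first components, then the four second ones, as in the numbering of [fhat_var]. *)
  pose v i : bwpoly F := nth 0 [:: x.1; y.1; z.1; t.1; x.2; y.2; z.2; t.2] i.
  have hv (p : bwpoly F * bwpoly F) i : v i = p.1 -> v (4 + i)%N = p.2 -> hatval v (fhat_var i) = p.
    move=> e1 e2; rewrite /hatval /fhat_var /fval !big_seq1 /= e1 e2 !scale1r.
    by case: (p).
  rewrite -(hv x 0) // -(hv y 1) // -(hv z 2) // -(hv t 3) // -hatval_jordan.
  split; rewrite /hatval /=.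
  + have := vanishes_sound (@bwbul F) cC v jordan_hat_check1; rewrite fval_cat => /eqP.
    rewrite addr_eq0 => /eqP ->; apply: (subspaceN ideal_subspace); exact: cert_ideal.
  + have := vanishes_sound (@bwbul F) cC v jordan_hat_check2; rewrite fval_cat => /eqP.
    rewrite addr_eq0 => /eqP ->; apply: (subspaceN ideal_subspace); exact: cert_ideal.
Qed.

End PostJordanHat.

(** * The free Rota-Baxter algebra of weight one *)

Notation letter := (GenTree.tree nat).
Notation Leaf := (@GenTree.Leaf nat).
Notation Node := (@GenTree.Node nat).

Definition is_leaf (l : letter) : bool := if l is GenTree.Leaf _ then true else false.

Fixpoint ldeg (l : letter) : nat :=
  match l with GenTree.Leaf _ => 1 | GenTree.Node _ w => (sumn (map ldeg w)).+1 end.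
Definition wdeg (w : seq letter) : nat := sumn (map ldeg w).

Lemma wdeg_cat u v : wdeg (u ++ v) = (wdeg u + wdeg v)%N.
Proof. by rewrite /wdeg map_cat sumn_cat. Qed.

Lemma ldeg_gt0 l : (0 < ldeg l)%N. Proof. by case: l. Qed.

Lemma addr_rot (V : zmodType) (x y z t : V) : x - y + z + t = x + z + t - y.
Proof. by rewrite -!addrA; congr (_ + _); rewrite addrC -addrA. Qed.

Lemma subr_cancel2 (V : zmodType) (p q x y z t : V) : x + y = z + t ->
  (p + x + y) - (q + z + t) = p - q.
Proof. by move=> e; rewrite -(addrA p x y) -(addrA q z t) e opprD addrACA subrr addr0. Qed.

Lemma rb_expand (A : pzRingType) (ra ru a u m : A) :
  ra * ru * m + (a * ru + ra * u + a * u) * m = ra * (ru * m + u * m) + a * (ru * m + u * m).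
Proof. by rewrite !mulrDr !mulrDl !mulrA -!addrA; congr (_ + _); rewrite addrCA. Qed.

Lemma rb_expandN (A : pzRingType) (ra ru a u g n : A) :
  a * (ru * g - n) + ra * (u * g) + a * (u * g) = (a * ru + ra * u + a * u) * g - a * n.
Proof. rewrite mulrBr !mulrDl !mulrA; exact: addr_rot. Qed.

(** The map z -> R(z x_i). *)
HB.lock Definition nu (F : fieldType) (i : nat) : {fa F[letter]} -> {fa F[letter]} :=
  linext (fun w => mono [:: Node i w]).

(* The word [r] is read from its end: [Rrev (rev w)] is the operator R applied to the word w,
   and the letter [Node i w] stands for R(w x_i).  The last clause solves the weight one
   Rota-Baxter identity R(u) R(w x_i) = R(u R(w x_i)) + R(R(u) w x_i) + R(u w x_i)
   for its first term. *)
Fixpoint Rrev (F : fieldType) (r : seq letter) : {fa F[letter]} :=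
  match r with
  | [::] => - 1
  | GenTree.Leaf i :: u => mono [:: Node i (rev u)]
  | GenTree.Node i w :: u =>
      Rrev F u * mono [:: Node i w] - nu i (Rrev F u * mono w) - nu i (mono (rev u ++ w))
  end.

HB.lock Definition RB (F : fieldType) : {fa F[letter]} -> {fa F[letter]} :=
  linext (fun w => Rrev F (rev w)).
Arguments nu {F} i x.
Arguments RB {F} x.

Lemma eta_expand (A : pzRingType) (ru u g m x n n' : A) :
  (ru + u) * (g + m * x) - (n + ru * m * x) - (n' + u * m * x) = ru * g - n - n' + u * g.
Proof.
rewrite mulrDl !mulrDr !mulrA !opprD !addrA (ACl (1*5*7*3*(2*6)*(4*8))) /=.
by rewrite !subrr !addr0.
Qed.

Lemma eta_split (A : pzRingType) (p q x y : A) :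
  p * q - y * x = (p - y) * x + y * (q - x) + (p - y) * (q - x).
Proof.
by rewrite addrAC -mulrDr [x + _]addrC subrK mulrBl mulrBr addrA subrK.
Qed.

Lemma addr_cycle (V : zmodType) (x y z : V) : x + y + z = y + z + x.
Proof. by rewrite addrC addrA addrC addrA. Qed.

Section FreeRotaBaxter.
Variable F : fieldType.
Local Notation U := {fa F[letter]}.
Implicit Types (x y z a b : U) (u v w : seq letter).

Lemma lin_mull y : linear (fun x : U => x * y).
Proof. exact: famull_linear. Qed.
Lemma lin_mulr y : linear (fun x : U => y * x).
Proof. exact: famulr_linear. Qed.

Lemma lin_nu i : linear (nu i : U -> U). Proof. by rewrite nu.unlock; exact: linextP. Qed.
Lemma lin_RB : linear (RB : U -> U). Proof. by rewrite RB.unlock; exact: linextP. Qed.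
HB.instance Definition _ i := GRing.isLinear.Build F U U _ (nu i) (lin_nu i).
HB.instance Definition _ := GRing.isLinear.Build F U U _ RB lin_RB.

Lemma nuE i w : nu i (mono w) = mono [:: Node i w] :> U.
Proof. by rewrite nu.unlock; exact: linextU. Qed.

Lemma RB_mono w : RB (mono w) = Rrev F (rev w).
Proof. by rewrite RB.unlock; exact: linextU. Qed.

Lemma RBD x y : RB (x + y) = RB x + RB y. Proof. exact: linearD. Qed.
Lemma RBB x y : RB (x - y) = RB x - RB y. Proof. exact: linearB. Qed.
Lemma nuD i x y : nu i (x + y) = nu i x + nu i y. Proof. exact: linearD. Qed.

Lemma RB1 : RB 1 = - 1 :> U.
Proof. by rewrite [in LHS]fa1E RB_mono. Qed.

Lemma RBX x i : RB (x * mono [:: Leaf i]) = nu i x.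
Proof.
move: x; apply: malg_ind => [|u].
  exact: eq_subspace (lin_comp lin_RB (lin_mull _)) (lin_nu i).
by rewrite faUU nuE RB_mono rev_cat /= revK.
Qed.

Lemma RBN x i w : RB (x * mono [:: Node i w]) =
  RB x * mono [:: Node i w] - nu i (RB x * mono w) - nu i (x * mono w).
Proof.
move: x; apply: malg_ind => [|u].
  apply: eq_subspace; first exact: lin_comp lin_RB (lin_mull _).
  apply: lin_add; last exact: lin_opp (lin_comp (lin_nu i) (lin_mull _)).
  apply: lin_add; first exact: lin_comp (lin_mull _) lin_RB.
  exact: lin_opp (lin_comp (lin_nu i) (lin_comp (lin_mull _) lin_RB)).
by rewrite !faUU !RB_mono rev_cat /= revK.
Qed.

Lemma RB_nu a y i :
  RB a * nu i y = RB (a * nu i y) + nu i (RB a * y) + nu i (a * y).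
Proof.
move: y; apply: malg_ind => [|u]; last by rewrite nuE RBN addrAC subrK subrK.
apply: eq_subspace; first exact: lin_comp (lin_mulr _) (lin_nu i).
apply: lin_add; last exact: lin_comp (lin_nu i) (lin_mulr _).
apply: lin_add; last exact: lin_comp (lin_nu i) (lin_mulr _).
exact: lin_comp lin_RB (lin_comp (lin_mulr _) (lin_nu i)).
Qed.

(** Together with [RB_noleaf_supp] this makes -R a projection onto the subalgebra spanned by the
    words without any x_i. *)
Lemma RB_noleaf_word w : ~~ has is_leaf w -> RB (mono w) = - mono w :> U.
Proof.
elim/last_ind: w => [|w l IH]; first by move=> _; rewrite -fa1E RB1.
rewrite -cats1 has_cat negb_or => /andP [/IH {}IH]; case: l => [i|i v] //= _.
by rewrite -faUU RBN IH !mulNr linearN opprK addrK.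
Qed.

Definition noleaf w : Prop := ~~ has is_leaf w.

Lemma RB_supp w : suppin (fun v => noleaf v /\ wdeg v = wdeg w) (RB (mono w : U)).
Proof.
elim/last_ind: w => [|w l IH].
  rewrite -fa1E RB1; apply: (subspaceN (suppin_subspace _)).
  by rewrite fa1E; apply: suppinU.
have nu_supp i y n : suppin (fun v => wdeg v = n) y ->
    suppin (fun v => noleaf v /\ wdeg v = n.+1) (nu i y).
  move=> hy; rewrite nu.unlock; apply: (subspace_linext (suppin_subspace _)) => v /hy <-; apply: suppinU.
  by rewrite /wdeg /= addn0.
rewrite -cats1 -faUU; case: l => [i|i v].
  rewrite RBX nuE; apply: suppinU.
  by rewrite /noleaf wdeg_cat /wdeg /= addn0 addn1.
have eD u : wdeg (u ++ [:: Node i v]) = (wdeg u + wdeg v).+1.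
  by rewrite wdeg_cat /wdeg /= addn0 addnS.
rewrite RBN; apply: (subspaceB (suppin_subspace _)); first apply: (subspaceB (suppin_subspace _)).
- have h := suppinU (F := F) (P := fun u => u = [:: Node i v]) erefl.
  apply: suppinM IH h => u1 u2 [n1 e1] ->; split; first by rewrite /noleaf has_cat negb_or n1.
  by rewrite !eD e1.
- rewrite eD; apply: nu_supp.
  have h := suppinU (F := F) (P := fun u => u = v) erefl.
  by apply: suppinM IH h => u1 u2 [n1 e1] ->; rewrite wdeg_cat e1.
- by rewrite eD; apply: nu_supp; rewrite faUU; apply: suppinU; rewrite wdeg_cat.
Qed.

Lemma RB_noleaf_supp x : suppin noleaf (RB x).
Proof.
move: x; apply: malg_ind => [|w v /(RB_supp (w := w)) [] //].
exact: subspace_preim lin_RB (suppin_subspace _).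
Qed.

Lemma RB_noleaf x : suppin noleaf x -> RB x = - x.
Proof.
move=> hx; apply: (linext_ext (f1 := RB) (f2 := -%R)) => w /hx; exact: RB_noleaf_word.
Qed.

Lemma RBRB x : RB (RB x) = - RB x.
Proof. exact/RB_noleaf/RB_noleaf_supp. Qed.

Lemma lin_rhs a : linear (fun b => RB (a * RB b + RB a * b + a * b)).
Proof.
apply: lin_comp; first exact: lin_RB.
apply: lin_add; last exact: lin_mulr.
by apply: lin_add; [exact: lin_comp (lin_mulr _) lin_RB|exact: lin_mulr].
Qed.

(** Induction on the last letter of a word of [b]. If it is x_i, the claim is [RB_nu], that is, the
    recursion defining R; if it is R(v x_i), the same recursion moves it out of R and leaves a
    shorter word. *)
Theorem rota_baxter a b : RB a * RB b = RB (a * RB b + RB a * b + a * b).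
Proof.
move: b; apply: malg_ind => [|w].
  exact: eq_subspace (lin_comp (lin_mulr _) lin_RB) (lin_rhs a).
elim/last_ind: w => [|w l IH].
  rewrite -fa1E RB1 !mulrN !mulr1 addrAC addNr add0r; exact/esym/RBRB.
rewrite -cats1 -faUU; case: l => [i|i v].
  rewrite RBX RB_nu (mulrA (RB a)) (mulrA a (mono w)) RBD RBD.
  by congr (_ + _ + _); exact/esym/RBX.
set u := mono w in IH *; set g := mono [:: Node i v]; pose m : U := mono v.
pose y := RB u * m + u * m.
have Ru : RB (u * g) = RB u * g - nu i y by rewrite RBN /y nuD opprD addrA.
(* By the induction hypothesis R(a) R(u) = R(q). Both sides then reduce to R(q g) - R(a nu_i(y)),
   the remaining values of nu_i cancelling by [e2]. *)
set q := a * RB u + RB a * u + a * u in IH.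
have e1 : a * (RB u * g - nu i y) + RB a * (u * g) + a * (u * g) = q * g - a * nu i y. by exact: rb_expandN.
have e2 : RB q * m + q * m = RB a * y + a * y.
  by rewrite -IH /q /y; exact: rb_expand.
have e3 : RB q * g = RB (q * g) + nu i (RB q * m) + nu i (q * m).
  by rewrite RBN -/m addrAC subrK subrK.
rewrite Ru e1 RBB mulrBr (mulrA (RB a)) IH RB_nu e3; apply: subr_cancel2.
by rewrite -!nuD e2.
Qed.

Definition etal (l : letter) : U :=
  match l with
  | GenTree.Leaf i => 0
  | GenTree.Node i w => mono [:: Node i w] + mono (w ++ [:: Leaf i])
  end.
Definition eta_hom : U -> U := fahom etal.
HB.instance Definition _ := GRing.Linear.on eta_hom.

Lemma lin_eta : linear eta_hom. Proof. exact: lin_lin. Qed.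
Lemma etaB x y : eta_hom (x - y) = eta_hom x - eta_hom y. Proof. exact: linearB. Qed.
Lemma etaM x y : eta_hom (x * y) = eta_hom x * eta_hom y. Proof. exact: fahomM. Qed.

Lemma eta_nu i y : eta_hom (nu i y) = nu i y + y * mono [:: Leaf i].
Proof.
move: y; apply: malg_ind => [|u].
  exact: eq_subspace (lin_comp lin_eta (lin_nu i)) (lin_add (lin_nu i) (lin_mull _)).
by rewrite nuE /eta_hom fahom_letter faUU.
Qed.

(** [etal] prescribes the shift on the generators R(v x_i) alone; the recursion defining R carries
    it to R of any word that contains some x_i. *)
Lemma eta_RB w : has is_leaf w -> eta_hom (RB (mono w)) = RB (mono w) + mono w.
Proof.
elim/last_ind: w => [//|w l IH].
rewrite -cats1 has_cat -faUU; case: l => [i _|i v] /=; first by rewrite RBX nuE -nuE eta_nu.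
rewrite !orbF => /IH {}IH; set u : U := mono w in IH *.
rewrite RBN etaB etaB etaM IH !eta_nu /eta_hom fahom_letter.
set g := mono [:: Node i v]; set m := mono v.
rewrite /= -faUU -/m -/g; set x := mono _.
exact: eta_expand.
Qed.

Lemma wordM l u : mono (l :: u) = mono [:: l] * mono u :> U.
Proof. by rewrite faUU. Qed.

(** The map z -> eta(z) - z satisfies the Leibniz rule of weight one ([eta_split]) and R integrates
    it: this holds on generators, and the Rota-Baxter identity passes it on to products. *)
Lemma RB_etaB_word w : noleaf w -> w != [::] -> RB (eta_hom (mono w) - mono w) = mono w.
Proof.
elim: w => [//|l w IH]; rewrite /noleaf /= negb_or => /andP [ll nw] _.
have el : RB (eta_hom (mono [:: l]) - mono [:: l]) = mono [:: l].
  case: l ll => [//|i v] _; rewrite /eta_hom fahom_letter /= addrAC subrr add0r -faUU RBX.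
  exact: nuE.
case: (eqVneq w [::]) => [->|w0]; first exact: el.
have {}IH := IH nw w0; rewrite wordM etaM.
set x := mono w in IH *; set y := mono [:: l] in el *.
have -> : eta_hom y * eta_hom x - y * x =
  (eta_hom y - y) * RB (eta_hom x - x) + RB (eta_hom y - y) * (eta_hom x - x) + (eta_hom y - y) * (eta_hom x - x).
  by rewrite el IH; exact: eta_split.
by rewrite -rota_baxter el IH.
Qed.

(** Applying R to eta(z) - z recovers z up to its constant term. *)
Lemma eta_fixed_const z : suppin noleaf z -> eta_hom z = z -> suppin (fun w => w = [::]) z.
Proof.
pose cst : U -> U := linext (fun w => if w == [::] then mono w else 0).
have lin_cst : linear cst by exact: linextP.
move=> hz ez; have : RB (eta_hom z - z) = z - cst z.
  move: z hz {ez}; apply: suppin_ind.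
    apply: (eq_subspace (f := fun z => RB (eta_hom z - z)) (g := fun z => z - cst z)).
      apply: (lin_comp (f := RB) (g := fun z : U => eta_hom z - z)); first exact: lin_RB.
      apply: (lin_add (f := eta_hom) (g := fun z : U => - z)); first exact: lin_eta.
      exact: (lin_opp (@lin_id F U)).
    exact: (lin_add (@lin_id F U) (lin_opp lin_cst)).
  move=> w nw; rewrite /cst linextU; case: eqVneq nw => [->|w0] nw.
    by rewrite -fa1E /eta_hom fahom1 !subrr linear0.
  by rewrite subr0 RB_etaB_word.
rewrite ez subrr linear0 => /esym/eqP; rewrite subr_eq0 => /eqP ->.
apply: (subspace_linext (suppin_subspace _)) => w _; case: eqP => [->|_].
  exact: suppinU.
exact: (subspace0 (suppin_subspace _)).
Qed.

Definition rb_prec (x y : U) : U := x * RB y.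
Definition rb_succ (x y : U) : U := RB x * y.
Definition rb_curly (x y : U) : U := x * y.

Lemma rb_prec_bilinear : bilinear_for *:%R *:%R rb_prec.
Proof. by split=> z; [exact: lin_mull|exact: (lin_comp (lin_mulr _) lin_RB)]. Qed.
Lemma rb_succ_bilinear : bilinear_for *:%R *:%R rb_succ.
Proof. by split=> z; [exact: (lin_comp (lin_mull _) lin_RB)|exact: lin_mulr]. Qed.
Lemma rb_curly_bilinear : bilinear_for *:%R *:%R rb_curly.
Proof. by split=> z; [exact: lin_mull|exact: lin_mulr]. Qed.

HB.instance Definition _ := bilinear_isBilinear.Build F U U U *:%R *:%R rb_prec rb_prec_bilinear.
HB.instance Definition _ := bilinear_isBilinear.Build F U U U *:%R *:%R rb_succ rb_succ_bilinear.
HB.instance Definition _ := bilinear_isBilinear.Build F U U U *:%R *:%R rb_curly rb_curly_bilinear.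

Lemma rb_prec_prec (a b c : U) : rb_prec (rb_prec a b) c =
  rb_prec a (rb_prec b c) + rb_prec a (rb_curly b c) + rb_prec a (rb_succ b c).
Proof.
rewrite /rb_prec /rb_curly /rb_succ -mulrA rota_baxter !RBD !mulrDr.
exact: addrAC.
Qed.

Lemma rb_succ_succ (a b c : U) : rb_succ a (rb_succ b c) =
  rb_succ (rb_succ a b) c + rb_succ (rb_curly a b) c + rb_succ (rb_prec a b) c.
Proof.
rewrite /rb_prec /rb_curly /rb_succ mulrA rota_baxter !RBD !mulrDl.
exact: addr_cycle.
Qed.

Definition rb_tridendriform : tridendriform F := @Tridendriform F U rb_prec rb_curly rb_succ
  (fun a b c => esym (mulrA a b c)) rb_prec_prec rb_succ_succ
  (fun a b c => esym (mulrA (RB a) b (RB c))) (fun a b c => esym (mulrA (RB a) b c))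
  (fun a b c => esym (mulrA a b (RB c))) (fun a b c => esym (mulrA a (RB b) c)).

Definition rbcirc (x y : U) : U := x * y + y * x.
Definition rbbul (x y : U) : U := x * RB y + RB y * x.

Definition ev (t : bwterm) : U := bwterm_eval rbcirc rbbul (fun i => mono [:: Leaf i]) t.

Lemma ev_identity n (f : bwpoly F) : tridendriform_identity n f ->
  bweval rbcirc rbbul (fun i => mono [:: Leaf i]) f = 0.
Proof. by case=> _ /(_ rb_tridendriform (fun i => mono [:: Leaf i])). Qed.

End FreeRotaBaxter.

(** * Free generators of the Rota-Baxter algebra *)

Section Greedy.
Variables (F : fieldType) (I : choiceType) (V : lmodType F) (e : I -> V).
Variables (C : eqType) (cls : I -> C) (proj : C -> V -> V) (lt : rel I).
Hypothesis lin_proj : forall c, linear (proj c).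
Hypothesis projE : forall c i, proj c (e i) = if cls i == c then e i else 0.
Hypothesis lt_wf : well_founded lt.
Hypothesis lt_trans : transitive lt.
Hypothesis lt_total : forall i j, i != j -> lt i j || lt j i.

Definition greedy (i : I) : Prop :=
  ~ exists2 g, suppin (fun j => lt j i /\ cls j = cls i) g & linext e g = e i.

Lemma greedy_span i : exists2 g,
  suppin (fun j => [/\ greedy j, (j == i) || lt j i & cls j = cls i]) g & linext e g = e i.
Proof.
elim: (lt_wf i) => {}i _ IH; have [[g hg eg]|ni] := EM (exists2 g,
    suppin (fun j => lt j i /\ cls j = cls i) g & linext e g = e i); last first.
  exists (mono i); last exact: linextU.
  by apply: suppinU; rewrite eqxx.
rewrite -eg; apply: (subspace_linext (subspace_image _ (linextP e))) => j /hg [ji cji].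
have [h hh eh] := IH j ji; exists h => //; apply: suppinW hh => k [ok kj ckj].
split=> //; last by rewrite ckj.
by case/orP: kj => [/eqP->|kj]; rewrite ?ji ?(lt_trans kj ji) orbT.
Qed.

Lemma seq_lt_max (s : seq I) : s != [::] -> exists2 i, i \in s & {in s, forall j, (j == i) || lt j i}.
Proof.
elim: s => [//|x s IH] _; case: (eqVneq s [::]) => [->|/IH [i si hi]].
  by exists x; rewrite ?mem_head // => j; rewrite inE => ->.
have [xi|/negP nxi] := boolP ((x == i) || lt x i).
  by exists i => [|j]; rewrite inE ?si ?orbT // => /orP[/eqP->|/hi].
exists x; first exact: mem_head.
have ix : lt i x.
  move/negP: nxi; rewrite negb_or => /andP [nxi /negPf nlt].
  by have := lt_total nxi; rewrite nlt.
by move=> j; rewrite inE => /orP[->//|/hi /orP[/eqP->|ji]]; rewrite ?ix ?(lt_trans ji ix) orbT.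
Qed.

(** In a vanishing combination, consider the class of the largest index of the support. The part in
    this class vanishes by itself, and it would express that largest vector through smaller ones of
    its class. *)
Lemma greedy_free g : suppin greedy g -> linext e g = 0 -> g = 0.
Proof.
move=> hg eg; apply: contrapT => g0.
have /seq_lt_max [i ig hi] : enum_fset (msupp g) != [::].
  apply/eqP => s0; apply: g0; apply/malgP => k; rewrite mcoeff0; apply: mcoeff_outdom.
  by rewrite /in_mem /= /pred_of_finset s0.
pose p j := (cls j == cls i) && (j != i).
have gi0 : g@_i != 0 by rewrite mcoeff_neq0.
case: (hg i ig); exists (- (g@_i)^-1 *: part p g).
  apply: (subspaceZ (suppin_subspace _)) => j jp.
  have /andP [/eqP cj nj] := suppin_part jp; split=> //.
  have /hi : j \in msupp g by apply: (suppin_partW (p := p) (S := fun j => j \in msupp g)) jp.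
  by rewrite (negPf nj).
have E : proj (cls i) (linext e g) = linext e (part (fun j => cls j == cls i) g).
  move: (cls i) => c {hi ig gi0 p eg}; move: g {hg g0}; apply: malg_ind => [|j].
    apply: eq_subspace; first exact: lin_comp (lin_proj c) (linextP _).
    exact: lin_comp (linextP _) (lin_part _).
  by rewrite part_mono linextU projE; case: ifP => _; rewrite ?linextU ?linear0.
have {E} : linext e (part (fun j => cls j == cls i) g) = 0.
  by rewrite -E eg (linear_fun0 (lin_proj _)).
have -> : part (fun j => cls j == cls i) g = g@_i *: mono i + part p g.
  apply/malgP => k; rewrite mcoeffD mcoeffZ !mcoeff_part mcoeff_mono /p.
  by case: (eqVneq k i) => [->|]; rewrite ?eqxx ?mulr1 ?mulr0 ?addr0 ?add0r ?andbT ?andbF // => ?; rewrite eq_sym.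
rewrite linearD linearZ /= linextU => /eqP; rewrite addrC addr_eq0 => /eqP eP.
by rewrite linearZ /= eP scaleNr scalerN opprK scalerA mulVf // scale1r.
Qed.

End Greedy.

Definition pickle_lt (T : countType) (x y : T) : bool := (choice.pickle x < choice.pickle y)%N.

Lemma rank_wf (T : Type) (f : T -> nat) : well_founded (fun x y => f x < f y)%N.
Proof.
move=> x; have [n] := ubnP (f x).
elim: n x => [x|n IH x xn]; first by rewrite ltn0.
by constructor=> y yx; apply: IH; exact: leq_trans yx xn.
Qed.

Lemma pickle_lt_wf (T : countType) : well_founded (@pickle_lt T).
Proof. exact: (rank_wf (fun x : T => choice.pickle x)). Qed.

Lemma pickle_lt_trans (T : countType) : transitive (@pickle_lt T).
Proof. by move=> y x z; exact: ltn_trans. Qed.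

Lemma pickle_lt_irr (T : countType) (x : T) : pickle_lt x x = false.
Proof. exact: ltnn. Qed.

Lemma pickle_lt_total (T : countType) (x y : T) : x != y -> pickle_lt x y || pickle_lt y x.
Proof.
move=> ne; rewrite -neq_ltn; apply: contra_neq ne; exact: (pcan_inj choice.pickleK).
Qed.

Section Letters.
Variable F : fieldType.
Local Notation U := {fa F[letter]}.
Local Notation Y := (bwterm + letter)%type.
Implicit Types (x : U) (u w : seq letter) (v : seq Y).

Definition tdeg (t : bwterm) := size (bwterm_leaves t).

Lemma tdeg_gt0 t : (0 < tdeg t)%N.
Proof. by rewrite /tdeg; elim: t => //= t IH s _; rewrite size_cat addn_gt0 IH. Qed.

Lemma RB_suppin x n : suppin (fun w => wdeg w = n) x ->
  suppin (fun w => noleaf w /\ wdeg w = n) (RB x).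
Proof.
move: x; apply: suppin_ind => [|w <-]; last exact: RB_supp.
exact: subspace_preim (@lin_RB F) (suppin_subspace _).
Qed.

Lemma ev_supp t : suppin (fun w => has is_leaf w /\ wdeg w = tdeg t) (ev F t).
Proof.
have sS := @suppin_subspace F _ (fun w => has is_leaf w /\ wdeg w = tdeg t).
elim: t sS => [i|a IHa b IHb|a IHa b IHb] sS.
- exact: suppinU.
- apply: (subspaceD sS); [move: IHa IHb => /(_ (suppin_subspace _)) ha /(_ (suppin_subspace _)) hb
   |move: IHb IHa => /(_ (suppin_subspace _)) ha /(_ (suppin_subspace _)) hb];
  apply: suppinM ha hb => u w [lu du] [lw dw]; rewrite has_cat lu wdeg_cat du dw /tdeg /= size_cat //.
  by rewrite addnC.
have hb : suppin (fun w => noleaf w /\ wdeg w = tdeg b) (RB (ev F b)).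
  by apply: RB_suppin; apply: suppinW (IHb (suppin_subspace _)) => w [].
have {IHb}ha := IHa (suppin_subspace _).
apply: (subspaceD sS); [apply: suppinM ha hb|apply: suppinM hb ha] => u w.
  by move=> [lu du] [nw dw]; rewrite has_cat lu wdeg_cat du dw /tdeg /= size_cat.
by move=> [nw dw] [lu du]; rewrite has_cat lu orbT wdeg_cat du dw /tdeg /= size_cat addnC.
Qed.

Lemma RBev_supp t : suppin (fun w => noleaf w /\ wdeg w = tdeg t) (RB (ev F t)).
Proof. by apply: RB_suppin; apply: suppinW (@ev_supp t) => w []. Qed.

(* The letter [inl t] stands for R(t) and [inr l] for the letter l itself; the invariant below
   splits letters into classes so that only homogeneous dependencies need to be considered. *)
Definition lcls (l : letter) : nat + nat :=
  if l is GenTree.Leaf i then inl i else inr (ldeg l).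
Definition ycls (y : Y) : nat + nat :=
  match y with inl t => inr (tdeg t) | inr l => lcls l end.

Definition betal (y : Y) : U :=
  match y with inl t => RB (ev F t) | inr l => mono [:: l] end.
Definition beta : {fa F[Y]} -> U := fahom betal.
Definition leadl (y : Y) : U := part (fun w => size w == 1%N) (betal y).

Definition wcls (c : nat + nat) : pred (seq letter) :=
  fun w => if w is [:: l] then lcls l == c else false.

Lemma leadl_supp y : suppin (wcls (ycls y)) (leadl y).
Proof.
move=> w wy; have /eqP s1 := suppin_part wy.
case: y wy => [t|l] wy; last first.
  move: wy; rewrite /leadl part_mono /= => /(suppinU (P := fun w => w = [:: l]) erefl) ->.
  exact: eqxx.
have [] := suppin_partW (@RBev_supp t) wy.
case: w s1 {wy} => [//|l [|//]] _; rewrite /noleaf /wdeg /= orbF addn0.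
by case: l => // i w _ <-; exact: eqxx.
Qed.

Lemma wcls_leadl c y : part (wcls c) (leadl y) = if ycls y == c then leadl y else 0.
Proof.
case: eqP => [<-|ne]; first exact/part_id/leadl_supp.
apply: part_0; apply: suppinW (@leadl_supp y) => -[|l [|//]] //= /eqP e.
by rewrite e; apply/eqP.
Qed.

(** The letters G precede the letters of U, so that a redundant G_t is expressed through letters G
    alone; [repR_step] relies on this. *)
Definition ylt (y z : Y) : bool :=
  match y, z with
  | inl s, inl t => pickle_lt s t
  | inl _, inr _ => true
  | inr _, inl _ => false
  | inr k, inr l => pickle_lt k l
  end.

Lemma ylt_wf : well_founded ylt.
Proof.
have hG (t : bwterm) : Acc ylt (inl t : Y).
  elim: (pickle_lt_wf t) => {}t _ IH; constructor=> -[s|//]; exact: IH.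
have hC (l : letter) : Acc ylt (inr l : Y).
  elim: (pickle_lt_wf l) => {}l _ IH; constructor=> -[s _|s]; [exact: hG|exact: IH].
by case.
Qed.

Lemma ylt_trans : transitive ylt.
Proof. by move=> [y|y] [x|x] [z|z] //=; exact: pickle_lt_trans. Qed.

Lemma ylt_total y z : y != z -> ylt y z || ylt z y.
Proof. by case: y z => [y|y] [z|z] //= ne; apply: pickle_lt_total; apply: contra_neq ne => ->. Qed.

Definition yok : Y -> Prop := greedy leadl ycls ylt.

Lemma yok_span y : exists2 g,
  suppin (fun z => [/\ yok z, (z == y) || ylt z y & ycls z = ycls y]) g & linext leadl g = leadl y.
Proof. exact: greedy_span ylt_wf ylt_trans y. Qed.

Lemma yok_free g : suppin yok g -> linext leadl g = 0 -> g = 0.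
Proof.
exact: (greedy_free (fun c => lin_part (wcls c)) wcls_leadl ylt_trans ylt_total).
Qed.

(** The letter x_i is alone in its class and its linear part is nonzero. *)
Lemma yok_leaf i : yok (inr (Leaf i)).
Proof.
case=> g hg; have -> : g = 0.
  apply/malgP => y; rewrite mcoeff0; apply: (mcoeff_suppin hg) => -[].
  by case: y => [t|[j|j w]] //= lt [ji]; move: lt; rewrite ji pickle_lt_irr.
rewrite linear0 /leadl part_mono /= => /malgP /(_ [:: Leaf i]).
by rewrite mcoeff0 mcoeff_mono eqxx => /esym/eqP; rewrite oner_eq0.
Qed.

End Letters.

Lemma mul_sub_split (A : pzRingType) (a b p q : A) : a * p - b * q = (a - b) * p + b * (p - q).
Proof. by rewrite mulrBl mulrBr addrA subrK. Qed.

Section GradedHom.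
Variables (F : fieldType) (K L : choiceType) (h : K -> {fa F[L]}).
Variables (R1 : K -> seq L -> Prop) (R : seq K -> seq L -> Prop).
Hypothesis R_nil : R [::] [::].
Hypothesis R_cons : forall k v u w, R1 k u -> R v w -> R (k :: v) (u ++ w).

Lemma suppin_fahom_word v : {in v, forall k, suppin (R1 k) (h k)} -> suppin (R v) (fahom h (mono v)).
Proof.
elim: v => [|k v IH] H; first by rewrite fahomU big_nil fa1E; exact: suppinU.
rewrite fahom_cons; apply: suppinM (H k (mem_head _ _)) (IH _) => [u w|j jv].
  exact: R_cons.
by apply: H; rewrite inE jv orbT.
Qed.

End GradedHom.

Section LowestSize.
Variables (F : fieldType) (K : choiceType).

Definition size_part l : {fa F[K]} -> {fa F[K]} := part (fun v => size v == l).

Lemma lin_size_part l : linear (size_part l). Proof. exact: lin_part. Qed.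

Lemma size_part_mono l (v : seq K) : size_part l (mono v) = if size v == l then mono v else 0.
Proof. exact: part_mono. Qed.

Lemma size_partM m n (x y : {fa F[K]}) :
  suppin (fun v => m <= size v)%N x -> suppin (fun v => n <= size v)%N y ->
  size_part (m + n) (x * y) = size_part m x * size_part n y.
Proof.
move=> hx hy; move: x hx; apply: suppin_ind => [|u mu].
  apply: (eq_subspace (f := fun x => size_part _ (x * y)) (g := fun x => size_part m x * _)).
    exact: (lin_comp (lin_part _) (famull_linear _)).
  exact: (lin_comp (famull_linear _) (lin_part _)).
move: y hy; apply: suppin_ind => [|v nv].
  apply: (eq_subspace (f := fun y => size_part _ (_ * y)) (g := fun y => _ * size_part n y)).
    exact: (lin_comp (lin_part _) (famulr_linear _)).
  exact: (lin_comp (famulr_linear _) (lin_part _)).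
rewrite faUU !size_part_mono size_cat.
have [su|su] := eqVneq (size u) m.
  by rewrite su eqn_add2l; case: ifP => _; rewrite ?faUU // mulr0.
rewrite gtn_eqF ?mul0r // -addSn leq_add // ltn_neqAle eq_sym su; exact: mu.
Qed.

End LowestSize.

(** When no letter is sent to an element with a constant term, the lowest terms of an image come
    from the lowest terms of the argument and the linear parts of the letters. *)
Lemma size_part_fahom (F : fieldType) (K L : choiceType) (h : K -> {fa F[L]}) l (x : {fa F[K]}) :
  (forall k, suppin (fun w => 0 < size w)%N (h k)) -> suppin (fun v => l <= size v)%N x ->
  size_part l (fahom h x) = fahom (fun k => size_part 1 (h k)) (size_part l x).
Proof.
move=> h0.
have hs v : suppin (fun w => size v <= size w)%N (fahom h (mono v)).
  apply: (suppin_fahom_word (R1 := fun _ w => (0 < size w)%N)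
    (R := fun v w => (size v <= size w)%N)) => // k u w w' w0 uw.
  by rewrite size_cat /= -add1n leq_add.
move: x; apply: suppin_ind => [|v lv].
  apply: (eq_subspace (f := fun x => size_part l (fahom h x)) (g := fun x => fahom _ (size_part l x))).
    exact: (lin_comp (lin_part _) (lin_fahom _)).
  exact: (lin_comp (lin_fahom _) (lin_part _)).
rewrite size_part_mono; have [sv|sv] := eqVneq (size v) l; last first.
  rewrite fahom0; apply: part_0; apply: suppinW (hs v) => w vw.
  by rewrite gtn_eqF // (leq_trans _ vw) // ltn_neqAle eq_sym sv.
rewrite -sv {l lv sv}; elim: v => [|k v IH].
  by rewrite !fahomU !big_nil fa1E size_part_mono.
rewrite !fahom_cons -IH; exact: (size_partM (m := 1) (h0 k) (@hs v)).
Qed.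

Section BetaInverse.
Variable F : fieldType.
Local Notation U := {fa F[letter]}.
Local Notation Y := (bwterm + letter)%type.
Local Notation FY := {fa F[Y]}.
Implicit Types (x : U) (u w : seq letter) (v : seq Y).

Definition wleaf (w : seq letter) : nat := sumn [seq nat_of_bool (is_leaf l) | l <- w].
Definition ydeg (y : Y) : nat := match y with inl t => tdeg t | inr l => ldeg l end.
Definition yleaf (y : Y) : nat := match y with inl _ => 0 | inr l => is_leaf l end.
Definition vdeg v := sumn (map ydeg v).
Definition vleaf v := sumn (map yleaf v).
Definition okword v : Prop := forall y, y \in v -> yok F y.

Lemma wleaf_cat u w : wleaf (u ++ w) = (wleaf u + wleaf w)%N.
Proof. by rewrite /wleaf map_cat sumn_cat. Qed.
Lemma vdeg_cat (u v : seq Y) : vdeg (u ++ v) = (vdeg u + vdeg v)%N.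
Proof. by rewrite /vdeg map_cat sumn_cat. Qed.
Lemma vleaf_cat (u v : seq Y) : vleaf (u ++ v) = (vleaf u + vleaf v)%N.
Proof. by rewrite /vleaf map_cat sumn_cat. Qed.

Lemma wleaf0 w : noleaf w <-> wleaf w = 0%N.
Proof.
by rewrite /noleaf /wleaf; elim: w => //= l w IH; case: (is_leaf l); first by split.
Qed.

Lemma ycls_lcls y l : ycls y = lcls l -> ydeg y = ldeg l /\ yleaf y = is_leaf l.
Proof. by case: y l => [t|[i|i w]] [j|j u] //= [->]. Qed.

Definition graded (r : nat -> nat -> bool) v w :=
  [/\ wdeg w = vdeg v, wleaf w = vleaf v & r (size v) (size w)].

Lemma betal_supp y : suppin (fun w => [/\ wdeg w = ydeg y, wleaf w = yleaf y & (0 < size w)%N])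
  (betal F y).
Proof.
case: y => [t|l]; last first.
  by apply: suppinU; rewrite /wdeg /wleaf /= !addn0.
apply: suppinW (@RBev_supp F t) => w [/wleaf0 nw dw]; split=> //.
by case: w dw {nw} => //= d0; have := tdeg_gt0 t; rewrite -d0.
Qed.

Lemma graded_cons (r r1 r2 : nat -> nat -> bool) (y : Y) v u w :
  (forall a b c d, r1 a b -> r2 c d -> r (a + c)%N (b + d)%N) ->
  graded r1 [:: y] u -> graded r2 v w -> graded r (y :: v) (u ++ w).
Proof.
move=> h [d1 l1 s1] [d2 l2 s2]; split; rewrite ?wdeg_cat ?wleaf_cat ?d1 ?d2 ?l1 ?l2 ?size_cat.
- by rewrite -vdeg_cat.
- by rewrite -vleaf_cat.
exact: (h _ _ _ _ s1 s2).
Qed.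

Lemma betal_graded y : suppin (graded leq [:: y]) (betal F y).
Proof.
by apply: suppinW (@betal_supp y) => w [dw lw sw]; split; rewrite // /vdeg /vleaf /= addn0.
Qed.

Lemma leadl_graded y : suppin (graded eq_op [:: y]) (leadl F y).
Proof.
move=> w wy; have [dw lw _] := suppin_partW (@betal_supp y) wy.
have /eqP sw := suppin_part wy.
by split; rewrite ?dw ?lw ?sw // /vdeg /vleaf /= addn0.
Qed.

Lemma beta_lead_letter y : suppin (graded ltn [:: y]) (betal F y - leadl F y).
Proof.
rewrite {1}(part_split (fun w => size w == 1%N) (betal F y)) addrAC subrr add0r.
move=> w wy; have [dw lw sw] := suppin_partW (@betal_supp y) wy.
have /= nw := suppin_part wy; split; rewrite ?dw ?lw //; try by rewrite /vdeg /vleaf /= addn0.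
by change (1 < size w)%N; rewrite ltn_neqAle eq_sym nw.
Qed.

Lemma beta_graded v : suppin (graded leq v) (beta (mono v : FY)).
Proof.
apply: (suppin_fahom_word (R1 := fun y => graded leq [:: y])) => [||y _]; first by [].
  by move=> y u w w'; apply: (graded_cons (r1 := leq) (r2 := leq)) => a b c d; exact: leq_add.
exact: betal_graded.
Qed.

(** Values and linear parts are exchanged letter by letter; each difference is homogeneous and
    consists of longer words. *)
Lemma beta_lead v : suppin (graded ltn v) (beta (mono v : FY) - fahom (leadl F) (mono v)).
Proof.
have sS v' := @suppin_subspace F _ (graded ltn v').
elim: v => [|y v IH]; first by rewrite /beta !fahomU !big_nil subrr; exact: (subspace0 (sS _)).
rewrite /beta !fahom_cons -/beta.
set a := betal F y; set b := leadl F y; set p := fahom _ _; set q := fahom _ _.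
have -> : a * p - b * q = (a - b) * p + b * (p - q) by exact: mul_sub_split.
apply: (subspaceD (sS _)).
  apply: suppinM (@beta_lead_letter y) (@beta_graded v) => u w; apply: (graded_cons (r1 := ltn) (r2 := leq)) => m n c d.
  by move=> mn cd; rewrite /= -addSn; exact: leq_add.
apply: suppinM (@leadl_graded y) IH => u w; apply: (graded_cons (r1 := eq_op) (r2 := ltn)) => m n c d /eqP-> cd.
by rewrite /= ltn_add2l.
Qed.

(** The linear parts of the chosen letters form a basis of the span of the letters of U; [lam] is
    the inverse change of basis, within each class. *)
Definition lead_inverse (lam : letter -> FY) : Prop :=
  [/\ forall l, suppin (fun v => exists2 y, v = [:: y] & yok F y /\ ycls y = lcls l) (lam l),
      forall l, fahom (leadl F) (lam l) = mono [:: l]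
    & forall y, yok F y -> fahom lam (leadl F y) = mono [:: y]].

Lemma lead_inverse_exists : exists lam, lead_inverse lam.
Proof.
have /choice [g hg] (l : letter) : exists g,
    suppin (fun z => [/\ yok F z, (z == inr l) || ylt z (inr l) & ycls z = lcls l]) g /\
    linext (leadl F) g = leadl F (inr l).
  by have [g h e] := yok_span F (inr l); exists g.
pose lett : {malg F[Y]} -> FY := linext (fun y => mono [:: y]).
have leadE l : leadl F (inr l) = mono [:: l] by rewrite /leadl part_mono.
have lettE d : fahom (leadl F) (lett d) = linext (leadl F) d.
  by rewrite /lett linext_comp; apply: eq_linext => y /=; exact: fahom_letter.
pose lam l := lett (g l).
have lamok l : suppin (yok F) (g l).
  by have [h _] := hg l; apply: suppinW h => y [].
have Elam l : fahom (leadl F) (lam l) = mono [:: l].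
  by rewrite lettE; have [_ ->] := hg l; exact: leadE.
exists lam; split=> [l||y yk]; [|exact: Elam|].
  apply: (subspace_linext (suppin_subspace _)) => y.
  by have [h _] := hg l => /h [ok _ cy]; apply: suppinU; exists y.
have EL x : fahom (leadl F) (fahom lam x) = x.
  by rewrite fahom_comp (eq_fahom _ Elam); exact: fahom_id.
have sQ : subspace (fun x : FY => exists2 d, suppin (yok F) d & lett d = x).
  exact: subspace_image (linextP _).
(* The error of [lam] at a chosen letter [y] is a combination [d] of chosen letters whose linear
   parts cancel, hence zero by freeness. *)
have [d dok dE] : exists2 d, suppin (yok F) d & lett d = fahom lam (leadl F y) - mono [:: y].
  apply: (subspaceB sQ); last by exists (mono y); [exact: suppinU|exact: linextU].
  apply: (subspace_linext sQ) => w /leadl_supp.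
  case: w => [|l [|//]] // _; exists (g l); first exact: lamok.
  by rewrite /wordprod big_seq1.
have d0 : d = 0.
  apply: (yok_free dok); rewrite -lettE dE fahomB EL fahom_letter; exact: subrr.
apply/eqP; rewrite -subr_eq0 -dE d0; apply/eqP; exact: linear0.
Qed.

Lemma fahom_leadK lam x : lead_inverse lam -> fahom (leadl F) (fahom lam x) = x.
Proof.
by move=> [_ Elam _]; rewrite fahom_comp (eq_fahom _ Elam); exact: fahom_id.
Qed.

Lemma fahom_lamK lam (z : FY) : lead_inverse lam -> suppin okword z -> fahom lam (fahom (leadl F) z) = z.
Proof.
move=> [_ _ Lk] zk; rewrite fahom_comp -[RHS]fahom_id.
by apply: (eq_fahom_in (P := yok F)) zk.
Qed.

Lemma lin_beta : linear (@beta F). Proof. exact: (lin_lin (fahom _)). Qed.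
HB.instance Definition _ := GRing.Linear.on (@beta F).

Lemma size_part_beta l (z : FY) : suppin (fun v => l <= size v)%N z ->
  size_part l (beta z) = fahom (leadl F) (size_part l z).
Proof. by apply: size_part_fahom => y; apply: suppinW (@betal_supp y) => w []. Qed.

(** The part of lowest size of an element of the kernel is killed by the substitution of linear
    parts, which [lam] inverts on chosen letters; so there is no lowest size. *)
Lemma beta_inj (z : FY) : suppin okword z -> beta z = 0 -> z = 0.
Proof.
move=> zk bz; have [lam hlam] := lead_inverse_exists.
have h l : suppin (fun v => l <= size v)%N z.
  elim: l => [|l IH]; first exact: suppinT.
  have pz : size_part l z = 0.
    have <- : fahom lam (fahom (leadl F) (size_part l z)) = size_part l z.
      exact: fahom_lamK hlam (suppin_partW zk).
    rewrite -size_part_beta // bz.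
    rewrite (linear_fun0 (@lin_size_part _ _ l)).
    exact: fahom0.
  move=> v vz; rewrite ltn_neqAle IH // andbT; apply/eqP => lv.
  have := mcoeff_part (fun v => size v == l) z v.
  by rewrite [part _ z]pz mcoeff0 -lv eqxx => /esym/eqP; apply/negP; rewrite mcoeff_neq0.
apply/malgP => v; rewrite mcoeff0; apply: (mcoeff_suppin (h (size v).+1)).
by rewrite ltnn.
Qed.

Lemma size_leq_wdeg w : (size w <= wdeg w)%N.
Proof.
elim: w => // l w IH; rewrite /wdeg /=; have := ldeg_gt0 l.
move: IH; rewrite /wdeg => IH l0; exact: (leq_add l0 IH).
Qed.

Definition okgraded d n (l : nat) v := [/\ okword v, vdeg v = d, vleaf v = n & l <= size v]%N.

(** Lifting [w] through [lam] leaves an error of the same degree in longer words. Size is bounded by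
    degree, so the induction is on their difference. *)
Lemma beta_sur_word w : exists2 z : FY,
  suppin (okgraded (wdeg w) (wleaf w) (size w)) z & beta z = mono w.
Proof.
have [lam hlam] := lead_inverse_exists.
have [k] := ubnP (wdeg w - size w)%N; elim: k w => // k IH w wk.
pose z := fahom lam (mono w).
have zs : suppin (fun v => [/\ okword v, vdeg v = wdeg w, vleaf v = wleaf w & size v = size w]) z.
  apply: (suppin_fahom_word (R1 := fun l v => exists2 y, v = [:: y] & yok F y /\ ycls y = lcls l)
    (R := fun w v => [/\ okword v, vdeg v = wdeg w, vleaf v = wleaf w & size v = size w])).
  - by split.
  - move=> l u _ v [y -> [yk /ycls_lcls [dy ly]]] [vk dv lv sv].
    split; rewrite ?vdeg_cat ?vleaf_cat ?dv ?lv //= ?sv //.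
    + by move=> y'; rewrite inE => /orP[/eqP->|/vk].
    + by rewrite /vdeg /wdeg /= addn0 dy.
    + by rewrite /vleaf /wleaf /= addn0 ly.
  - by move=> l _; have [H _ _] := hlam; exact: H.
pose S := okgraded (wdeg w) (wleaf w) (size w).
have sS : subspace (fun x => exists2 z : FY, suppin S z & beta z = x).
  exact: subspace_image lin_beta.
have Ez : fahom (leadl F) z = mono w by exact: fahom_leadK.
rewrite -[mono w](subKr (beta z)); apply: (subspaceB sS).
  by exists z => //; apply: suppinW zs => v [vk dv lv sv]; split=> //; rewrite sv.
have hi : suppin (fun w' => [/\ wdeg w' = wdeg w, wleaf w' = wleaf w & size w < size w']%N)
    (beta z - mono w).
  rewrite -Ez; move: z zs {Ez}; apply: suppin_ind => [|v [vk dv lv sv]].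
    apply: (subspace_preim (f := fun z => beta z - fahom (leadl F) z)) (suppin_subspace _).
    exact: (lin_add lin_beta (lin_opp (lin_fahom _))).
  apply: suppinW (@beta_lead v) => u [du lu su].
  by rewrite du dv lu lv; split=> //; rewrite -sv.
rewrite -[_ - _]linext_id; apply: (subspace_linext sS) => u /hi [du lu su].
have [|zu hzu zuE] := IH u.
  rewrite du; apply: leq_trans (_ : wdeg w - size w <= k)%N; last by [].
  by apply: ltn_sub2l => //; apply: leq_trans su _; rewrite -du size_leq_wdeg.
exists zu => //; apply: suppinW hzu => v [vk dv lv sv]; split=> //; rewrite ?dv ?lv //.
by apply: leq_trans (ltnW su) sv.
Qed.

Lemma beta_sur d n l x :
  suppin (fun w => [/\ wdeg w = d, wleaf w = n & l <= size w]%N) x ->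
  exists2 z : FY, suppin (okgraded d n l) z & beta z = x.
Proof.
move: x; apply: suppin_ind => [|w [<- <- lw]]; first exact: subspace_image lin_beta.
have [z hz ez] := beta_sur_word w; exists z => //.
by apply: suppinW hz => v [vk dv lv sv]; split=> //; apply: leq_trans lw sv.
Qed.

End BetaInverse.

(** * Reversal and left quotients *)

HB.lock Definition rv (F : fieldType) (K : choiceType) : {fa F[K]} -> {fa F[K]} :=
  linext (fun v => mono (rev v)).
Arguments rv {F K} x.

HB.lock Definition lquot (F : fieldType) (K : choiceType) (p : seq K) : {fa F[K]} -> {fa F[K]} :=
  linext (fun v => if prefix p v then mono (drop (size p) v) else 0).
Arguments lquot {F K} p x.

Section Reversal.
Variables (F : fieldType) (K : choiceType).
Local Notation FK := {fa F[K]}.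
Implicit Types (x y : FK) (v : seq K).

Lemma lin_rv : linear (rv : FK -> FK).
Proof. by rewrite rv.unlock; exact: linextP. Qed.

Lemma rvD x y : rv (x + y) = rv x + rv y. Proof. exact: linear_funD lin_rv _ _. Qed.
Lemma rvZ c x : rv (c *: x) = c *: rv x. Proof. exact: linear_funZ lin_rv _ _. Qed.
Lemma rv_mono v : rv (mono v) = mono (rev v) :> FK.
Proof. by rewrite rv.unlock; exact: linextU. Qed.

Lemma rvK : involutive (rv : FK -> FK).
Proof.
apply: malg_ind => [|v]; last by rewrite !rv_mono revK.
exact: (eq_subspace (lin_comp lin_rv lin_rv) (@lin_id _ _)).
Qed.

Lemma rvM x y : rv (x * y) = rv y * rv x.
Proof.
move: x; apply: malg_ind => [|u].
  apply: (eq_subspace (f := fun x => rv (x * y)) (g := fun x => rv y * rv x)).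
    exact: lin_comp lin_rv (famull_linear _).
  exact: (lin_comp (famulr_linear (rv y)) lin_rv).
move: y; apply: malg_ind => [|v]; last by rewrite faUU !rv_mono rev_cat faUU.
apply: (eq_subspace (f := fun y => rv (mono u * y)) (g := fun y => rv y * rv (mono u))).
  exact: lin_comp lin_rv (famulr_linear _).
exact: (lin_comp (famull_linear (rv (mono u))) lin_rv).
Qed.

Lemma suppin_rv (P : seq K -> Prop) x : suppin (fun v => P (rev v)) x -> suppin P (rv x).
Proof.
move: x; apply: suppin_ind => [|v Pv]; last by rewrite rv_mono; exact: suppinU.
exact: (subspace_preim (f := rv)) lin_rv (suppin_subspace _).
Qed.

Lemma mcoeff_rv x v : (rv x)@_v = x@_(rev v).
Proof.
move: x; apply: malg_ind => [|u].
  split; first by rewrite (linear_fun0 lin_rv) !mcoeff0.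
    by move=> x y ex ey; rewrite rvD !mcoeffD ex ey.
  by move=> c x ex; rewrite rvZ !mcoeffZ ex.
by rewrite rv_mono !mcoeff_mono (inv_eq (@revK K)).
Qed.

Lemma rv_part_size l x : rv (part (fun v => size v == l) x) = part (fun v => size v == l) (rv x).
Proof. by apply/malgP => v; rewrite mcoeff_rv !mcoeff_part mcoeff_rv size_rev. Qed.

End Reversal.

Lemma rv_fahom (F : fieldType) (K L : choiceType) (h : K -> {fa F[L]}) (x : {fa F[K]}) :
  rv (fahom h x) = fahom (fun k => rv (h k)) (rv x).
Proof.
move: x; apply: malg_ind => [|v].
  apply: (eq_subspace (f := fun x => rv (fahom h x)) (g := fun x => fahom _ (rv x))).
    exact: lin_comp (@lin_rv _ _) (lin_fahom _).
  exact: lin_comp (lin_fahom _) (@lin_rv _ _).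
elim: v => [|k v IH]; first by rewrite !rv_mono !fahomU !big_nil fa1E rv_mono.
rewrite fahom_cons rvM IH !rv_mono rev_cons -cats1 fahom_cat.
by rewrite fahom_letter.
Qed.

Section LeftQuotient.
Variables (F : fieldType) (K : choiceType).
Local Notation FK := {fa F[K]}.
Implicit Types (x y : FK) (u v p q : seq K) (k : K).

Lemma lin_lquot p : linear (lquot p : FK -> FK).
Proof. by rewrite lquot.unlock; exact: linextP. Qed.

Lemma lquot_mono p v :
  lquot p (mono v) = if prefix p v then mono (drop (size p) v) else 0 :> FK.
Proof. by rewrite lquot.unlock; exact: linextU. Qed.

Lemma lquot_nil x : lquot [::] x = x.
Proof.
move: x; apply: malg_ind => [|v]; last by rewrite lquot_mono prefix0s drop0.
exact: (eq_subspace (lin_lquot _) (@lin_id _ _)).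
Qed.

Lemma lquot_cons k p l x : lquot (k :: p) (mono [:: l] * x) = if k == l then lquot p x else 0.
Proof.
move: x; apply: malg_ind => [|v]; last by rewrite faUU !lquot_mono /=; case: (k == l).
apply: (eq_subspace (f := fun x => lquot _ (mono [:: l] * x))).
  exact: (lin_comp (lin_lquot _) (famulr_linear _)).
case: (k == l); first exact: lin_lquot.
by move=> c x y; rewrite scaler0 addr0.
Qed.

Lemma lquot_mull0 p x y (P : seq K -> Prop) :
  (forall u v, P u -> ~~ prefix p (u ++ v)) -> suppin P x -> lquot p (x * y) = 0.
Proof.
move=> hP; move: x; apply: suppin_ind => [|u Pu].
  have s0 : subspace (fun x : FK => x = 0).
    by split=> [|x z -> ->|c x ->] //; rewrite ?addr0 ?scaler0.
  apply: (subspace_preim (f := fun x => lquot p (x * y))) s0.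
  exact: (lin_comp (lin_lquot _) (famull_linear _)).
move: y; apply: malg_ind => [|v].
  have s0 : subspace (fun x : FK => x = 0).
    by split=> [|x z -> ->|c x ->] //; rewrite ?addr0 ?scaler0.
  apply: (subspace_preim (f := fun y => lquot p (mono u * y))) s0.
  exact: (lin_comp (lin_lquot _) (famulr_linear _)).
by rewrite faUU lquot_mono (negPf (hP u v Pu)).
Qed.

Lemma mcoeff_lquot p x q : (lquot p x)@_q = x@_(p ++ q).
Proof.
move: x; apply: malg_ind => [|u].
  split; first by rewrite (linear_fun0 (lin_lquot p)) !mcoeff0.
    by move=> x y ex ey; rewrite (linear_funD (lin_lquot p)) !mcoeffD ex ey.
  by move=> c x ex; rewrite (linear_funZ (lin_lquot p)) !mcoeffZ ex.
rewrite lquot_mono mcoeff_mono; case: ifPn => [/prefixP [r ->]|np].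
  by rewrite drop_size_cat // mcoeff_mono eqseq_cat // eqxx.
rewrite mcoeff0; case: eqP np => [->|//]; by rewrite prefix_prefix.
Qed.

End LeftQuotient.

Definition wordin (K : eqType) (A : K -> Prop) (v : seq K) : Prop := forall k, k \in v -> A k.

(* If b occurs in no hat and every hat contains a letter of X, then the left quotient by v b, for v
   free of X, commutes with the homomorphism k -> k + hat k. *)
Section StepA.
Variables (F : fieldType) (K : choiceType) (X : pred K) (A : K -> Prop) (b : K).
Local Notation FK := {fa F[K]}.
Variable hat : K -> FK.
Let etas : FK -> FK := fahom (fun k => mono [:: k] + hat k).
Hypothesis AX : forall k, A k -> ~~ X k.
Hypothesis hatX : forall k, A k -> suppin (fun v : seq K => has X v && (b \notin v)) (hat k).
Hypothesis etas_fixed : forall x : FK, suppin (wordin A) x ->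
  etas x = x -> suppin (fun v => v = [::]) x.
Implicit Types (p q u v : seq K).

Let lin_etas : linear etas. Proof. exact: lin_fahom. Qed.

(** If [u] reached beyond [p] it would contain [b]; otherwise it is a prefix of [p] and brings a
    letter of X into it. *)
Lemma prefix_hat p u v : ~~ has X p -> has X u && (b \notin u) -> ~~ prefix (rcons p b) (u ++ v).
Proof.
move=> pX /andP [uX bu]; apply/negP => /prefixP [r /esym e].
have [s|s] := leqP (size (rcons p b)) (size u).
  have : take (size (rcons p b)) u = rcons p b.
    by have := take_size_cat r (erefl (size (rcons p b))); rewrite e takel_cat.
  by move=> ep; case/negP: bu; apply: (@mem_take (size (rcons p b))); rewrite ep mem_rcons mem_head.
have : take (size u) p = u.
  rewrite size_rcons ltnS in s.
  by have := take_size_cat v (erefl (size u)); rewrite -e -cats1 -catA takel_cat.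
by move=> ep; case/negP: pX; rewrite -(cat_take_drop (size u) p) has_cat ep uX.
Qed.

Lemma lquot_etas p (x : FK) : ~~ has X p -> suppin (wordin A) x ->
  lquot (rcons p b) (etas x) = etas (lquot (rcons p b) x).
Proof.
move=> pX; move: x; apply: suppin_ind => [|v].
  apply: (eq_subspace (f := fun x => lquot _ (etas x)) (g := fun x => etas (lquot _ x))).
    exact: (lin_comp (lin_lquot _) lin_etas).
  exact: (lin_comp lin_etas (lin_lquot _)).
elim: v p pX => [|k v IH] p pX vA.
  rewrite /etas fahomU big_nil fa1E lquot_mono; case: p {pX} => [|l p] /=; exact/esym/fahom0.
rewrite /etas fahom_cons -/etas mulrDl (linear_funD (lin_lquot _)).
have -> : lquot (rcons p b) (hat k * etas (mono v)) = 0.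
  apply: lquot_mull0 (hatX (vA k (mem_head _ _))) => u w; exact: prefix_hat.
rewrite addr0 -(faUU _ [:: k] v).
have {}IH : forall p, ~~ has X p -> lquot (rcons p b) (etas (mono v)) = etas (lquot (rcons p b) (mono v)).
  by move=> p' pX'; apply: IH => // l lv; apply: vA; rewrite inE lv orbT.
case: p pX => [_|l p].
  rewrite !lquot_cons; case: ifP => _; last exact/esym/fahom0.
  by rewrite !lquot_nil.
rewrite /= negb_or => /andP [_ /IH {}IH]; rewrite !lquot_cons.
by case: ifP => _; [exact: IH|exact/esym/fahom0].
Qed.

(** The left quotient by [p] followed by [b] kills [s], so it sends [W] to a fixed element of
    [etas], that is, to a constant. *)
Lemma stepA_last W s p q : suppin (wordin A) W ->
  etas W = W + s -> suppin (fun v : seq K => b \notin v) s -> p ++ b :: q \in msupp W -> q = [::].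
Proof.
move=> WA eW sb pq.
have pX : ~~ has X p.
  apply/hasPn => k kp; apply: AX; apply: (WA _ pq); by rewrite mem_cat kp.
have sT : suppin (fun v => v = [::]) (lquot (rcons p b) W).
  apply: etas_fixed.
    apply/suppinP => v; rewrite mcoeff_lquot mcoeff_neq0 => /WA h k kv; apply: h.
    by rewrite mem_cat kv orbT.
  rewrite -lquot_etas // eW (linear_funD (lin_lquot _)) -[RHS]addr0; congr (_ + _).
  apply/malgP => v; rewrite mcoeff_lquot mcoeff0; apply: (mcoeff_suppin sb).
  by rewrite mem_cat mem_rcons mem_head.
apply: sT; rewrite -mcoeff_neq0 mcoeff_lquot mcoeff_neq0.
by rewrite -cats1 -catA.
Qed.
End StepA.

(** * Lifting terms to Jordan polynomials *)

Section JordanRep.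
Variables (F : fieldType) (Y : choiceType) (V : lmodType F) (c : V -> V -> V) (Z : V -> Prop).
Hypotheses (charF0 : [pchar F] =i pred0) (jm : jordan_mod c Z).
Variables (val : Y -> V) (A : Y -> Prop) (dg : Y -> nat).
Hypothesis dg_gt0 : forall y, (0 < dg y)%N.
Local Notation FY := {fa F[Y]}.
Implicit Types (s : FY) (z : V) (t : jtree Y).

Let bc := jordan_bil jm.
Let Zs := jordan_sub jm.

(* [jrep d s z]: modulo Z, the element z is the value of a Jordan polynomial of degree d
   in the letters satisfying A whose associative expansion is s. *)
Inductive jrep (d : nat) : FY -> V -> Prop :=
  | JRepTree t z : jall A t -> jdeg dg t = d -> Z (z - jval c val t) -> jrep d (jexp F t) z
  | JRep0 z : Z z -> jrep d 0 z
  | JRepD s1 z1 s2 z2 : jrep d s1 z1 -> jrep d s2 z2 -> jrep d (s1 + s2) (z1 + z2)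
  | JRepZ a s z : jrep d s z -> jrep d (a *: s) (a *: z).

Lemma jsize_jdeg t : (jsize t <= jdeg dg t)%N.
Proof. by elim: t => [y|a IHa b IHb] /=; [exact: dg_gt0|exact: leq_add]. Qed.

(** Letters have positive degree, so the trees have at most 6 leaves and [jproj_tree] reads the
    value off the expansion. All values of the same [s] therefore agree modulo [Z]. *)
Lemma jrep_functional d s z : (d <= 6)%N -> jrep d s z -> Z (z - linext (jproj c val) s).
Proof.
move=> d6; elim=> {s z} [t z tA td zt|z Zz|s1 z1 s2 z2 _ h1 _ h2|a s z _ h].
- have := jproj_tree charF0 jm val (leq_trans (jsize_jdeg t) (etrans (congr1 (leq^~ 6%N) td) d6)).
  have -> : linext (jproj c val) (jexp F t) = \sum_(w <- jwords t) jproj c val w.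
    by rewrite /jexp linear_sum; apply: eq_bigr => w _; exact: linextU.
  move=> /(subspaceN Zs) /(subspaceD Zs zt); rewrite opprB addrA subrK.
  exact.
- by rewrite linear0 subr0.
- by rewrite linearD opprD addrACA; exact: (subspaceD Zs).
- by rewrite linearZ /= -scalerBr; exact: (subspaceZ Zs).
Qed.

Lemma jrep_eq0 d z : (d <= 6)%N -> jrep d 0 z -> Z z.
Proof. by move=> d6 /(jrep_functional d6); rewrite linear0 subr0. Qed.

Lemma jrepN d s z : jrep d s z -> jrep d (- s) (- z).
Proof. by move=> /(JRepZ (-1)); rewrite !scaleN1r. Qed.

Lemma jrepB d s1 z1 s2 z2 : jrep d s1 z1 -> jrep d s2 z2 -> jrep d (s1 - s2) (z1 - z2).
Proof. by move=> h1 h2; apply: JRepD => //; exact: jrepN. Qed.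

Lemma jrep_leaf y : A y -> jrep (dg y) (mono [:: y]) (val y).
Proof.
move=> Ay; rewrite -jexp_leaf; apply: JRepTree => //=; rewrite subrr; exact: subspace0 Zs.
Qed.

Lemma jrep_mod d s z z' : Z (z' - z) -> jrep d s z -> jrep d s z'.
Proof.
move=> zz h; rewrite -[s]addr0 -[z'](subrKC z); exact: JRepD h (JRep0 d zz).
Qed.

Lemma jrep_linext (K : choiceType) d (h : K -> FY) (v : K -> V) (g : {malg F[K]}) :
  (forall k, k \in msupp g -> jrep d (h k) (v k)) -> jrep d (linext h g) (linext v g).
Proof.
move=> H; rewrite /linext big_seq [in X in jrep _ _ X]big_seq.
elim/big_ind2: _ => [|x x' y y'|k /H]; [|exact: JRepD|exact: JRepZ].
apply: JRep0; exact: subspace0 Zs.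
Qed.

Lemma jrep_mul d1 s1 z1 d2 s2 z2 : jrep d1 s1 z1 -> jrep d2 s2 z2 ->
  jrep (d1 + d2) (s1 * s2 + s2 * s1) (c z1 z2).
Proof.
have cZ x y : Z x -> Z (c x y) by move=> Zx; apply: (jordan_ideal jm).
have cZr x y : Z y -> Z (c x y) by rewrite (jordan_comm jm); exact: cZ.
move=> h1 h2; elim: h1 => {s1 z1} [t z tA td zt|z Zz|s1 z1 s1' z1' _ IH _ IH'|a s1 z1 _ IH].
- elim: h2 => {s2 z2} [t' z' tA' td' zt'|z' Zz|s2 z2 s2' z2' _ IH _ IH'|a s2 z2 _ IH].
  + rewrite -jexp_mul; apply: JRepTree => //=; first by rewrite td td'.
    have -> : c z z' - c (jval c val t) (jval c val t') =
        c (z - jval c val t) z' + c (jval c val t) (z' - jval c val t').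
      by rewrite (bilopDl bc) (bilopDr bc) (bilopNl bc) (bilopNr bc) addrA subrK.
    by apply: (subspaceD Zs); [exact: cZ|exact: cZr].
  + by rewrite mulr0 mul0r addr0; apply: JRep0; exact: cZr.
  + rewrite mulrDr mulrDl (bilopDr bc) addrACA; exact: JRepD.
  + rewrite fa_scalerAr fa_scalerAl -scalerDr (bilopZr bc); exact: JRepZ.
- by rewrite mulr0 mul0r addr0; apply: JRep0; exact: cZ.
- rewrite mulrDr mulrDl (bilopDl bc) addrACA; exact: JRepD.
- rewrite fa_scalerAr fa_scalerAl -scalerDr (bilopZl bc); exact: JRepZ.
Qed.

Lemma jrep_size_part d s z l : jrep d s z -> exists z', jrep d (size_part l s) z'.
Proof.
have lin := @lin_size_part F Y l.
elim=> {s z} [t z tA td zt|z Zz|s1 z1 s2 z2 _ [x hx] _ [y hy]|a s z _ [x hx]].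
- have ts : suppin (fun v => size v = jsize t) (jexp F t).
    elim: t {tA td zt} => [y|a IHa b IHb]; first by rewrite jexp_leaf; exact: suppinU.
    rewrite jexp_mul; apply: (subspaceD (suppin_subspace _)).
      by apply: suppinM IHa IHb => u v /= <- <-; exact: size_cat.
    by apply: suppinM IHb IHa => u v /= <- <-; rewrite size_cat addnC.
  have [e|ne] := eqVneq (jsize t) l.
    exists z; rewrite /size_part part_id; first exact: JRepTree.
    by apply: suppinW ts => v ->; exact/eqP.
  exists 0; rewrite /size_part part_0; first by apply: JRep0; exact: subspace0 Zs.
  by apply: suppinW ts => v ->.
- by exists 0; rewrite (linear_fun0 lin); apply: JRep0; exact: subspace0 Zs.
- by exists (x + y); rewrite (linear_funD lin); exact: JRepD.
- by exists (a *: x); rewrite (linear_funZ lin); exact: JRepZ.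
Qed.

Lemma jrep_fahom_ex (h : Y -> FY) d s z :
  (forall y, A y -> (dg y <= d)%N -> exists z', jrep (dg y) (h y) z') ->
  jrep d s z -> exists z', jrep d (fahom h s) z'.
Proof.
move=> H; elim=> {s z} [t z tA td zt|z Zz|s1 z1 s2 z2 _ [x hx] _ [y hy]|a s z _ [x hx]].
- rewrite -{1}td {zt}; have {td} td : (jdeg dg t <= d)%N by rewrite td.
  elim: t tA td => [y|a IHa b IHb] /= => [Ay yd|[tA tB] ab].
    by rewrite jexp_leaf fahom_letter; exact: H.
  have [x hx] := IHa tA (leq_trans (leq_addr _ _) ab).
  have [y hy] := IHb tB (leq_trans (leq_addl _ _) ab).
  by exists (c x y); rewrite jexp_mul fahomD !fahomM; exact: jrep_mul.
- by exists 0; rewrite fahom0; apply: JRep0; exact: subspace0 Zs.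
- by exists (x + y); rewrite fahomD; exact: JRepD.
- by exists (a *: x); rewrite fahomZ; exact: JRepZ.
Qed.

(** A substitution of letters and an endomorphism of the Jordan algebra that correspond on letters
    correspond on all Jordan polynomials. *)
Lemma jrep_fahom (h : Y -> FY) (D : V -> V) d s z : linear D ->
  {morph D : x y / c x y} -> (forall x, Z x -> Z (D x)) ->
  (forall y, A y -> (dg y <= d)%N -> jrep (dg y) (h y) (D (val y))) ->
  jrep d s z -> jrep d (fahom h s) (D z).
Proof.
move=> lD cD ZD H; elim=> {s z} [t z tA td zt|z Zz|s1 z1 s2 z2 _ h1 _ h2|a s z _ h1].
- apply: (@jrep_mod _ _ (D (jval c val t))).
    by have := ZD _ zt; rewrite (linear_funD lD) -scaleN1r (linear_funZ lD) scaleN1r.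
  rewrite -{1}td {zt}; have {td} td : (jdeg dg t <= d)%N by rewrite td.
  elim: t tA td => [y|a IHa b IHb] /= => [Ay yd|[tA tB] ab].
    by rewrite jexp_leaf fahom_letter; exact: H.
  have hx := IHa tA (leq_trans (leq_addr _ _) ab).
  have hy := IHb tB (leq_trans (leq_addl _ _) ab).
  by rewrite jexp_mul fahomD !fahomM cD; exact: jrep_mul.
- by rewrite fahom0; apply: JRep0; exact: ZD.
- by rewrite fahomD (linear_funD lD); exact: JRepD.
- by rewrite fahomZ (linear_funZ lD); exact: JRepZ.
Qed.

Lemma jrep_rv d s z : jrep d s z -> rv s = s.
Proof.
elim=> {s z} [t z _ _ _|z _|s1 z1 s2 z2 _ h1 _ h2|a s z _ h1].
- elim: t => [y|a IHa b IHb]; first by rewrite jexp_leaf rv_mono.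
  by rewrite jexp_mul rvD !rvM IHa IHb addrC.
- exact: linear_fun0 (@lin_rv _ _).
- by rewrite rvD h1 h2.
- by rewrite rvZ h1.
Qed.

End JordanRep.

(** The Jordan triple product, which makes symmetrized words of length three Jordan. *)
Lemma sym3_jordan (A : pzRingType) (x y z : A) :
  (x * y * z + z * y * x) *+ 2 =
  ((x * y + y * x) * z + z * (x * y + y * x)) + ((y * z + z * y) * x + x * (y * z + z * y))
  - ((x * z + z * x) * y + y * (x * z + z * x)).
Proof.
rewrite !mulrDl !mulrDr !mulrA !opprD !addrA mulr2n addrA.
rewrite [RHS](ACl ((1*4)*(7*6)*(2*11)*(3*10)*(5*12)*(8*9)))/=.
by rewrite !subrr !addr0 addrA.
Qed.

Lemma addr_sub4 (M : zmodType) (a b c e : M) : a - b - (c - e) = (a - c) - (b - e).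
Proof. by rewrite !opprB !addrA [LHS](ACl (1*4*3*2)). Qed.

Lemma pair_subE (M : zmodType) (a b c e : M) : (a, b) - (c, e) = (a - c, b - e).
Proof. by []. Qed.

Lemma addr_subD4 (M : zmodType) (a b c e : M) : a + b - (c + e) = a - c + (b - e).
Proof. by rewrite opprD addrACA. Qed.

Lemma pair_addE (M : zmodType) (a b c e : M) : (a, b) + (c, e) = (a + c, b + e).
Proof. by []. Qed.

Lemma linext_pair (F : fieldType) (K : choiceType) (M : lmodType F) (f h : K -> M) (g : {malg F[K]}) :
  linext (fun k => (f k, h k)) g = (linext f g, linext h g).
Proof.
move: g; apply: malg_ind => [|k]; last by rewrite !linextU.
apply: (eq_subspace (f := linext _) (g := fun g => (linext f g, linext h g))).
  exact: linextP.
by move=> c x y; rewrite (linextP f) (linextP h).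
Qed.

Lemma linext0 (F : fieldType) (K : choiceType) (M : lmodType F) (g : {malg F[K]}) :
  linext (fun _ => 0 : M) g = 0.
Proof. by rewrite /linext big1 // => k _; rewrite scaler0. Qed.

Section Representations.
Variables (F : fieldType).
Hypothesis charF0 : [pchar F] =i pred0.
Local Notation U := {fa F[letter]}.
Local Notation Y := (bwterm + letter)%type.
Local Notation FY := {fa F[Y]}.
Local Notation V := (bwpoly F * bwpoly F)%type.
Local Notation N := (@post_jordan_ideal F).
Implicit Types (t : bwterm) (y : Y) (v : seq Y) (w : seq letter) (s z : FY).

Lemma tdeg_circ a b : tdeg (TCirc a b) = (tdeg a + tdeg b)%N.
Proof. exact: size_cat. Qed.
Lemma tdeg_bul a b : tdeg (TBul a b) = (tdeg a + tdeg b)%N.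
Proof. exact: size_cat. Qed.

Definition isX y : bool := if y is inr l then is_leaf l else false.
Definition isC y : bool := if y is inr l then ~~ is_leaf l else false.
Definition isG y : bool := if y is inl _ then true else false.

(** A letter R(w x_i) of U has no counterpart among the pairs, since w x_i need not come from a
    term; [jr] admits only the letters X_i and G_t. *)
Definition yval y : V :=
  match y with
  | inl t => (0, bwt t)
  | inr (GenTree.Leaf i) => (bwt (TVar i), 0)
  | inr (GenTree.Node _ _) => 0
  end.

Definition jr := jrep (@hatmul F) (@hatideal F) yval (fun y => ~~ isC y) ydeg.

(** That each word contains an X and no C is what [hat_Am] asks of the shift of G_t; the bound on
    sizes and [repK_var] determine its linear part in [size_part_hat]. *)
Record repK t s : Prop := RepK {
  repK_supp : suppin (fun v => [/\ okword F v, has isX v, ~~ has isC v & (1 < tdeg t -> 1 < size v)%N]) s;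
  repK_jr : jr (tdeg t) s (bwt t, 0);
  repK_beta : beta s = ev F t;
  repK_var : forall i, t = TVar i -> s = mono [:: inr (Leaf i)]
}.

Record repR t s : Prop := RepR {
  repR_supp : suppin (fun v => [/\ okword F v, all isG v & 0 < size v]%N) s;
  repR_jr : jr (tdeg t) s (0, bwt t);
  repR_beta : beta s = RB (ev F t)
}.

Lemma ydeg_gt0 y : (0 < ydeg y)%N.
Proof. by case: y => [t|l]; [exact: tdeg_gt0|exact: ldeg_gt0]. Qed.

Lemma eta_RB_supp (x : U) : suppin (fun w => has is_leaf w) x -> eta_hom (RB x) = RB x + x.
Proof.
move: x; apply: suppin_ind => [|w]; last exact: eta_RB.
apply: (eq_subspace (f := fun x => eta_hom (RB x)) (g := fun x => RB x + x)).
  exact: (lin_comp (@lin_eta F) (@lin_RB F)).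
exact: (lin_add (@lin_RB F) (@lin_id _ _)).
Qed.

Lemma eta_RBev t : eta_hom (RB (ev F t)) = RB (ev F t) + ev F t.
Proof. by apply: eta_RB_supp; apply: suppinW (@ev_supp F t) => w []. Qed.

Lemma suppin_sum_eq0 (P Q : seq Y -> Prop) z :
  (forall v, P v -> ~ Q v) -> suppin P z -> suppin Q z -> z = 0.
Proof.
move=> PQ hp hq; apply/malgP => v; rewrite mcoeff0; apply: mcoeff_outdom.
by apply/negP => vz; exact: (PQ v (hp v vz) (hq v vz)).
Qed.

(** [C l] lifts w x_i, the amount by which the shift moves the letter l = R(w x_i). Lifting through
    [beta] keeps the degree and the number of letters X. *)
Lemma hatC_exists : exists C : letter -> FY, forall l, ~~ is_leaf l ->
  suppin (fun v => [/\ okword F v, vdeg v = ldeg l & 0 < vleaf v]%N) (C l) /\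
  beta (C l) = etal F l - mono [:: l].
Proof.
suff /choice [C hC] : forall l : letter, exists s : FY, ~~ is_leaf l ->
    suppin (fun v => [/\ okword F v, vdeg v = ldeg l & 0 < vleaf v]%N) s /\
    beta s = etal F l - mono [:: l] by exists C.
case=> [i|i w]; first by exists 0.
have [s hs es] := beta_sur_word F (w ++ [:: Leaf i]); exists s => _; split.
  apply: suppinW hs => v [vk dv lv _]; split=> //.
    by rewrite dv wdeg_cat /wdeg /= addn0 addn1.
  by rewrite lv wleaf_cat /wleaf /= addn1.
by rewrite es /= addrAC subrr add0r.
Qed.

(** * The shift on free generators and the lifting of R(t) *)

Section Step.
Variables (d : nat) (S : bwterm -> FY) (C : letter -> FY).
Hypothesis hS : forall t, (tdeg t <= d)%N -> repK t (S t).
Hypothesis hC : forall l, ~~ is_leaf l ->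
  suppin (fun v => [/\ okword F v, vdeg v = ldeg l & 0 < vleaf v]%N) (C l) /\
  beta (C l) = etal F l - mono [:: l].

(* Lifts to [Y] the homomorphism R(k) -> R(k) + k; letters x_i are sent to 0. *)
Definition hat y : FY :=
  match y with
  | inl t => if (tdeg t <= d)%N then S t else 0
  | inr (GenTree.Leaf i) => - mono [:: inr (Leaf i)]
  | inr (GenTree.Node i w) => C (Node i w)
  end.

Definition etas : FY -> FY := fahom (fun y => mono [:: y] + hat y).

Lemma lin_etas : linear etas. Proof. exact: lin_fahom. Qed.
Lemma etasB x z : etas (x - z) = etas x - etas z. Proof. exact: fahomB. Qed.
Definition Aok y : Prop := [/\ yok F y, ~~ isX y & ydeg y <= d]%N.

Lemma hat_ok y : Aok y -> suppin (okword F) (hat y).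
Proof.
case: y => [t|[i|i w]] [] // _ _ /= td; rewrite /hat.
  by rewrite td; apply: suppinW (repK_supp (hS td)) => v [].
by have [h _] := hC (l := Node i w) isT; apply: suppinW h => v [].
Qed.

Lemma beta_hat y : Aok y -> beta (hat y) = eta_hom (betal F y) - betal F y.
Proof.
case: y => [t|[i|i w]] [] // _ _ /= td; rewrite /hat.
  by rewrite td (repK_beta (hS td)) eta_RBev addrAC subrr add0r.
by have [_ ->] := hC (l := Node i w) isT; rewrite /= /eta_hom fahom_letter.
Qed.

Lemma suppin_letter (P : Y -> Prop) y : P y -> suppin (wordin P) (mono [:: y] : FY).
Proof. by move=> Py; apply: suppinU => z; rewrite inE => /eqP->. Qed.

Lemma etas_ok x : suppin (wordin Aok) x -> suppin (okword F) (etas x).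
Proof.
apply: (suppin_fahom (P := wordin Aok)) => v vA.
apply: (suppin_fahom_word (R1 := fun _ v => okword F v) (R := fun _ v => okword F v)) => //.
  by move=> _ _ u u' hu hu' y; rewrite mem_cat => /orP[/hu|/hu'].
move=> y /vA yA; apply: (subspaceD (suppin_subspace _)); last exact: hat_ok.
by apply: suppin_letter; case: yA.
Qed.

Lemma beta_etas x : suppin (wordin Aok) x -> beta (etas x) = eta_hom (beta x).
Proof.
move=> xA; rewrite /beta /etas /eta_hom !fahom_comp; apply: (eq_fahom_in (P := Aok)) xA => y yA.
rewrite fahomD fahom_letter -/(beta _) beta_hat // addrC subrK.
by [].
Qed.

Lemma vleaf0 v : wordin (fun y => ~~ isX y) v -> vleaf v = 0%N.
Proof.
elim: v => // y v IH h; rewrite /vleaf /= -/(vleaf v) IH => [|z zv]; last first.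
  by apply: h; rewrite inE zv orbT.
by have := h y (mem_head _ _); case: y {h} => [|l] //= /negPf ->.
Qed.

(** Through [beta] this becomes [eta_fixed_const], and injectivity of [beta] brings the conclusion
    back. *)
Lemma etas_fixed x : suppin (wordin Aok) x -> etas x = x -> suppin (fun v => v = [::]) x.
Proof.
move=> xA ex; have xok : suppin (okword F) x by apply: suppinW xA => v h y /h [].
have bx : suppin (fun w => w = [::]) (beta x).
  apply: eta_fixed_const; last by rewrite -beta_etas // ex.
  move: x xA {ex xok}; apply: suppin_ind => [|v vA].
    exact: (subspace_preim (f := @beta F) (P := suppin noleaf) (@lin_beta F) (suppin_subspace _)).
  apply: suppinW (@beta_graded F v) => w [_ + _].
  by rewrite (vleaf0 (fun y yv => let: And3 _ h _ := vA y yv in h)) => /wleaf0.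
pose x0 := (beta x)@_[::] *: mono [::] : FY.
have x0s : suppin (fun v => v = [::]) x0.
  by apply: (subspaceZ (suppin_subspace _)); exact: suppinU.
suff e : x - x0 = 0 by move/eqP: e; rewrite subr_eq0 => /eqP ->.
apply: beta_inj.
  apply: (subspaceB (suppin_subspace _)) => //; by apply: suppinW x0s => v ->.
rewrite linearB linearZ /= [X in _ - _ *: X]fahomU big_nil fa1E.
apply/malgP => w; rewrite mcoeffB mcoeffZ mcoeff_mono mcoeff0.
have [<-|nw] := eqVneq [::] w; first by rewrite mulr1 subrr.
by rewrite mulr0 subr0; apply: (mcoeff_suppin bx) => ew; rewrite ew eqxx in nw.
Qed.

Lemma isC_isX y : isC y -> ~~ isX y.
Proof. by case: y => [|[]]. Qed.

Lemma vleaf_leq_vdeg v : (vleaf v <= vdeg v)%N.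
Proof.
elim: v => // y v IH; rewrite /vleaf /vdeg /= leq_add //.
by case: y => [t|l] //=; apply: leq_trans (leq_b1 _) (ldeg_gt0 l).
Qed.

Lemma mem_vdeg b v : b \in v -> ~~ isX b -> (0 < vleaf v)%N -> (ydeg b < vdeg v)%N.
Proof.
move=> /perm_to_rem bv bX; rewrite /vleaf /vdeg !(perm_sumn (perm_map _ bv)) /=.
have -> : yleaf b = 0%N by case: b bX {bv} => [t|l] //= /negPf ->.
move=> lv; rewrite -addn1 leq_add2l; exact: leq_trans lv (vleaf_leq_vdeg _).
Qed.

(** The letters C are removed in descending degree. Words in the shift of a letter C have its degree
    and contain an X, so any C in them has smaller degree. *)
Definition Am m y : Prop := Aok y /\ (isC y -> ydeg y <= m)%N.

Lemma Am_word m v : wordin (Am m) v -> wordin Aok v.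
Proof. by move=> h y /h []. Qed.

Lemma hat_Am m b y : isC b -> ydeg b = m -> Am m y ->
  suppin (fun v => has isX v && (b \notin v)) (hat y).
Proof.
move=> bC bm [[yk yX yd] ym]; case: y yk yX yd ym => [t|[i|i w]] // yk yX yd ym.
  rewrite /hat; have -> : (tdeg t <= d)%N by exact: yd.
  apply: suppinW (repK_supp (hS yd)) => v [_ -> /hasPn nC _] /=.
  by apply/negP => /nC; rewrite bC.
have [h _] := hC (l := Node i w) isT; apply: suppinW h => v [_ dv lv].
apply/andP; split.
  by apply: contraTT lv => /hasPn h; rewrite (vleaf0 h).
apply/negP => /mem_vdeg /(_ (isC_isX bC) lv).
by rewrite bm dv ltnNge ym.
Qed.

Lemma rv_etas x : rv (etas x) = fahom (fun y => mono [:: y] + rv (hat y)) (rv x).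
Proof. by rewrite rv_fahom; apply: eq_fahom => y; rewrite rvD rv_mono. Qed.

Lemma suppin_rv_word (P : Y -> Prop) (x : FY) : suppin (wordin P) x -> suppin (wordin P) (rv x).
Proof.
move=> xP; apply: suppin_rv; apply: suppinW xP => v vP y; rewrite mem_rev; exact: vP.
Qed.

(** By [stepA_last] for [W] and for its reversal, an occurrence of [b] is both last and first in its
    word, against size at least two. *)
Lemma stepA_letter m b (W s : FY) : isC b -> ydeg b = m -> suppin (wordin (Am m)) W ->
  suppin (fun v => 1 < size v)%N W -> etas W = W + s ->
  suppin (fun v => ~~ has isC v) s -> suppin (fun v => b \notin v) W.
Proof.
move=> bC bm WA W2 eW sC.
have sb : suppin (fun v => b \notin v) s.
  by apply: suppinW sC => v /hasPn nC; apply/negP => /nC; rewrite bC.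
have AX y : Am m y -> ~~ isX y by case=> [[]].
have last p q : p ++ b :: q \in msupp W -> q = [::].
  apply: (stepA_last (X := isX) (A := Am m) (hat := hat)) WA eW sb => // [y|x xA ex].
    exact: hat_Am.
  by apply: etas_fixed ex; apply: suppinW xA; exact: Am_word.
have hatX' y : Am m y -> suppin (fun v => has isX v && (b \notin v)) (rv (hat y)).
  move=> yA; apply: suppin_rv; apply: suppinW (hat_Am bC bm yA) => v.
  by rewrite has_rev mem_rev.
have fixed' (x : FY) : suppin (wordin (Am m)) x ->
    fahom (fun y => mono [:: y] + rv (hat y)) x = x -> suppin (fun v => v = [::]) x.
  move=> xA ex; rewrite -[x]rvK; apply: suppin_rv.
  have rA : suppin (wordin Aok) (rv x).
    by apply: suppin_rv_word; apply: suppinW xA; exact: Am_word.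
  have : suppin (fun v => v = [::]) (rv x).
    by apply: etas_fixed rA _; rewrite -[LHS]rvK rv_etas rvK ex.
  by apply: suppinW => v ->.
have eW' : fahom (fun y => mono [:: y] + rv (hat y)) (rv W) = rv W + rv s.
  by rewrite -rv_etas eW rvD.
have sb' : suppin (fun v => b \notin v) (rv s).
  by apply: suppin_rv; apply: suppinW sb => v; rewrite mem_rev.
have first p q := stepA_last AX hatX' fixed' (suppin_rv_word WA) eW' sb' (p := p) (q := q).
move=> v vW; apply/negP => bv; case/splitPr: bv vW => p q vW.
have := W2 _ vW; rewrite (last _ _ vW) size_cat /=.
suff -> : p = [::] by [].
apply: (can_inj (@revK Y)); apply: (first (rev q)).
by rewrite -mcoeff_neq0 mcoeff_rv rev_cat rev_cons !revK cat_rcons mcoeff_neq0.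
Qed.

Lemma stepA (W s : FY) : suppin (wordin Aok) W ->
  suppin (fun v => 1 < size v)%N W -> etas W = W + s ->
  suppin (fun v => ~~ has isC v) s -> suppin (fun v => ~~ has isC v) W.
Proof.
move=> WA W2 eW sC.
have h k : suppin (wordin (Am (d - k))) W.
  elim: k => [|k IH]; first by apply: suppinW WA => v h y /h yA; split=> //; rewrite subn0; case: yA.
  have [dk|kd] := leqP d k; first by apply: suppinW IH; rewrite !(eqP dk) subnS (eqP dk).
  move=> v vW y yv; have [yA yk] := IH v vW y yv; split=> // yC.
  have := yk yC; rewrite subnS leq_eqVlt => /orP[/eqP e|]; last by case: (d - k)%N.
  by have := stepA_letter yC e IH W2 eW sC vW; rewrite yv.
apply: suppinW (h d) => v hv; apply/hasPn => y /hv [_ yC]; apply/negP => /yC.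
by rewrite subnn leqNgt ydeg_gt0.
Qed.

(** The shifts of letters G are Jordan, hence reversible, so the reversal of [W] solves the same
    equation. The difference of the two solutions is fixed by [etas], hence constant, and it has no
    words of size below two. *)
Lemma stepB (W s : FY) : suppin (wordin Aok) W -> suppin (fun v => all isG v) W ->
  suppin (fun v => 1 < size v)%N W -> etas W = W + s -> rv s = s -> rv W = W.
Proof.
move=> WA WG W2 eW rs.
have eR : etas (rv W) = rv W + s.
  rewrite -rs -rvD -eW rv_etas; apply: (eq_fahom_in (P := fun y => isG y /\ Aok y)).
    case=> [t|l] [//= _ [_ _ td]]; congr (_ + _).
    by rewrite /hat td (jrep_rv (repK_jr (hS td))).
  apply: suppin_rv; move=> v vW y; rewrite mem_rev => yv; split.
    by have /allP := WG v vW; exact.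
  exact: WA v vW y yv.
apply/eqP; rewrite -subr_eq0; apply/eqP.
have D2 : suppin (fun v => 1 < size v)%N (rv W - W).
  apply: (subspaceB (suppin_subspace _)) => //.
  by apply: suppin_rv; apply: suppinW W2 => v; rewrite size_rev.
apply: suppin_sum_eq0 D2 (etas_fixed _ _) => [v + ev||]; first by rewrite ev.
  by apply: (subspaceB (suppin_subspace _)) => //; exact: suppin_rv_word.
by rewrite etasB eR eW opprD addrACA subrr addr0.
Qed.

Hypothesis d_le : (d <= 5)%N.

Definition jcomb x : Prop := exists z : V, jr d x z.

Lemma jcomb_subspace : subspace jcomb.
Proof.
split; first by exists 0; apply: JRep0; exact: (subspace0 (jordan_sub (hat_jordan F))).
  by move=> x1 x2 [z1 h1] [z2 h2]; exists (z1 + z2); exact: JRepD.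
by move=> c x [z h]; exists (c *: z); exact: JRepZ.
Qed.

Lemma jr_letter y : ~~ isC y -> jr (ydeg y) (mono [:: y]) (yval y).
Proof. exact: (jrep_leaf (hat_jordan F) yval ydeg (A := fun y => ~~ isC y)). Qed.

Lemma jr_mul n1 s1 (z1 : V) n2 s2 (z2 : V) : jr n1 s1 z1 -> jr n2 s2 z2 ->
  jr (n1 + n2) (s1 * s2 + s2 * s1) (hatmul z1 z2).
Proof. move=> h1 h2; exact: (jrep_mul (hat_jordan F) h1 h2). Qed.

(** The counterpart of [etas] on pairs: R(r) goes to r + R(r), and first components, like the X_i,
    go to 0. *)
Definition ev2 (x : V) : V := (x.2, x.2).

Lemma jr_hat y : ~~ isC y -> (ydeg y <= d)%N -> jr (ydeg y) (mono [:: y] + hat y) (ev2 (yval y)).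
Proof.
case: y => [t|[i|//]] _ td.
  rewrite /hat /=; have -> : (tdeg t <= d)%N by exact: td.
  have := JRepD (jr_letter (y := inl t) isT) (repK_jr (hS td)).
  by rewrite pair_addE add0r addr0.
rewrite /hat /= subrr; apply: JRep0; exact: (subspace0 (jordan_sub (hat_jordan F))).
Qed.

Lemma jcomb_etas x : jcomb x -> jcomb (etas x).
Proof.
case=> z; apply: jrep_fahom_ex; first exact: hat_jordan.
by move=> y yC yd; exists (ev2 (yval y)); exact: jr_hat.
Qed.

Lemma two_unit : (2 : F) != 0.
Proof. by rewrite (proj1 (pcharf0P F) charF0). Qed.

Lemma isG_isC y : isG y -> ~~ isC y.
Proof. by case: y. Qed.

Lemma jcomb_sym_word v : all isG v -> vdeg v = d -> (0 < size v <= 3)%N ->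
  jcomb (mono v + mono (rev v)).
Proof.
have L y : isG y -> jr (ydeg y) (mono [:: y]) (yval y) by move/isG_isC/jr_letter.
case: v => [//|a [|b [|c [|//]]]] /= vG vd _.
- rewrite andbT in vG; rewrite /rev /=; exists (yval a + yval a); rewrite -vd /vdeg /= addn0.
  exact: JRepD (L a vG) (L a vG).
- move: vG => /and3P [aG bG _].
  have -> : mono [:: a; b] + mono (rev [:: a; b]) =
      mono [:: a] * mono [:: b] + mono [:: b] * mono [:: a] :> FY by rewrite !faUU.
  rewrite /jcomb -vd /vdeg /= addn0.
  by eexists; exact: jr_mul (L a aG) (L b bG).
move: vG => /and4P [aG bG cG _].
have -> : mono [:: a; b; c] + mono (rev [:: a; b; c]) =
    2^-1 *: ((mono [:: a] * mono [:: b] * mono [:: c] +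
              mono [:: c] * mono [:: b] * mono [:: a]) *+ 2) :> FY.
  by rewrite !faUU -scaler_nat scalerA mulVf ?scale1r //; exact: two_unit.
apply: (subspaceZ jcomb_subspace); rewrite sym3_jordan.
have Ld n m p y1 y2 y3 (e : (n + m + p)%N = d) : isG y1 -> isG y2 -> isG y3 ->
  n = ydeg y1 -> m = ydeg y2 -> p = ydeg y3 ->
  jcomb ((mono [:: y1] * mono [:: y2] + mono [:: y2] * mono [:: y1]) * mono [:: y3] +
    mono [:: y3] * (mono [:: y1] * mono [:: y2] + mono [:: y2] * mono [:: y1])).
  move=> g1 g2 g3 e1 e2 e3; rewrite /jcomb -e e1 e2 e3.
  by eexists; exact: jr_mul (jr_mul (L _ g1) (L _ g2)) (L _ g3).
have e3 : (ydeg a + ydeg b + ydeg c)%N = d by rewrite -vd /vdeg /= addn0 addnA.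
apply: (subspaceB jcomb_subspace); first apply: (subspaceD jcomb_subspace).
- exact: Ld e3 aG bG cG erefl erefl erefl.
- by apply: Ld bG cG aG erefl erefl erefl; rewrite -e3 addnC addnA.
- by apply: Ld aG cG bG erefl erefl erefl; rewrite -e3 addnAC.
Qed.

Lemma jcomb_sym x : suppin (fun v => [/\ all isG v, vdeg v = d & 0 < size v <= 3]%N) x ->
  rv x = x -> jcomb x.
Proof.
move=> xs rx.
have E : x = 2^-1 *: (x + rv x).
  by rewrite rx -mulr2n -scaler_nat scalerA mulVf ?scale1r //; exact: two_unit.
rewrite E; apply: (subspaceZ jcomb_subspace); move: x xs {rx E}.
apply: suppin_ind => [|v [vG vd v3]].
  apply: (subspace_preim (f := fun x : FY => x + rv x)) jcomb_subspace.
  exact: (lin_add (@lin_id _ _) (@lin_rv _ _)).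
by rewrite rv_mono; exact: jcomb_sym_word.
Qed.

(** The shift sends the letter of R(x_i) to itself plus X_i. Identifying X_i with that letter turns
    this into multiplication by 2, which is the origin of [cfac]. *)
Definition glet y : FY :=
  if y is inr (GenTree.Leaf i) then mono [:: inl (TVar i)] else mono [:: y].

Lemma jcomb_glet x : jcomb x -> jcomb (fahom glet x).
Proof.
case=> z; apply: jrep_fahom_ex; first exact: hat_jordan.
case=> [t|[i|//]] _ _; first by exists (yval (inl t)); exact: jr_letter.
by exists (yval (inl (TVar i))); exact: (jr_letter (y := inl (TVar i))).
Qed.

Definition cfac y : F := if ydeg y == 1%N then 2 else 1.

Lemma fahom_scale v :
  fahom (fun y => cfac y *: mono [:: y]) (mono v) = (\prod_(y <- v) cfac y) *: mono v :> FY.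
Proof.
elim: v => [|y v IH]; first by rewrite fahomU !big_nil scale1r fa1E.
by rewrite fahom_cons IH big_cons fa_scalerAl fa_scalerAr faUU scalerA.
Qed.

Lemma size_leq_vdeg v : (size v <= vdeg v)%N.
Proof. by elim: v => // y v IH; rewrite /vdeg /= -add1n leq_add // ydeg_gt0. Qed.

Lemma mem_ydeg y v : y \in v -> (ydeg y <= vdeg v)%N.
Proof. by move=> /perm_to_rem yv; rewrite /vdeg (perm_sumn (perm_map _ yv)) /= leq_addr. Qed.

(** At most one letter has degree 2 and the others have degree 1, so the exponent is the number of
    letters of degree 1. *)
Lemma cfac_prod v : (vdeg v <= (size v).+1)%N ->
  \prod_(y <- v) cfac y = 2 ^+ (2 * size v - vdeg v).
Proof.
move=> h; suff [k [e <-]] : exists k, (k + vdeg v = 2 * size v)%N /\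
    2 ^+ k = \prod_(y <- v) cfac y by rewrite -e addnK.
elim: v h => [|y v IH] h; first by exists 0%N; rewrite big_nil expr0.
rewrite /vdeg /= -/(vdeg v) in h *; have y0 := ydeg_gt0 y; have sv := size_leq_vdeg v.
have [|k [ek pk]] := IH; first by lia.
rewrite big_cons -pk /cfac; case: eqP => [y1|y1].
  by exists k.+1; split; [lia|rewrite exprS].
by exists k; split; [lia|rewrite mul1r].
Qed.

Lemma fahom_scale_graded l x : (d <= l.+1)%N -> suppin (fun v => vdeg v = d /\ size v = l) x ->
  fahom (fun y => cfac y *: mono [:: y]) x = 2 ^+ (2 * l - d) *: x.
Proof.
move=> dl; move: x; apply: suppin_ind => [|v [vd vl]]; last by rewrite fahom_scale cfac_prod vd vl.
apply: (eq_subspace (f := fahom _) (g := fun x => _ *: x)); first exact: lin_fahom.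
by move=> c x y; rewrite scalerDr !scalerA mulrC.
Qed.

Lemma size_part_hat t : (tdeg t <= d)%N ->
  fahom glet (size_part 1 (mono [:: inl t] + hat (inl t))) = cfac (inl t) *: mono [:: inl t].
Proof.
move=> td; have [sS _ _ vS] := hS td.
rewrite (linear_funD (@lin_size_part _ _ 1)) size_part_mono fahomD fahom_letter /hat td /cfac /=.
case: eqP => [t1|t1].
  have [i ti] : exists i, t = TVar i.
    case: t t1 {td sS vS} => [i _|a b|a b]; first by exists i.
      by rewrite tdeg_circ; have := tdeg_gt0 a; have := tdeg_gt0 b; lia.
    by rewrite tdeg_bul; have := tdeg_gt0 a; have := tdeg_gt0 b; lia.
  by rewrite (vS i ti) size_part_mono fahom_letter /= ti scaler_nat mulr2n.
rewrite /size_part part_0; first by rewrite fahom0 addr0 scale1r.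
apply: suppinW sS => v [_ _ _ v1]; rewrite gtn_eqF // v1 // ltn_neqAle tdeg_gt0 andbT.
by apply/eqP => /esym.
Qed.

Lemma size_part_le x l : part (fun v => size v < l.+1)%N x =
  part (fun v => size v < l)%N x + size_part l x :> FY.
Proof.
apply/malgP => v; rewrite mcoeffD !mcoeff_part ltnS leq_eqVlt.
by case: ltngtP => _; rewrite ?addr0 ?add0r.
Qed.

Lemma etas_nonempty y : suppin (fun v => 0 < size v)%N (mono [:: y] + hat y).
Proof.
apply: (subspaceD (suppin_subspace _)); first exact: suppinU.
case: y => [t|[i|i w]]; rewrite /hat.
- case: ifP => [/hS /repK_supp h|_]; last exact: (subspace0 (suppin_subspace _)).
  by apply: suppinW h => -[|//] [].
- by apply: (subspaceN (suppin_subspace _)); exact: suppinU.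
by have [h _] := hC (l := Node i w) isT; apply: suppinW h => -[|//] [].
Qed.

(* In sizes 2 and 3 reversible words are Jordan.  In size l >= 4 each letter has degree at most 2,
   and the terms of least size in etas W - W, with X_i replaced by R(x_i), are 2 ^ (2 l - d) - 1
   times the part of W of size l. *)
Lemma jcomb_low W :
  suppin (fun v => [/\ all isG v, vdeg v = d & 1 < size v]%N) W ->
  rv W = W -> jcomb (etas W - W) -> jcomb W.
Proof.
move=> Ws rW JW.
have h l : jcomb (part (fun v => size v < l)%N W).
  elim: l => [|l IH].
    by rewrite part_0; [exact: (subspace0 jcomb_subspace)|exact: suppinT].
  rewrite size_part_le; apply: (subspaceD jcomb_subspace) => //.
  have Wl := suppin_partW (p := fun v => size v == l) Ws.
  have sl : suppin (fun v => size v == l) (size_part l W) by exact: suppin_part.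
  have [l3|l3] := leqP l 3.
    apply: jcomb_sym; last by rewrite /size_part rv_part_size rW.
    move=> v vW; have [vG vd v1] := Wl v vW; split=> //.
    by rewrite (ltnW v1) (eqP (sl v vW)).
  have [ld|dl] := leqP l d; last first.
    rewrite /size_part part_0; first exact: (subspace0 jcomb_subspace).
    apply: suppinW Ws => v [_ vd _]; rewrite ltn_eqF //.
    by apply: leq_ltn_trans dl; rewrite -vd size_leq_vdeg.
  (* The smaller sizes are Jordan by induction; subtracting them makes [l] the lowest size. *)
  pose W' := W - part (fun v => size v < l)%N W.
  have W'l : suppin (fun v => l <= size v)%N W'.
    rewrite /W' {1}(part_split (fun v => size v < l)%N W) addrAC subrr add0r.
    by apply: suppinW (@suppin_part _ _ (predC (fun v => size v < l)%N) W) => v; rewrite /= -leqNgt.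
  have sW' : size_part l W' = size_part l W.
    apply/malgP => v; rewrite !mcoeff_part mcoeffB mcoeff_part; case: eqP => // ->.
    by rewrite ltnn subr0.
  have JW' : jcomb (etas W' - W').
    rewrite etasB; set p := part _ _; have -> : etas W - etas p - (W - p) = (etas W - W) - (etas p - p).
      exact: addr_sub4.
    apply: (subspaceB jcomb_subspace) => //; apply: (subspaceB jcomb_subspace) => //.
    exact: jcomb_etas.
  have : jcomb (size_part l (etas W' - W')).
    by case: JW' => z hz; exact: (jrep_size_part (hat_jordan F) l hz).
  rewrite (linear_funB (@lin_size_part _ _ l)) size_part_fahom //; last exact: etas_nonempty.
  rewrite sW' => /jcomb_glet; rewrite fahomB fahom_comp.
  have -> : fahom glet (size_part l W) = size_part l W.
    rewrite -[RHS]fahom_id; apply: (eq_fahom_in (P := isG)); first by case.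
    by apply: suppinW Wl => v [/allP].
  have -> : fahom (fun y => fahom glet (size_part 1 (mono [:: y] + hat y))) (size_part l W) =
      2 ^+ (2 * l - d) *: size_part l W.
    rewrite (eq_fahom_in (g := fun y => cfac y *: mono [:: y]) (P := fun y => isG y /\ (ydeg y <= d)%N)).
    - apply: fahom_scale_graded; first exact: leq_trans d_le _.
      by move=> v vW; have [_ vd _] := Wl v vW; split=> //; exact/eqP/sl.
    - by case=> [t [_ td]|l' []//]; exact: size_part_hat.
    apply: suppinW Wl => v [/allP vG vd _] y yv; split; first exact: vG.
    by rewrite -vd mem_ydeg.
  (* A positive exponent makes the power of two minus 1 a positive integer, invertible in
     characteristic 0. *)
  have l0 : (0 < 2 * l - d)%N by lia.
  rewrite -[X in _ - X]scale1r -scalerBl => /(subspaceZ jcomb_subspace (2 ^+ (2 * l - d) - 1)^-1).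
  rewrite scalerA mulVf ?scale1r // -natrX.
  have p2 : (1 < 2 ^ (2 * l - d))%N by rewrite -{1}(expn0 2) ltn_exp2l.
  by rewrite -[1]/(1%:R) -natrB ?(ltnW p2) // (proj1 (pcharf0P F) charF0) -lt0n subn_gt0.
suff -> : W = part (fun v => size v < d.+1)%N W by exact: h.
apply/esym/part_id; apply: suppinW Ws => v [_ vd _].
by rewrite ltnS -vd size_leq_vdeg.
Qed.

Lemma ev2_hat : linear ev2 /\ {morph ev2 : x y / hatmul x y} /\
  (forall x, hatideal x -> hatideal (ev2 x)).
Proof.
split; first by move=> c x y; rewrite -[RHS]/(c *: x.2 + y.2, c *: x.2 + y.2).
by split=> [x y|x [_ h]]; [rewrite /ev2 /hatmul | split].
Qed.

(** The counterpart of sending every X_i to 0, which does not change a polynomial in letters G; it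
    normalizes the value of [W] to the form (0, r). *)
Definition ev02 (x : V) : V := (0, x.2).

Lemma ideal0 : N 0.
Proof. exact: subspace0 (@ideal_subspace F). Qed.

Lemma ev02_hat : linear ev02 /\ {morph ev02 : x y / hatmul x y} /\
  (forall x, hatideal x -> hatideal (ev02 x)).
Proof.
split; first by move=> c x y; rewrite -[RHS]/(c *: 0 + 0, c *: x.2 + y.2) scaler0 addr0.
split=> [x y|x [_ h]]; last by split=> //; exact: ideal0.
by rewrite /ev02 /hatmul /= (bilop0l (bwcirc_bil F)) !(bilop0l (bwbul_bil F)) !addr0.
Qed.

Lemma jcomb_value W : suppin (fun v => all isG v) W -> jcomb W ->
  exists r : bwpoly F, jr d W (0, r) /\ jr d (etas W) (r, r).
Proof.
move=> WG [z hz]; exists z.2; split.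
  have -> : W = fahom (fun y => if isX y then 0 else mono [:: y]) W.
    rewrite -[LHS]fahom_id; apply: (eq_fahom_in (P := isG)); first by case.
    by apply: suppinW WG => v /allP.
  have [l0 [m0 i0]] := ev02_hat.
  apply: (jrep_fahom (hat_jordan F) l0 m0 i0) hz => -[t|[i|//]] _ _.
    exact: (jr_letter (y := inl t)).
  exact: JRep0 (subspace0 (jordan_sub (hat_jordan F))).
have [l2 [m2 i2]] := ev2_hat.
exact: (jrep_fahom (hat_jordan F) l2 m2 i2 jr_hat hz).
Qed.

Section LinearPart.
Variables (t : bwterm) (g : {malg F[Y]}).
Hypothesis td : tdeg t = d.
Hypothesis gs : suppin (fun y => exists t', [/\ y = inl t', yok F y & tdeg t' = d]) g.
Hypothesis eg : linext (leadl F) g = leadl F (inl t).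

(** Below, [sg] is the combination of chosen letters with the same linear part as R(t), [q] is the
    rest of R(t), of order at least two, and [sr] lifts the amount by which the shift moves [q]. *)
Let evY y : U := if y is inl t' then ev F t' else 0.
Let SY y : FY := if y is inl t' then S t' else 0.
Let bY y : bwpoly F := if y is inl t' then bwt t' else 0.
Let sg : FY := linext (fun y => mono [:: y]) g.
Let q : U := RB (ev F t) - beta sg.
Let sr : FY := S t - linext SY g.

Let beta_sg : beta sg = linext (betal F) g.
Proof.
rewrite /sg (linext_comp (@beta F)); apply: eq_linext => y; exact: fahom_letter.
Qed.

Let q_supp : suppin (fun w => [/\ wdeg w = d, wleaf w = 0 & 2 <= size w]%N) q.
Proof.
have qd : suppin (fun w => noleaf w /\ wdeg w = d) q.
  apply: (subspaceB (suppin_subspace _)); first by rewrite -td; exact: RBev_supp.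
  rewrite beta_sg; apply: (subspace_linext (suppin_subspace _)) => y /gs [t' [-> _ <-]].
  exact: RBev_supp.
have q1 : part (fun w => size w == 1%N) q = 0.
  rewrite /q beta_sg (linear_funB (lin_part _)) (linext_comp (part _)).
  by rewrite -[X in _ - X]/(linext (leadl F) g) eg subrr.
move=> w wq; have [/wleaf0 nw dw] := qd w wq; split=> //.
case: w wq dw {nw} => [|a [|b w]] // wq dw; first by have := tdeg_gt0 t; rewrite td -dw.
have := mcoeff_part (fun w => size w == 1%N) q [:: a].
by rewrite q1 mcoeff0 /= => /esym/eqP; rewrite (negPf (_ : q@_[:: a] != 0)) // mcoeff_neq0.
Qed.

Let shift_q : eta_hom q = q + beta sr.
Proof.
have e1 : eta_hom (beta sg) = beta sg + linext evY g.
  rewrite beta_sg; move: g gs; apply: suppin_ind => [|_ [t' [-> _ _]]]; last first.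
    by rewrite !linextU; exact: eta_RBev.
  apply: (eq_subspace (f := fun g => eta_hom (linext (betal F) g))
    (g := fun g => linext _ g + linext evY g)).
    exact: (lin_comp (@lin_eta F) (linextP _)).
  exact: (lin_add (linextP _) (linextP _)).
have e2 : beta (linext SY g) = linext evY g.
  move: g gs; apply: suppin_ind => [|_ [t' [-> _ td']]]; last first.
    by rewrite !linextU; apply: repK_beta; apply: hS; rewrite td'.
  apply: (eq_subspace (f := fun g => beta (linext SY g))).
    exact: (lin_comp (@lin_beta F) (linextP _)).
  exact: linextP.
rewrite /q /sr (linear_funB (@lin_eta F)) eta_RBev e1 (linear_funB (@lin_beta F)) e2.
rewrite (repK_beta (hS (eq_leq td))); exact: addr_subD4.
Qed.

Lemma repR_lead : exists W, repR t W.
Proof.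
have [W Wq eW] := beta_sur q_supp.
have WA : suppin (wordin Aok) W.
  move=> v vW y yv; have [vk vd vl _] := Wq v vW; split; first exact: vk.
    apply/negP => yX; have /perm_to_rem pv := yv.
    move: vl; rewrite /vleaf (perm_sumn (perm_map _ pv)) /=.
    by case: y yX {yv pv} => [//|l] /= ->.
  by rewrite -vd mem_ydeg.
have W2 : suppin (fun v => 1 < size v)%N W by apply: suppinW Wq => v [].
have srs : suppin (fun v => okword F v /\ ~~ has isC v) sr.
  have hs t' : tdeg t' = d -> suppin (fun v => okword F v /\ ~~ has isC v) (S t').
    by move=> td'; apply: suppinW (repK_supp (hS (eq_leq td'))) => v [].
  apply: (subspaceB (suppin_subspace _)); first exact: hs.
  by apply: (subspace_linext (suppin_subspace _)) => y /gs [t' [-> _ /hs]].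
(* Both sides have the image [q + beta sr] in U, and [beta] is injective on words in chosen
   letters. *)
have eWs : etas W = W + sr.
  apply/eqP; rewrite -subr_eq0; apply/eqP; apply: beta_inj.
    apply: (subspaceB (suppin_subspace _)); first exact: etas_ok.
    apply: (subspaceD (suppin_subspace _)); first by apply: suppinW Wq => v [].
    by apply: suppinW srs => v [].
  rewrite (linear_funB (@lin_beta F)) (linear_funD (@lin_beta F)) beta_etas // eW shift_q.
  exact: subrr.
have WC := stepA WA W2 eWs (suppinW (fun v => @proj2 _ _) srs).
have WG : suppin (fun v => all isG v) W.
  move=> v vW; apply/allP => y yv; have /hasPn /(_ y yv) := WC v vW.
  by have [_ yX _] := WA v vW y yv; case: y yX {yv} => [|[]].
pose r := bwt t - linext bY g.
have jsr : jr d sr (r, 0).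
  have -> : (r, 0) = (bwt t, 0) - linext (fun y => (bY y, 0)) g :> V.
    by rewrite linext_pair linext0 pair_subE subr0.
  apply: jrepB; first by rewrite -{1}td; exact: repK_jr (hS (eq_leq td)).
  apply: (jrep_linext (hat_jordan F)) => y /gs [t' [-> _ td']].
  by rewrite -td'; exact: repK_jr (hS (eq_leq td')).
have rW : rv W = W by apply: stepB eWs (jrep_rv jsr).
have JW : jcomb W.
  apply: jcomb_low => //; last by rewrite eWs addrAC subrr add0r; exists (r, 0).
  by move=> v vW; have [_ vd _ v1] := Wq v vW; split=> //; exact: WG.
have [z [hz hz2]] := jcomb_value WG JW.
(* The value (0, z) of W gives (z, z) for [etas W] and (r, z) for [W + sr]. These are one Jordan
   polynomial of degree at most 6, so z and r agree modulo N. *)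
have jW : jr d W (0, r).
  have := jrepB hz2 (JRepD hz jsr); rewrite eWs subrr.
  move=> /(jrep_eq0 charF0 (hat_jordan F) ydeg_gt0 (leqW d_le)) [h _].
  have zr : hatideal ((0, r) - (0, z)).
    rewrite pair_subE subrr; split; first exact: ideal0.
    by have := subspaceN (@ideal_subspace F) h; rewrite /= add0r opprB.
  exact: (jrep_mod zr hz).
exists (W + sg); split.
- apply: (subspaceD (suppin_subspace _)).
    by move=> v vW; have [vk _ _ v2] := Wq v vW; split; [|exact: WG|exact: ltnW].
  apply: (subspace_linext (suppin_subspace _)) => y /gs [t' [-> yk _]].
  by apply: suppinU; split=> // y'; rewrite inE => /eqP ->.
- rewrite td; have -> : (0, bwt t) = (0, r) + linext (fun y => (0, bY y)) g :> V.
    by rewrite linext_pair linext0 pair_addE addr0 subrK.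
  apply: JRepD jW _; apply: (jrep_linext (hat_jordan F)) => y /gs [t' [-> _ <-]].
  exact: (jr_letter (y := inl t')).
by rewrite (linear_funD (@lin_beta F)) eW subrK.
Qed.

End LinearPart.

Lemma repR_step t : tdeg t = d -> exists W, repR t W.
Proof.
move=> td; have [g hg eg] := yok_span F (inl t); apply: (repR_lead td _ eg) => y /hg [yk yt cy].
case: y yk yt cy => [t'|l] yk yt cy; last by case/orP: yt.
by exists t'; split=> //; case: cy => ->.
Qed.

End Step.
Lemma repK_var_exists i : exists s, repK (TVar i) s.
Proof.
exists (mono [:: inr (Leaf i)]); split.
- apply: suppinU; split=> // y; rewrite inE => /eqP ->; exact: yok_leaf.
- exact: (jr_letter (y := inr (Leaf i))).
- exact: fahom_letter.
by move=> j [->].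
Qed.

Lemma okword_cat (u v : seq Y) : okword F u -> okword F v -> okword F (u ++ v).
Proof. by move=> hu hv y; rewrite mem_cat => /orP[/hu|/hv]. Qed.

Lemma hasX_size v : has isX v -> (0 < size v)%N.
Proof. by case: v. Qed.

Lemma repK_circ a b sa sb : repK a sa -> repK b sb -> exists s, repK (TCirc a b) s.
Proof.
move=> [ka ja ba _] [kb jb bb _]; exists (sa * sb + sb * sa); split=> //.
- apply: (subspaceD (suppin_subspace _)); [apply: suppinM ka kb|apply: suppinM kb ka];
    move=> u v [uk uX uC _] [vk vX vC _]; rewrite !has_cat uX (negPf uC) size_cat;
    by split=> //; [exact: okword_cat|move=> _; exact: leq_add (hasX_size uX) (hasX_size vX)].
- rewrite tdeg_circ; have := jr_mul ja jb; rewrite /hatmul /= bwcirc_bwt.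
  by rewrite !(bilop0l (bwcirc_bil F)) !(bilop0l (bwbul_bil F)) !(bilop0r (bwbul_bil F)) !addr0.
by rewrite (linear_funD (@lin_beta F)) /beta !fahomM -!/(beta _) ba bb.
Qed.

Lemma repK_bul a b sa wb : repK a sa -> repR b wb -> exists s, repK (TBul a b) s.
Proof.
move=> [ka ja ba _] [kb jb bb]; exists (sa * wb + wb * sa); split=> //.
- have GC v : all isG v -> ~~ has isC v.
    by move=> /allP h; apply/hasPn => y /h; case: y.
  apply: (subspaceD (suppin_subspace _)).
    apply: suppinM ka kb => u v [uk uX uC _] [vk vG v0].
    rewrite !has_cat uX (negPf uC) (negPf (GC v vG)) size_cat; split=> //; first exact: okword_cat.
    by move=> _; exact: leq_add (hasX_size uX) v0.
  apply: suppinM kb ka => v u [vk vG v0] [uk uX uC _].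
  rewrite !has_cat uX orbT (negPf uC) (negPf (GC v vG)) size_cat; split=> //; first exact: okword_cat.
  by move=> _; exact: leq_add v0 (hasX_size uX).
- rewrite tdeg_bul; have := jr_mul ja jb; rewrite /hatmul /= bwbul_bwt.
  rewrite !(bilop0l (bwcirc_bil F)) !(bilop0l (bwbul_bil F)) !(bilop0r (bwbul_bil F)).
  by rewrite (bilop0r (bwcirc_bil F)) !addr0 add0r.
by rewrite (linear_funD (@lin_beta F)) /beta !fahomM -!/(beta _) ba bb.
Qed.

(** Lifting [TBul a b] requires a lift of R(b), where [b] has degree at most 5; lifting R(t) in turn
    requires lifts of the terms of degree up to that of [t]. Hence the two bounds and the joint
    induction. *)
Lemma rep_exists n t : (n <= 6)%N -> (tdeg t <= n)%N ->
  (exists s, repK t s) /\ ((tdeg t <= 5)%N -> exists s, repR t s).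
Proof.
elim: n t => [|n IH] t n6 tn; first by have := tdeg_gt0 t; rewrite ltnNge tn.
have {}IH t' : (tdeg t' <= n)%N -> (exists s, repK t' s) /\ (exists s, repR t' s).
  move=> t'n; have [hK hR] := IH t' (ltnW n6) t'n; split=> //.
  by apply: hR; exact: leq_trans t'n _.
have K t' : (tdeg t' <= n.+1)%N -> exists s, repK t' s.
  case: t' => [i|a b|a b] ab; first exact: repK_var_exists.
    rewrite tdeg_circ in ab; have a0 := tdeg_gt0 a; have b0 := tdeg_gt0 b.
    have [|[sa ha] _] := IH a; first by lia.
    by have [|[sb hb] _] := IH b; [lia|exact: repK_circ ha hb].
  rewrite tdeg_bul in ab; have a0 := tdeg_gt0 a; have b0 := tdeg_gt0 b.
  have [|[sa ha] _] := IH a; first by lia.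
  by have [|_ [wb hb]] := IH b; [lia|exact: repK_bul ha hb].
split=> [|t5]; first exact: K.
have /choice [S hS] : forall t', exists s, (tdeg t' <= tdeg t)%N -> repK t' s.
  move=> t'; have [le|_] := boolP (tdeg t' <= tdeg t)%N; last by exists 0.
  by have [s hs] := K t' (leq_trans le tn); exists s.
have [C hC] := hatC_exists.
exact: (repR_step hS hC t5).
Qed.

Lemma repK_exists t : (tdeg t <= 6)%N -> exists s, repK t s.
Proof. by move=> t6; have [] := rep_exists (leqnn 6) t6. Qed.

End Representations.

Theorem proposition6p8 (F : fieldType) (charF0 : [pchar F] =i pred0)
    (n : nat) (le_n6 : (n <= 6)%N) (f : bwpoly F) :
  tridendriform_identity n f -> bw_consequence (@post_jordan_identity F) n f.
Proof.
move=> idf; have [fBW _] := idf; apply: (post_jordan_ideal_consequence fBW).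
have deg m : m \in msupp f -> tdeg (repr m) = n.
  move=> mf; have /allP /(_ m mf) := fBW.
  by rewrite /bwmon_multilinear => /perm_size; rewrite size_iota.
have /choice [S hS] : forall t, exists s, (tdeg t <= 6)%N -> repK (F := F) t s.
  move=> t; have [t6|_] := boolP (tdeg t <= 6)%N; last by exists 0.
  by have [s hs] := repK_exists charF0 t6; exists s.
have {}hS m : m \in msupp f -> repK (repr m) (S (repr m)).
  by move=> mf; apply: hS; rewrite deg.
pose s := linext (fun m : bwmon => S (repr m)) f.
(* The image of [s] under [beta] is the value of [f] at the generators x_i, and [beta] is injective
   on words in chosen letters. *)
have s0 : s = 0.
  apply: beta_inj.
    apply: (subspace_linext (suppin_subspace _)) => m /hS /repK_supp h.
    by apply: suppinW h => v [].
  rewrite /s (linext_comp (@beta F)) -[RHS](ev_identity idf).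
  by apply: eq_linext_in => m /hS /repK_beta.
have : jr n s (linext (fun m : bwmon => (bwt (repr m), 0)) f).
  apply: (jrep_linext (hat_jordan F)) => m mf; rewrite -(deg m mf); exact: repK_jr (hS m mf).
rewrite s0 => /(jrep_eq0 charF0 (hat_jordan F) ydeg_gt0 le_n6).
rewrite linext_pair linext0 => -[+ _]; rewrite /fst.
by rewrite (eq_linext (h2 := mono)) ?linext_id // => m; exact: bwt_repr.
Qed.
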